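(* There exists an algorithm that solves the Bandwidth problem in $O(4.83^n)$ time and $O^*(4^n)$ space.
   Context: Let $G=(V,E)$ be an undirected graph with $n=|V|$. For a one-to-one ordering $\pi: V \to \{1,\ldots,n\}$, its bandwidth is $\max_{uv\in E}|\pi(u)-\pi(v)|$; the bandwidth of $G$ is the minimum bandwidth over all orderings. The Bandwidth problem asks to find an ordering of minimum bandwidth (decision version: given an integer $b$ with $1\le b<n$, decide whether an ordering of bandwidth at most $b$ exists and if so find one). $O^*$ denotes big-$O$ notation omitting polynomial factors. *)

(* Defs.v *)
From HB Require Import structures.
From mathcomp Require Import all_boot all_order all_algebra.

Set Implicit Arguments.
Unset Strict Implicit.
Unset Printing Implicit Defensive.

Section Bandwidth.
Variables (V : finType) (e : rel V).

Definition ordering (pi : V -> nat) : Prop :=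
  injective pi /\ forall v, 1 <= pi v <= #|V|.

Definition ordering_bandwidth (pi : V -> nat) : nat :=
  \max_(u : V) \max_(v : V | e u v) `|pi u - pi v|%N.

Definition minimum_ordering (pi : V -> nat) : Prop :=
  ordering pi /\
  forall sigma, ordering sigma ->
    ordering_bandwidth pi <= ordering_bandwidth sigma.

End Bandwidth.

(* "Algorithm" means a program of a random access machine under the
   logarithmic cost criterion (Cook-Reckhow; Aho-Hopcroft-Ullman): words are
   unbounded naturals, and every number that an instruction handles, address
   or value, is charged its binary length.  Registers are addressed by
   constants of the program, memory cells by the contents of registers. *)

Variant binop := Add | Sub | Mul | Div.

Variant instr :=
| IConst (d k : nat)               (* R[d] := k *)
| IOp (o : binop) (d a b : nat)    (* R[d] := R[a] o R[b] *)
| ILoad (d a : nat)                (* R[d] := M[R[a]] *)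
| IStore (a b : nat)               (* M[R[a]] := R[b] *)
| IJump (l : nat)
| IJumpZ (a l : nat).              (* goto l if R[a] = 0 *)

Definition program := seq instr.

(* Registers and cells beyond the end of [regs] and [memory] hold 0. *)
Record config := Config { pc : nat; regs : seq nat; memory : seq nat }.

(* [Sub] is truncated, and division by 0 returns 0. *)
Definition eval_binop (o : binop) : nat -> nat -> nat :=
  match o with Add => addn | Sub => subn | Mul => muln | Div => divn end.

(* Binary length, with [bitlen 0 = 1]. *)
Definition bitlen (x : nat) : nat := (trunc_log 2 x).+1.

Definition exec_instr (i : instr) (c : config) : config :=
  let R := nth 0 (regs c) in
  let M := nth 0 (memory c) in
  match i with
  | IConst d k => Config (pc c).+1 (set_nth 0 (regs c) d k) (memory c)
  | IOp o d a b =>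
      Config (pc c).+1 (set_nth 0 (regs c) d (eval_binop o (R a) (R b))) (memory c)
  | ILoad d a => Config (pc c).+1 (set_nth 0 (regs c) d (M (R a))) (memory c)
  | IStore a b => Config (pc c).+1 (regs c) (set_nth 0 (memory c) (R a) (R b))
  | IJump l => Config l (regs c) (memory c)
  | IJumpZ a l => Config (if R a == 0 then l else (pc c).+1) (regs c) (memory c)
  end.

Definition instr_cost (i : instr) (c : config) : nat :=
  let R := nth 0 (regs c) in
  let M := nth 0 (memory c) in
  match i with
  | IConst d k => bitlen d + bitlen k
  | IOp _ d a b =>
      bitlen d + (bitlen a + bitlen (R a)) + (bitlen b + bitlen (R b))
  | ILoad d a => bitlen d + (bitlen a + bitlen (R a) + bitlen (M (R a)))
  | IStore a b => (bitlen a + bitlen (R a)) + (bitlen b + bitlen (R b))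
  | IJump _ => 1
  | IJumpZ a _ => bitlen a + bitlen (R a)
  end.

(* [set_nth] pads with zeros, so every cell up to the largest address ever
   written is charged at least one bit, whether it is used or not. *)
Definition config_space (c : config) : nat :=
  \sum_(x <- regs c) bitlen x + \sum_(x <- memory c) bitlen x.

(* [run P c t s c']: started in [c], the program [P] halts in [c'], after
   instructions of total cost [t], and [s] is the maximum space of the
   configurations on the way, [c] and [c'] included.  The machine halts when
   [pc] leaves the program. *)
Inductive run (P : program) : config -> nat -> nat -> config -> Prop :=
| run_halt c : onth P (pc c) = None -> run P c 0 (config_space c) c
| run_step c i t s c' :
    onth P (pc c) = Some i ->
    run P (exec_instr i c) t s c' ->
    run P c (instr_cost i c + t) (maxn (config_space c) s) c'.

(* The input is [n] followed by the adjacency matrix, row by row. *)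
Definition graph_code (n : nat) (e : rel 'I_n) : seq nat :=
  n :: [seq nat_of_bool (e i j) | i <- enum 'I_n, j <- enum 'I_n].

(* The vertex set is 'I_n; the output is the ordering, with the position of
   vertex [v] in memory cell [v]. *)
Definition solves_bandwidth (P : program) (T S : nat -> nat) : Prop :=
  forall (n : nat) (e : rel 'I_n), symmetric e -> irreflexive e ->
  exists (t s : nat) (c : config),
    [/\ run P (Config 0 [::] (graph_code e)) t s c,
        minimum_ordering e (fun v : 'I_n => nth 0 (memory c) v),
        t <= T n & s <= S n].

(* Only used for nonnegative functions. *)
Definition bigO (f g : nat -> rat) : Prop :=
  exists (C : rat) (n0 : nat), forall n, n0 <= n -> (f n <= C * g n)%R.

Definition bigOstar (f g : nat -> rat) : Prop :=
  exists k : nat, bigO f (fun n => n%:R ^+ k * g n)%R.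

(* Main.v *)
Require Import Defs.
From mathcomp Require Import all_boot all_order all_algebra zify.

(* Fix [b] and cut the positions of a connected component with [m] vertices into
   segments of [b + 1] consecutive positions.  An ordering has bandwidth at most
   [b] iff the ends of every edge lie in equal or neighbouring segments, and in
   the latter case the end in the right segment has the smaller offset.  So if
   the positions are filled in the lexicographic order of (offset within the
   segment, segment), then whether a vertex may come next depends only on the set
   of the placed vertices and on the segments.

   Segments are guessed only for one class of a 2-colouring of a spanning tree:
   freely for the root, with 5 choices relative to the grandparent for the
   others.  An unguessed vertex has 3 possible segments relative to its parent,
   chosen when it is placed.  A state of the search is thus a word of [m] digits
   in base 4 (0 for an unplaced vertex), and the states reached are marked in an
   array of length [4 ^ m].

   States are discarded if some unguessed vertex has no segment that agrees with
   its digit and with its guessed neighbours.  Counting the pairs (guess,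
   remaining state) along the tree gives [O (m * 4 ^ t * (28 / 5) ^ g)] of them,
   for [t] unguessed vertices and [g] guessed ones besides the root; the colouring
   can be chosen with [g <= t], and [4 * 28 / 5 < (19 / 4) ^ 2] where
   [19 / 4 < 4.83].

   The algorithm is written in a small imperative language with a compiler to
   the machine.  Besides [for] loops of polynomial length it has [while] loops;
   a counter [tk] of their iterations is bounded by the number of such pairs. *)

Set Implicit Arguments.
Unset Strict Implicit.
Unset Printing Implicit Defensive.

(** * Execution of the machine *)

(** A mark is the serial number of the search that set it, so one array of length [4 ^ m] serves all
    guesses and is never cleared. Clearing it for each of about [5 ^ g] guesses would cost about
    [4 ^ m * 5 ^ g], which is far too much. Time is therefore charged to the pairs (guess, state)
    that are really reached.

    The origin of [28 / 5]: for an unguessed vertex with [c] guessed children, the digits of the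
    vertex together with the guesses and placements of the children have at most 4, 22 or
    [5 * 5 ^ c] combinations for [c = 0], [c = 1] and [c >= 2]. The bound [4 * (28 / 5) ^ c] covers
    all of them, narrowly for one child ([22 <= 22.4]) and for two ([125 <= 125.44]). A guessed
    vertex thus costs more than an unguessed one, so the smaller colour class has to be the guessed
    one. One vertex of each kind costs [22.4 < 22.5625 = (19 / 4) ^ 2], and the gap between 4.75 and
    4.83 absorbs all polynomial factors, the word length included.

    Components are solved separately and laid out one after the other. This is optimal because no
    edge joins two components, and an ordering of the whole graph restricts to each of them without
    any loss of bandwidth. *)

Definition reg (c : config) x := nth 0 (regs c) x.
Definition cell (c : config) i := nth 0 (memory c) i.
Definition set_reg c d v := Config (pc c).+1 (set_nth 0 (regs c) d v) (memory c).
Definition set_cell c i v := Config (pc c).+1 (regs c) (set_nth 0 (memory c) i v).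
Definition jump_to c l := Config l (regs c) (memory c).

Lemma reg_set c d v x : reg (set_reg c d v) x = if x == d then v else reg c x.
Proof. by rewrite /reg nth_set_nth. Qed.

Lemma reg_jump c l x : reg (jump_to c l) x = reg c x. Proof. by []. Qed.

Lemma cell_reg c d v x : cell (set_reg c d v) x = cell c x. Proof. by []. Qed.

Lemma pc_set_reg c d v : pc (set_reg c d v) = (pc c).+1. Proof. by []. Qed.

Lemma pc_set_cell c d v : pc (set_cell c d v) = (pc c).+1. Proof. by []. Qed.

Lemma pc_jump c l : pc (jump_to c l) = l. Proof. by []. Qed.

Arguments set_reg : simpl never.
Arguments set_cell : simpl never.
Arguments jump_to : simpl never.
Arguments reg : simpl never.
Arguments cell : simpl never.

Lemma cell_set c d v x : cell (set_cell c d v) x = if x == d then v else cell c x.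
Proof. by rewrite /cell nth_set_nth. Qed.

Lemma bitlen_le x b : 0 < b -> x < 2 ^ b -> bitlen x <= b.
Proof.
move=> b0 xb; rewrite /bitlen; case: (posnP x) => [->|x0]; first by rewrite trunc_log0.
by rewrite -(ltn_exp2l _ _ (isT : 1 < 2)) (leq_ltn_trans (trunc_logP _ x0)).
Qed.

Definition operands_ok NR (i : instr) : bool :=
  match i with
  | IConst d k => (d < NR) && (k < NR)
  | IOp _ d a b => [&& d < NR, a < NR & b < NR]
  | ILoad d a => (d < NR) && (a < NR)
  | IStore a b => (a < NR) && (b < NR)
  | IJump _ => true
  | IJumpZ a _ => a < NR
  end.

Lemma all_onth (T : Type) (a : pred T) s k x : all a s -> onth s k = Some x -> a x.
Proof.
by elim: s k => [|y s IH] [|k] //= /andP[ay sa]; [case=> <-|apply: IH].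
Qed.

Section Execution.
Variables NR LB MS : nat.
Hypothesis NR_LB : NR <= 2 ^ LB.
Hypothesis LB_gt0 : 0 < LB.
Variable P : program.

Definition within c :=
  [/\ size (regs c) <= NR, forall x, reg c x < 2 ^ LB,
      size (memory c) <= MS & forall i, cell c i < 2 ^ LB].

(** Instructions are merely counted. Since every configuration on the way satisfies [within], the
    count is turned into logarithmic cost and space once and for all in [steps_run]. *)
Inductive steps : nat -> config -> config -> Prop :=
| steps_nil c : within c -> steps 0 c c
| steps_cons k c i c' :
    within c -> onth P (pc c) = Some i -> steps k (exec_instr i c) c' ->
    steps k.+1 c c'.

Lemma steps_trans k1 k2 c1 c2 c3 :
  steps k1 c1 c2 -> steps k2 c2 c3 -> steps (k1 + k2) c1 c3.
Proof. by elim=> [//|k c i c' ok Pi _ IH /IH]; apply: steps_cons. Qed.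

Lemma sum_bitlen_le (s : seq nat) :
  (forall i, nth 0 s i < 2 ^ LB) -> \sum_(x <- s) bitlen x <= size s * LB.
Proof.
move=> sP; rewrite (big_nth 0) -[size s]subn0 -sum_nat_const_nat subn0.
by apply: leq_sum => i _; apply: bitlen_le.
Qed.

Lemma config_space_le c : within c -> config_space c <= (NR + MS) * LB.
Proof.
case=> szr rb szm mb; rewrite /config_space mulnDl leq_add //.
  by rewrite (leq_trans (sum_bitlen_le rb)) // leq_mul2r szr orbT.
by rewrite (leq_trans (sum_bitlen_le mb)) // leq_mul2r szm orbT.
Qed.

Lemma instr_cost_le c i :
  within c -> operands_ok NR i -> instr_cost i c <= 6 * LB.
Proof.
case=> _ rb _ mb; have L x : x < NR -> bitlen x <= LB.
  by move=> xN; apply: bitlen_le => //; apply: leq_trans NR_LB.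
have Lr x : bitlen (nth 0 (regs c) x) <= LB by apply: bitlen_le => //; apply: rb.
have Lm x : bitlen (nth 0 (memory c) x) <= LB by apply: bitlen_le => //; apply: mb.
case: i => [d k|o d a b|d a|a b|l|a l] /=.
- by case/andP=> /L ? /L ?; lia.
- by case/and3P=> /L ? /L ? /L ?; move: (Lr a) (Lr b); lia.
- by case/andP=> /L ? /L ?; move: (Lr a) (Lm (nth 0 (regs c) a)); lia.
- by case/andP=> /L ? /L ?; move: (Lr a) (Lr b); lia.
- by lia.
- by move=> /L ?; move: (Lr a); lia.
Qed.

Lemma steps_run k c c' :
  all (operands_ok NR) P -> steps k c c' -> onth P (pc c') = None ->
  exists t s, [/\ run P c t s c', t <= k * (6 * LB) & s <= (NR + MS) * LB].
Proof.
move=> okP; elim=> {k c c'} [c ok halt|k c i c' ok Pi _ IH /IH[t [s [r tk sk]]]].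
  by exists 0, (config_space c); split; [apply: run_halt| |apply: config_space_le].
exists (instr_cost i c + t), (maxn (config_space c) s); split.
- exact: run_step Pi r.
- rewrite mulSn leq_add // instr_cost_le //.
  exact: all_onth okP Pi.
- by rewrite geq_max config_space_le.
Qed.

Definition reach k c (Q : config -> Prop) :=
  exists k' c', [/\ k' <= k, steps k' c c' & Q c'].

Lemma reach_done k c (Q : config -> Prop) : within c -> Q c -> reach k c Q.
Proof. by exists 0, c; split=> //; apply: steps_nil. Qed.

Lemma reach_bind k1 k2 c (Q Q' : config -> Prop) :
  reach k1 c Q -> (forall c', Q c' -> within c' -> reach k2 c' Q') ->
  reach (k1 + k2) c Q'.
Proof.
move=> [k [c' [kk r Qc]]] H; have ok : within c' by elim: r.
have [k' [c2 [kk' r' Qc2]]] := H _ Qc ok.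
by exists (k + k'), c2; split=> //; [apply: leq_add|apply: steps_trans r'].
Qed.

Lemma reach_weaken k1 k2 c (Q Q' : config -> Prop) :
  reach k1 c Q -> k1 <= k2 -> (forall c', Q c' -> Q' c') -> reach k2 c Q'.
Proof.
move=> [k [c' [kk r Qc]]] k12 QQ.
by exists k, c'; split=> //; [apply: leq_trans k12|apply: QQ].
Qed.

Lemma reach_step k c i Q :
  within c -> onth P (pc c) = Some i -> reach k (exec_instr i c) Q ->
  reach k.+1 c Q.
Proof.
by move=> ok Pi [k' [c' [kk r Qc]]]; exists k'.+1, c'; split=> //; apply: steps_cons r.
Qed.

Lemma within_set_reg c d v :
  within c -> d < NR -> v < 2 ^ LB -> within (set_reg c d v).
Proof.
case=> ? rb ? ? dN vL; split=> //; first by rewrite size_set_nth geq_max dN.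
by move=> x; rewrite reg_set; case: ifP.
Qed.

Lemma reach_set_reg k c i d v Q :
  within c -> onth P (pc c) = Some i -> exec_instr i c = set_reg c d v ->
  d < NR -> v < 2 ^ LB ->
  (within (set_reg c d v) -> reach k (set_reg c d v) Q) -> reach k.+1 c Q.
Proof.
move=> ok Pi E dN vL H; apply: reach_step Pi _ => //.
by rewrite E; apply: H; apply: within_set_reg.
Qed.

Lemma reach_set_cell k c a b Q :
  within c -> onth P (pc c) = Some (IStore a b) -> reg c a < MS ->
  (within (set_cell c (reg c a) (reg c b)) ->
   reach k (set_cell c (reg c a) (reg c b)) Q) -> reach k.+1 c Q.
Proof.
move=> ok Pi aM H; apply: reach_step Pi _ => //; apply: H.
case: ok => ? rb ? mb; split=> //; first by rewrite size_set_nth geq_max aM.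
by move=> x; rewrite cell_set; case: ifP.
Qed.

Lemma reach_jump k c l Q :
  within c -> onth P (pc c) = Some (IJump l) ->
  reach k (jump_to c l) Q -> reach k.+1 c Q.
Proof. by move=> ok Pi H; apply: reach_step Pi _. Qed.

Lemma reach_jumpz k c a l Q :
  within c -> onth P (pc c) = Some (IJumpZ a l) ->
  reach k (jump_to c (if reg c a == 0 then l else (pc c).+1)) Q ->
  reach k.+1 c Q.
Proof. by move=> ok Pi H; apply: reach_step Pi _. Qed.

Definition code_at l (code : seq instr) :=
  forall i, i < size code -> onth P (l + i) = onth code i.

Lemma code_at_cat l c1 c2 :
  code_at l (c1 ++ c2) -> code_at l c1 /\ code_at (l + size c1) c2.
Proof.
move=> H; split=> i ic.
  by rewrite H ?size_cat ?ltn_addr // onth_cat ic.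
rewrite -addnA H ?size_cat ?ltn_add2l // onth_cat.
by rewrite ltnNge leq_addr /= addKn.
Qed.

Lemma code_at_cons l i c1 :
  code_at l (i :: c1) -> onth P l = Some i /\ code_at l.+1 c1.
Proof.
move=> H; split; first by have := H 0 isT; rewrite addn0.
by move=> j jc; rewrite addSnnS (H j.+1).
Qed.

End Execution.

(** * An imperative language and its compiler *)

(** Only variables below [nsmall] may bound loops, sums and products. Their values stay at most [N],
    later linear in the number of vertices, so these constructs have polynomial length. The other
    variables may hold exponentially large numbers such as states and guesses. *)
Definition nvars := 24.
Definition narr := 12.
Definition nsmall := 12.

Variant dop := OAdd | OSub | OMul | ODiv | OMod | OEq | OLt.

(** [EBnd] is a de Bruijn index for the variables bound by [EBig], whose flag selects a product
    ([true]) or a sum ([false]). *)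
Inductive expr :=
| ECst (k : nat)
| EVar (x : nat)
| EBnd (i : nat)
| EArr (a : nat) (e : expr)
| EBin (o : dop) (e1 e2 : expr)
| EBig (o : bool) (e1 e2 : expr).

(** [CGet] and [CPut] access array 0, the initial stretch of the memory with the input and the
    output. All other arrays lie behind it. *)
Inductive cmd :=
| CSkip
| CAsg (x : nat) (e : expr)
| CGet (x : nat) (e : expr)
| CSet (a : nat) (e1 e2 : expr)
| CPut (e1 e2 : expr)
| CSeq (c1 c2 : cmd)
| CIf (e : expr) (c1 c2 : cmd)
| CLoop (x y : nat) (c : cmd)
| CWhile (e : expr) (c : cmd).

Record state := State {vr : nat -> nat; ar : nat -> nat -> nat; tk : nat}.

(** With [eqn] instead of [==], simplification decides the comparison of two concrete variables, so
    reading an updated state computes. *)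
Definition setv s x v :=
  State (fun y => if eqn y x then v else vr s y) (ar s) (tk s).
Definition seta s a i v :=
  State (vr s)
    (fun b => if eqn b a then (fun j => if j == i then v else ar s b j) else ar s b)
    (tk s).
Definition tick s := State (vr s) (ar s) (tk s).+1.

Definition evop o a b :=
  match o with
  | OAdd => a + b | OSub => a - b | OMul => a * b | ODiv => a %/ b
  | OMod => a %% b | OEq => nat_of_bool (a == b) | OLt => nat_of_bool (a < b)
  end.

Fixpoint eval s (rho : seq nat) e : nat :=
  match e with
  | ECst k => k
  | EVar x => vr s x
  | EBnd i => nth 0 rho i
  | EArr a e => ar s a (eval s rho e)
  | EBin o e1 e2 => evop o (eval s rho e1) (eval s rho e2)
  | EBig o e1 e2 =>
      if o then \prod_(0 <= i < eval s rho e1) eval s (i :: rho) e2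
      else \sum_(0 <= i < eval s rho e1) eval s (i :: rho) e2
  end.

(** Register [nvars] is left out because it holds the base address of the arrays. The registers
    behind it form the stack on which expressions are evaluated. *)
Definition tmp d := nvars.+1 + d.

(** Truncated subtraction is the only comparison at hand: equality is [1 - ((x - y) + (y - x))],
    order is [1 - (1 - (y - x))]. The remainder [x - x %/ y * y] is right for [y = 0] as well, since
    division by 0 gives 0. *)
Definition comp_op o d : seq instr :=
  let t := tmp d in let u := tmp d.+1 in let v := tmp d.+2 in
  match o with
  | OAdd => [:: IOp Add t t u]
  | OSub => [:: IOp Defs.Sub t t u]
  | OMul => [:: IOp Mul t t u]
  | ODiv => [:: IOp Div t t u]
  | OMod => [:: IOp Div v t u; IOp Mul v v u; IOp Defs.Sub t t v]
  | OEq => [:: IOp Defs.Sub v t u; IOp Defs.Sub t u t; IOp Add t t v; IConst v 1; IOp Defs.Sub t v t]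
  | OLt => [:: IOp Defs.Sub t u t; IConst v 1; IOp Defs.Sub t v t; IOp Defs.Sub t v t]
  end.

(** The arrays are interleaved. Hence no array length enters the code, and the memory used is linear
    in the largest index. *)
Definition comp_addr a d : seq instr :=
  let t := tmp d in let u := tmp d.+1 in
  [:: IConst u narr; IOp Mul t t u; IConst u a; IOp Add t t u; IOp Add t t nvars].

Arguments comp_addr : simpl never.
Arguments comp_op : simpl never.

(** [l] is the address of the code, needed for the absolute jumps; [env] lists the stack slots of
    the bound variables. For [EBig], slot [d] accumulates, starting from the neutral element, which
    is the flag [o] read as a number, and slot [d.+1] counts. *)
Fixpoint comp_e l (env : seq nat) d e : seq instr :=
  match e with
  | ECst k => [:: IConst (tmp d) k]
  | EVar x => [:: IConst (tmp d) 0; IOp Add (tmp d) (tmp d) x]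
  | EBnd i => [:: IConst (tmp d) 0; IOp Add (tmp d) (tmp d) (tmp (nth 0 env i))]
  | EArr a e => comp_e l env d e ++ comp_addr a d ++ [:: ILoad (tmp d) (tmp d)]
  | EBin o e1 e2 =>
      let c1 := comp_e l env d e1 in
      c1 ++ comp_e (l + size c1) env d.+1 e2 ++ comp_op o d
  | EBig o e1 e2 =>
      let t := tmp d in let u := tmp d.+1 in let v := tmp d.+2 in
      let c1 := comp_e l.+2 env d.+2 e1 in
      let l2 := (l.+2 + size c1).+2 in
      let c2 := comp_e l2 (d.+1 :: env) d.+2 e2 in
      [:: IConst t o; IConst u 0] ++ c1 ++
      [:: IOp Defs.Sub v v u; IJumpZ v (l2 + size c2 + 4)] ++ c2 ++
      [:: IOp (if o then Mul else Add) t t v; IConst v 1; IOp Add u u v; IJump l.+2]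
  end.

Fixpoint comp_c l c : seq instr :=
  match c with
  | CSkip => [::]
  | CAsg x e =>
      comp_e l [::] 0 e ++ [:: IConst x 0; IOp Add x x (tmp 0)]
  | CGet x e => comp_e l [::] 0 e ++ [:: ILoad x (tmp 0)]
  | CSet a e1 e2 =>
      let p := comp_e l [::] 0 e2 in
      p ++ comp_e (l + size p) [::] 1 e1 ++ comp_addr a 1 ++ [:: IStore (tmp 1) (tmp 0)]
  | CPut e1 e2 =>
      let c1 := comp_e l [::] 0 e1 in
      c1 ++ comp_e (l + size c1) [::] 1 e2 ++ [:: IStore (tmp 0) (tmp 1)]
  | CSeq c1 c2 => let p := comp_c l c1 in p ++ comp_c (l + size p) c2
  | CIf e c1 c2 =>
      let p := comp_e l [::] 0 e in
      let p1 := comp_c (l + size p).+1 c1 in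
      let l2 := ((l + size p).+1 + size p1).+1 in
      let p2 := comp_c l2 c2 in
      p ++ [:: IJumpZ (tmp 0) l2] ++ p1 ++ [:: IJump (l2 + size p2)] ++ p2
  | CLoop x y c =>
      let p := comp_c l.+2 c in
      [:: IOp Defs.Sub (tmp 0) y x; IJumpZ (tmp 0) (l.+2 + size p + 3)] ++ p ++
      [:: IConst (tmp 0) 1; IOp Add x x (tmp 0); IJump l]
  | CWhile e c =>
      let p := comp_e l [::] 0 e in
      let p1 := comp_c (l + size p).+1 c in
      p ++ [:: IJumpZ (tmp 0) ((l + size p).+1 + size p1).+1] ++ p1 ++ [:: IJump l]
  end.

Definition atom k e :=
  match e with EVar x => x < nsmall | EBnd i => i < k | _ => false end.

Fixpoint wfe k e : bool :=
  match e with
  | ECst _ => true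
  | EVar x => x < nvars
  | EBnd i => i < k
  | EArr a e => [&& 0 < a, a < narr & wfe k e]
  | EBin _ e1 e2 => wfe k e1 && wfe k e2
  | EBig _ e1 e2 => [&& atom k e1, wfe k e1 & wfe k.+1 e2]
  end.

Fixpoint wfc c : bool :=
  match c with
  | CSkip => true
  | CAsg x e | CGet x e => (x < nvars) && wfe 0 e
  | CSet a e1 e2 => [&& 0 < a, a < narr, wfe 0 e1 & wfe 0 e2]
  | CPut e1 e2 => wfe 0 e1 && wfe 0 e2
  | CSeq c1 c2 => wfc c1 && wfc c2
  | CIf e c1 c2 => [&& wfe 0 e, wfc c1 & wfc c2]
  | CLoop x y c => [&& x < nsmall, y < nsmall & wfc c]
  | CWhile e c => wfe 0 e && wfc c
  end.

(* The largest index of a temporary used by the code of an expression. *)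
Fixpoint depth_e d e : nat :=
  match e with
  | ECst _ | EVar _ | EBnd _ => d
  | EArr _ e => maxn d.+1 (depth_e d e)
  | EBin _ e1 e2 => maxn (maxn d.+2 (depth_e d e1)) (depth_e d.+1 e2)
  | EBig _ e1 e2 => maxn (maxn d.+2 (depth_e d.+2 e1)) (depth_e d.+2 e2)
  end.

Fixpoint depth_c c : nat :=
  match c with
  | CSkip => 0
  | CAsg _ e | CGet _ e => depth_e 0 e
  | CSet _ e1 e2 => maxn (maxn 2 (depth_e 0 e2)) (depth_e 1 e1)
  | CPut e1 e2 => maxn (maxn 2 (depth_e 0 e1)) (depth_e 1 e2)
  | CSeq c1 c2 => maxn (depth_c c1) (depth_c c2)
  | CIf e c1 c2 => maxn (depth_e 0 e) (maxn (depth_c c1) (depth_c c2))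
  | CLoop _ _ c => depth_c c
  | CWhile e c => maxn (depth_e 0 e) (depth_c c)
  end.

Lemma size_comp_addr a d : size (comp_addr a d) = 5. Proof. by []. Qed.

Section Costs.
Variables N L : nat.

Fixpoint steps_e e : nat :=
  match e with
  | ECst _ => 1
  | EVar _ | EBnd _ => 2
  | EArr _ e => steps_e e + 6
  | EBin _ e1 e2 => steps_e e1 + (steps_e e2 + 5)
  | EBig _ e1 e2 => 2 + (steps_e e1 + (2 + (steps_e e2 + 4))) * N.+1
  end.

(** A [CWhile] is charged for a single round; the number of rounds enters as a factor in
    [comp_cP]. *)
Fixpoint steps_c c : nat :=
  match c with
  | CSkip => 0
  | CAsg _ e => steps_e e + 2
  | CGet _ e => steps_e e + 1
  | CSet _ e1 e2 => steps_e e2 + (steps_e e1 + 6)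
  | CPut e1 e2 => steps_e e1 + (steps_e e2 + 1)
  | CSeq c1 c2 => steps_c c1 + steps_c c2
  | CIf e c1 c2 => steps_e e + (2 + (steps_c c1 + steps_c c2))
  | CLoop _ _ c => 2 + (5 + steps_c c) * N.+1
  | CWhile e c => steps_e e + 2 + steps_c c
  end.

(* Values of [e] are below [2 ^ bits_e e]. *)
Fixpoint bits_e e : nat :=
  match e with
  | ECst k => k.+1
  | EVar _ | EBnd _ => L.+1
  | EArr _ e => bits_e e + 2 * narr + L
  | EBin _ e1 e2 => bits_e e1 + bits_e e2
  | EBig _ e1 e2 => N.+1 * (bits_e e2).+1 + bits_e e1
  end.

Fixpoint bits_c c : nat :=
  match c with
  | CSkip => 1
  | CAsg _ e | CGet _ e => bits_e e
  | CSet _ e1 e2 => bits_e e1 + 2 * narr + L + bits_e e2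
  | CPut e1 e2 => bits_e e1 + bits_e e2
  | CSeq c1 c2 => bits_c c1 + bits_c c2
  | CIf e c1 c2 => bits_e e + (bits_c c1 + bits_c c2)
  | CLoop _ _ c => L.+1 + bits_c c
  | CWhile e c => bits_e e + bits_c c
  end.

Lemma bits_e_gt0 e : 0 < bits_e e.
Proof. by elim: e => //= *; lia. Qed.

End Costs.

Lemma ltn_add_exp2 x y p q : 0 < p -> 0 < q -> x < 2 ^ p -> y < 2 ^ q -> x + y < 2 ^ (p + q).
Proof.
move=> p0 q0 xp yq; rewrite expnD.
have : 2 <= 2 ^ p by rewrite -{1}(expn1 2) leq_exp2l.
have : 2 <= 2 ^ q by rewrite -{1}(expn1 2) leq_exp2l.
nia.
Qed.

Lemma ltn_mul_exp2 x y p q : x < 2 ^ p -> y < 2 ^ q -> x * y < 2 ^ (p + q).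
Proof. by move=> xp yq; rewrite expnD ltn_mul. Qed.

Lemma ltn_exp2W x p q : x < 2 ^ p -> p <= q -> x < 2 ^ q.
Proof. by move=> xp pq; rewrite (leq_trans xp) // leq_exp2l. Qed.

Lemma partial_big_bound (o : bool) (F : nat -> nat) n N p :
  n <= N -> (forall i, i < n -> F i < 2 ^ p) ->
  (if o then \prod_(0 <= i < n) F i else \sum_(0 <= i < n) F i) < 2 ^ (N.+1 * p.+1).
Proof.
move=> nN Fp; have: (if o then \prod_(0 <= i < n) F i else \sum_(0 <= i < n) F i)
    < 2 ^ (n.+1 * p.+1).
  elim: n {nN} Fp => [|n IH] Fp.
    by rewrite !big_nil; case: o; rewrite ?expn_gt0 // mul1n expnS; have := expn_gt0 2 p; lia.
  rewrite !big_nat_recr //= mulSn [p.+1 + _]addnC.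
  have {}IH := IH (fun i h => Fp i (ltnW h)); have {}Fp := Fp n (leqnn _).
  have Fp' : F n < 2 ^ p.+1 by rewrite (ltn_exp2W Fp).
  by case: o IH => IH; [apply: ltn_mul_exp2|apply: ltn_add_exp2].
move/ltn_exp2W; apply; by rewrite leq_mul2r ltnS nN orbT.
Qed.

(** * Correctness and cost of the compiler *)

Section Compilation.
Variables (base N L Ix NR LB MS : nat).
Hypothesis base_L : base < 2 ^ L.
Hypothesis N_L : N < 2 ^ L.
Hypothesis L_LB : L < LB.
Hypothesis NR_LB : NR <= 2 ^ LB.
Hypothesis MS_ge : base + Ix.+1 * narr <= MS.

Definition bounded s :=
  [/\ forall x, vr s x < 2 ^ L, forall x, x < nsmall -> vr s x <= N &
      forall a i, ar s a i < 2 ^ L].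

Definition vbound x v := (v < 2 ^ L) && ((x < nsmall) ==> (v <= N)).

(** A derivation exists only if the run terminates and every written value, and every index of a
    write, respects the bounds. It therefore certifies word length and memory along with the
    result. *)
Inductive ev : cmd -> state -> state -> Prop :=
| ev_skip s : ev CSkip s s
| ev_asg s x e : vbound x (eval s [::] e) -> ev (CAsg x e) s (setv s x (eval s [::] e))
| ev_get s x e : eval s [::] e < base -> vbound x (ar s 0 (eval s [::] e)) ->
    ev (CGet x e) s (setv s x (ar s 0 (eval s [::] e)))
| ev_set s a e1 e2 : eval s [::] e1 <= Ix -> eval s [::] e2 < 2 ^ L ->
    ev (CSet a e1 e2) s (seta s a (eval s [::] e1) (eval s [::] e2))
| ev_put s e1 e2 : eval s [::] e1 < base -> eval s [::] e2 < 2 ^ L ->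
    ev (CPut e1 e2) s (seta s 0 (eval s [::] e1) (eval s [::] e2))
| ev_seq c1 c2 s1 s2 s3 : ev c1 s1 s2 -> ev c2 s2 s3 -> ev (CSeq c1 c2) s1 s3
| ev_if e c1 c2 s s' :
    ev (if eval s [::] e == 0 then c2 else c1) s s' -> ev (CIf e c1 c2) s s'
| ev_loop_end x y c s : vr s y <= vr s x -> ev (CLoop x y c) s s
| ev_loop x y c s s1 s2 :
    vr s x < vr s y -> ev c s s1 -> vr s1 x = vr s x ->
    ev (CLoop x y c) (setv s1 x (vr s x).+1) s2 -> ev (CLoop x y c) s s2
| ev_while_end e c s : eval s [::] e = 0 -> ev (CWhile e c) s s
| ev_while e c s s1 s2 :
    eval s [::] e <> 0 -> ev c s s1 -> ev (CWhile e c) (tick s1) s2 ->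
    ev (CWhile e c) s s2.

Lemma bounded_setv s x v : bounded s -> vbound x v -> bounded (setv s x v).
Proof.
case=> bv bn ba /andP[vL /implyP vN]; split=> //= y.
  by case: ifP.
by move=> yn; case: ifP => [/eqnP yx|_]; [apply: vN; rewrite -yx|apply: bn].
Qed.

Lemma bounded_seta s a i v : bounded s -> v < 2 ^ L -> bounded (seta s a i v).
Proof. by case=> bv bn ba vL; split=> //= b j; case: ifP => // _; case: ifP. Qed.

Lemma atom_le k e s rho :
  atom k e -> bounded s -> k <= size rho -> (forall i, i < size rho -> nth 0 rho i <= N) ->
  eval s rho e <= N.
Proof.
by case: e => //= x xn [_ bn _] kr rN; [apply: bn|apply: rN; apply: leq_trans kr].
Qed.

Lemma evop_bound o x y p q : 0 < p -> 0 < q -> x < 2 ^ p -> y < 2 ^ q ->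
  evop o x y < 2 ^ (p + q).
Proof.
move=> p0 q0 xp yq.
have lx z : z <= x -> z < 2 ^ (p + q).
  by move=> zx; apply: leq_ltn_trans zx _; apply: ltn_exp2W xp _; rewrite leq_addr.
have b01 (b : bool) : b < 2 ^ (p + q).
  by apply: leq_ltn_trans (leq_b1 b) _; rewrite -{1}(expn0 2) ltn_exp2l // ltn_addr.
case: o => //=; first exact: ltn_add_exp2.
- by apply: lx; rewrite leq_subr.
- exact: ltn_mul_exp2.
- by apply: lx; rewrite leq_div.
- by apply: lx; rewrite leq_mod.
Qed.

Lemma eval_bound e s rho :
  bounded s -> wfe (size rho) e -> (forall i, i < size rho -> nth 0 rho i <= N) ->
  eval s rho e < 2 ^ bits_e N L e.
Proof.
move=> bs; have [bv bn ba] := bs; elim: e rho => //=.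
- by move=> k rho _ _; apply: (ltn_exp2W (ltn_expl k (isT : 1 < 2))).
- by move=> x rho _ _; apply: ltn_exp2W (bv x) _.
- move=> i rho ir rN; apply: ltn_exp2W (leq_ltn_trans (rN i ir) N_L) _; lia.
- by move=> a e IH rho _ _; apply: ltn_exp2W (ba _ _) _; lia.
- move=> o e1 IH1 e2 IH2 rho /andP[w1 w2] rN.
  by apply: evop_bound; rewrite ?bits_e_gt0 ?IH1 ?IH2.
- move=> o e1 IH1 e2 IH2 rho /and3P[a1 w1 w2] rN.
  have n1 := atom_le a1 bs (leqnn _) rN.
  apply: (@ltn_exp2W _ (N.+1 * (bits_e N L e2).+1)); last by rewrite leq_addr.
  apply: partial_big_bound => // i ie; apply: IH2 => // -[|j] //= js; last exact: rN.
  by rewrite (leq_trans _ n1) // ltnW.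
Qed.

Definition addr a i := base + i * narr + a.

Definition sim s c :=
  [/\ forall x, x < nvars -> reg c x = vr s x, reg c nvars = base,
      forall a i, 0 < a < narr -> cell c (addr a i) = ar s a i &
      forall i, i < base -> cell c i = ar s 0 i].

Variable P : program.
Notation within := (within NR LB MS).
Notation reach := (reach NR LB MS P).
Notation code_at := (code_at P).

(** Code compiled at depth [d] owns the stack from slot [d] on, so the values of an enclosing
    expression survive the evaluation of its parts. *)
Definition keeps d c c' :=
  memory c' = memory c /\ forall x, x < tmp d -> reg c' x = reg c x.

Lemma sim_keeps d s c c' : keeps d c c' -> sim s c -> sim s c'.
Proof.
case=> mm rr [sv sb sa s0]; split.
- by move=> x xn; rewrite rr ?sv // /tmp; lia.
- by rewrite rr ?sb // /tmp; lia.
- by move=> a i h; rewrite /cell mm; apply: sa.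
- by move=> i h; rewrite /cell mm; apply: s0.
Qed.

Lemma keeps_refl d c : keeps d c c. Proof. by []. Qed.

Lemma keeps_trans d d' c1 c2 c3 : d <= d' -> keeps d c1 c2 -> keeps d' c2 c3 -> keeps d c1 c3.
Proof.
move=> dd [m1 r1] [m2 r2]; split; first by rewrite m2.
by move=> x xd; rewrite r2 ?r1 //; move: xd; rewrite /tmp; lia.
Qed.

Lemma keeps_weak d d' c c' : d <= d' -> keeps d' c c' -> keeps d c c'.
Proof. by move=> dd; apply: keeps_trans dd (keeps_refl d c). Qed.

Lemma keeps_set d d' c v : d <= d' -> keeps d c (set_reg c (tmp d') v).
Proof.
move=> dd; split=> // x xd; rewrite reg_set; case: eqP => // E.
by move: xd; rewrite E /tmp; lia.
Qed.

Lemma reach_const k c d v Q :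
  onth P (pc c) = Some (IConst d v) -> within c -> d < NR -> v < 2 ^ LB ->
  (within (set_reg c d v) -> reach k (set_reg c d v) Q) -> reach k.+1 c Q.
Proof. by move=> Pi ok dN vL; apply: reach_set_reg Pi _ dN vL. Qed.

Lemma reach_op k c o d a b Q :
  onth P (pc c) = Some (IOp o d a b) -> within c -> d < NR ->
  eval_binop o (reg c a) (reg c b) < 2 ^ LB ->
  (within (set_reg c d (eval_binop o (reg c a) (reg c b))) ->
    reach k (set_reg c d (eval_binop o (reg c a) (reg c b))) Q) -> reach k.+1 c Q.
Proof. by move=> Pi ok dN vL; apply: reach_set_reg Pi _ dN vL. Qed.

Lemma reach_load k c d a Q :
  onth P (pc c) = Some (ILoad d a) -> within c -> d < NR ->
  (within (set_reg c d (cell c (reg c a))) ->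
    reach k (set_reg c d (cell c (reg c a))) Q) -> reach k.+1 c Q.
Proof. by move=> Pi ok dN; apply: reach_set_reg Pi _ dN _ => //; case: ok. Qed.

Lemma tmp_neq d :
  ((tmp d == tmp d.+1 = false) * (tmp d == tmp d.+2 = false) *
   (tmp d.+1 == tmp d = false) * (tmp d.+1 == tmp d.+2 = false) *
   (tmp d.+2 == tmp d = false) * (tmp d.+2 == tmp d.+1 = false))%type.
Proof. by rewrite /tmp; repeat split; lia. Qed.

Lemma tmp_leq d d' : (tmp d <= tmp d') = (d <= d').
Proof. by rewrite /tmp leq_add2l. Qed.

Lemma tmp_maxn d d' : tmp (maxn d d') = maxn (tmp d) (tmp d').
Proof. by rewrite /tmp addn_maxr. Qed.

Lemma one_lt : 1 < 2 ^ LB.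
Proof. by rewrite -{1}(expn0 2) ltn_exp2l //; lia. Qed.

Lemma keeps_setr d d' c c' v : d <= d' -> keeps d c c' -> keeps d c (set_reg c' (tmp d') v).
Proof.
by move=> dd K; apply: (keeps_trans dd K); apply: keeps_set.
Qed.

Ltac simp_regs :=
  rewrite ?pc_set_reg ?pc_jump ?reg_jump ?reg_set ?tmp_neq ?eqxx.
Ltac step_op H :=
  eapply reach_op;
    [simp_regs; match goal with E : pc ?c = _ |- context [pc ?c] => rewrite E end; exact: H
    |eassumption | by []
    |simp_regs;
     repeat match goal with E : reg ?c _ = _ |- context [reg ?c _] => rewrite E end;
     cbn [eval_binop]; try lia
    |intro; cbn [eval_binop]].
Ltac step_const H :=
  eapply reach_const;
    [simp_regs; match goal with E : pc ?c = _ |- context [pc ?c] => rewrite E end; exact: H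
    |eassumption | by [] | try lia | intro].
Ltac finish :=
  apply: reach_done; [eassumption|split;
    [simp_regs; match goal with E : pc ?c = _ |- context [pc ?c] => rewrite E end; simpl; lia
    |repeat (apply: keeps_setr; [lia|]); apply: keeps_refl
    |simp_regs;
     repeat match goal with E : reg ?c _ = _ |- context [reg ?c _] => rewrite E end; simpl; try reflexivity]].

Lemma comp_opP o d l c x y p q :
  code_at l (comp_op o d) -> pc c = l -> within c -> tmp d.+2 < NR ->
  reg c (tmp d) = x -> reg c (tmp d.+1) = y ->
  x < 2 ^ p -> y < 2 ^ q -> 0 < p -> 0 < q -> p + q <= LB ->
  reach 5 c (fun c' => [/\ pc c' = l + size (comp_op o d), keeps d c c' &
                           reg c' (tmp d) = evop o x y]).
Proof.
move=> C pcl ok dN rx ry xp yq p0 q0 pq.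
have dN1 : tmp d.+1 < NR by move: dN; rewrite /tmp; lia.
have dN0 : tmp d < NR by move: dN; rewrite /tmp; lia.
have xyL : x + y < 2 ^ LB by apply: ltn_exp2W pq; apply: ltn_add_exp2.
have mL : x * y < 2 ^ LB by apply: ltn_exp2W pq; apply: ltn_mul_exp2.
have xL : x < 2 ^ LB by lia.
have dL : x %/ y < 2 ^ LB by apply: leq_ltn_trans (leq_div _ _) xL.
have dmL : x %/ y * y < 2 ^ LB by apply: leq_ltn_trans (leq_divM _ _) xL.
have L1 := one_lt.
have K v d' : d <= d' -> keeps d c (set_reg c (tmp d') v) by apply: keeps_set.
case: o C => /=; rewrite /comp_op /= => /code_at_cons[P1].
- move=> _; step_op P1; finish.
- move=> _; step_op P1; finish.
- move=> _; step_op P1; finish.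
- move=> _; step_op P1; finish.
- case/code_at_cons=> P2 /code_at_cons[P3 _].
  by step_op P1; step_op P2; step_op P3; finish; rewrite {1}(divn_eq x y) addKn.
- case/code_at_cons=> P2 /code_at_cons[P3 /code_at_cons[P4 /code_at_cons[P5 _]]].
  by step_op P1; step_op P2; step_op P3; step_const P4; step_op P5; finish; lia.
- case/code_at_cons=> P2 /code_at_cons[P3 /code_at_cons[P4 _]].
  by step_op P1; step_const P2; step_op P3; step_op P4; finish; lia.
Qed.

Lemma nvars_tmp d : (nvars == tmp d) = false.
Proof. by rewrite /tmp; lia. Qed.

Lemma comp_addrP a d l c x p :
  code_at l (comp_addr a d) -> pc c = l -> within c -> tmp d.+1 < NR -> a < narr ->
  reg c (tmp d) = x -> reg c nvars = base -> x < 2 ^ p -> 0 < p -> p + 2 * narr + L <= LB ->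
  reach 5 c (fun c' => [/\ pc c' = l + 5, keeps d c c' & reg c' (tmp d) = addr a x]).
Proof.
move=> C pcl ok dN aN rx rb xp p0 pL.
have dN0 : tmp d < NR by move: dN; rewrite /tmp; lia.
have nn : narr < 2 ^ narr by apply: ltn_expl.
have n0 : 0 < narr by [].
have h1 : narr < 2 ^ LB by apply: ltn_exp2W nn _; lia.
have h2 : x * narr < 2 ^ (p + narr) by apply: ltn_mul_exp2.
have h2' : x * narr < 2 ^ LB by apply: ltn_exp2W h2 _; lia.
have h3 : a < 2 ^ narr by lia.
have h4 : x * narr + a < 2 ^ (p + narr + narr) by apply: ltn_add_exp2 => //; lia.
have h4' : x * narr + a < 2 ^ LB by apply: ltn_exp2W h4 _; lia.
have h5 : x * narr + a + base < 2 ^ LB.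
  case: (posnP L) (base_L) => [->|L0] bL; first by have ->: base = 0; lia.
  by apply: (@ltn_exp2W _ (p + narr + narr + L)); [apply: ltn_add_exp2 => //; lia|lia].
rewrite /comp_addr in C; case/code_at_cons: C => P1 /code_at_cons[P2 /code_at_cons[P3 /code_at_cons[P4 /code_at_cons[P5 _]]]].
step_const P1; step_op P2; step_const P3; step_op P4.
eapply reach_op;
    [simp_regs; rewrite pcl; exact: P5
    |eassumption | by []
    |simp_regs; rewrite !nvars_tmp rx rb //|intro; cbn [eval_binop]].
by finish; rewrite ?nvars_tmp ?rb /addr /=; lia.
Qed.

Local Opaque comp_addr comp_op.

Lemma comp_eP e l env d rho s c :
  wfe (size rho) e -> size env = size rho -> (forall i, i < size rho -> nth 0 env i < d) ->
  code_at l (comp_e l env d e) -> pc c = l -> within c -> sim s c -> bounded s ->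
  (forall i, i < size rho -> nth 0 rho i <= N) ->
  (forall i, i < size rho -> reg c (tmp (nth 0 env i)) = nth 0 rho i) ->
  tmp (depth_e d e) < NR -> bits_e N L e <= LB ->
  reach (steps_e N e) c (fun c' => [/\ pc c' = l + size (comp_e l env d e),
                                     keeps d c c' & reg c' (tmp d) = eval s rho e]).
Proof.
elim: e l env d rho s c => /=.
- move=> k l env d rho s c _ _ _ C pcl ok _ _ _ _ dN kL.
  case/code_at_cons: C => P1 _; have k1 : k < 2 ^ LB by apply: ltn_exp2W (ltn_expl k _) _ => //; lia.
  by step_const P1; finish.
- move=> x l env d rho s c xn _ _ C pcl ok sm bs _ _ dN kL.
  case/code_at_cons: C => P1 /code_at_cons[P2 _].
  have rx : reg c x = vr s x by case: sm => h _ _ _; apply: h.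
  have xt : (x == tmp d) = false by rewrite /tmp; lia.
  have xL : vr s x < 2 ^ LB by case: bs => /(_ x) h _ _; apply: ltn_exp2W h _; lia.
  have L1 := one_lt.
  step_const P1.
  by step_op P2; rewrite ?xt ?rx //; finish; rewrite ?xt ?rx ?add0n.
- move=> i l env d rho s c ir er ed C pcl ok sm bs rN rE dN kL.
  case/code_at_cons: C => P1 /code_at_cons[P2 _].
  have rx := rE i ir.
  have xt : (tmp (nth 0 env i) == tmp d) = false by have := ed i ir; rewrite /tmp; lia.
  have xL : nth 0 rho i < 2 ^ LB.
    by apply: leq_ltn_trans (rN i ir) _; apply: ltn_exp2W N_L _; lia.
  have L1 := one_lt.
  step_const P1.
  by step_op P2; rewrite ?xt ?rx //; finish; rewrite ?xt ?rx ?add0n.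
- move=> a e IH l env d rho s c /and3P[a0 aN we] er ed C pcl ok sm bs rN rE dN kL.
  case/code_at_cat: C => C1 /code_at_cat[C2 /code_at_cons[C3 _]].
  have dN1 : tmp d.+1 < NR by apply: leq_ltn_trans dN; rewrite tmp_leq leq_maxl.
  have dN0 : tmp d < NR by apply: leq_ltn_trans dN1; rewrite tmp_leq.
  apply: reach_bind.
    apply: (IH l env d rho s c) => //; last by lia.
    by apply: leq_ltn_trans dN; rewrite tmp_leq leq_maxr.
  move=> c1 [pc1 k1 r1] ok1; rewrite -[6]/(5 + 1).
  have [_ rb sa _] := sim_keeps k1 sm.
  apply: reach_bind.
    by apply: (@comp_addrP a d _ c1 (eval s rho e) (bits_e N L e) C2) => //;
      [apply: eval_bound|apply: bits_e_gt0].
  move=> c2 [pc2 k2 r2] ok2.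
  eapply reach_load; [rewrite pc2; exact: C3 | by []|by []|intro].
  apply: reach_done; rewrite // pc_set_reg pc2 !size_cat size_comp_addr /=; split; first by lia.
    apply: (keeps_trans (leqnn d)); [exact: k1|].
    by apply: (keeps_trans (leqnn d)); [exact: k2|apply: keeps_set].
  rewrite reg_set eqxx r2; case: k2 => m2 _; rewrite /cell m2 -/(cell c1 _).
  by apply: sa; rewrite a0.
- move=> o e1 IH1 e2 IH2 l env d rho s c /andP[w1 w2] er ed C pcl ok sm bs rN rE dN kL.
  case/code_at_cat: C => C1 /code_at_cat[C2 C3].
  rewrite !tmp_maxn !gtn_max in dN; case/andP: dN => /andP[dN2 dN0] dN1.
  have b1 := bits_e_gt0 N L e1; have b2 := bits_e_gt0 N L e2.
  apply: reach_bind.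
    by apply: (IH1 l env d rho s c) => //; lia.
  move=> c1 [pc1 k1 r1] ok1.
  apply: reach_bind.
    apply: (IH2 (l + size (comp_e l env d e1)) env d.+1 rho s c1) => //; last by lia.
    - by move=> i ir; apply: ltnW; apply: ed.
    - exact: sim_keeps k1 sm.
    - by move=> i ir; case: k1 => _ ->; [apply: rE|rewrite /tmp; have := ed i ir; lia].
  move=> c2 [pc2 k2 r2] ok2.
  have r1' : reg c2 (tmp d) = eval s rho e1 by case: k2 => _ ->; rewrite // /tmp; lia.
  apply: reach_weaken (comp_opP C3 pc2 ok2 dN2 r1' r2 (eval_bound bs w1 rN)
      (eval_bound bs w2 rN) b1 b2 kL) (leqnn _) _ => c3 [pc3 k3 r3].
  split; [by rewrite pc3 !size_cat; lia| |by []].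
  apply: (keeps_trans (leqnn d)); [exact: k1|].
  exact: (keeps_trans (leqnn d) (keeps_weak (leqnSn d) k2)).
- move=> o e1 IH1 e2 IH2 l env d rho s c /and3P[a1 w1 w2] er ed C pcl ok sm bs rN rE dN kL.
  case/code_at_cons: C => P1 /code_at_cons[P2 /code_at_cat[C1]].
  case/code_at_cons => P3 /code_at_cons[P4 /code_at_cat[C2]].
  case/code_at_cons=> P5 /code_at_cons[P6 /code_at_cons[P7 /code_at_cons[P8 _]]].
  rewrite !tmp_maxn !gtn_max in dN; case/andP: dN => /andP[dN dN1] dN2.
  have dNu : tmp d.+1 < NR by apply: leq_ltn_trans dN; rewrite tmp_leq.
  have dNt : tmp d < NR by apply: leq_ltn_trans dNu; rewrite tmp_leq.
  have L1 := one_lt.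
  have o1 : o < 2 ^ LB by apply: leq_ltn_trans (leq_b1 o) L1.
  have o2 : 0 < 2 ^ LB by lia.
  step_const P1; step_const P2.
  set c1 := set_reg _ (tmp d.+1) 0.
  have k1 : keeps d c c1 by rewrite /c1; do 2 (apply: keeps_setr; [lia|]); apply: keeps_refl.
  have r1 : reg c1 (tmp d) = o by rewrite /c1; simp_regs.
  have r1' : reg c1 (tmp d.+1) = 0 by rewrite /c1; simp_regs.
  have pc1 : pc c1 = l.+2 by rewrite /c1 !pc_set_reg pcl.
  have ok1 : within c1 by [].
  set n := eval s rho e1.
  (* The content of the accumulator at the head of the loop when the counter is [i]. *)
  pose part i := if o then \prod_(0 <= k < i) eval s (k :: rho) e2
                 else \sum_(0 <= k < i) eval s (k :: rho) e2.
  have part0 : part 0 = o by rewrite /part !big_nil; case: (o).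
  have nN : n <= N by apply: atom_le a1 bs (leqnn _) rN.
  have rN2 j : j < n -> forall i, i < size (j :: rho) -> nth 0 (j :: rho) i <= N.
    by move=> jn [|i] //= ir; [lia|apply: rN].
  have partB i : i <= n -> part i < 2 ^ LB.
    move=> ni; apply: ltn_exp2W (partial_big_bound (p := bits_e N L e2) o (leq_trans ni nN) _) _; last first.
      by apply: leq_trans kL; rewrite leq_addr.
    by move=> j ji; apply: eval_bound => //; apply: rN2; lia.
  have nB : n < 2 ^ LB by apply: leq_ltn_trans nN _; apply: ltn_exp2W N_L _; lia.
  have kL1 : bits_e N L e1 <= LB by lia.
  have kL2 : bits_e N L e2 <= LB by lia.
  rewrite -part0 in r1; rewrite {part0 o1 o2 P1 P2}.
  pose l2 := (l.+2 + size (comp_e l.+2 env d.+2 e1)).+2.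
  pose c2 := comp_e l2 (d.+1 :: env) d.+2 e2.
  rewrite -/l2 -/c2 in P3 P4 C2 P5 P6 P7 P8 *.
  (* Induction on the number [j] of remaining rounds; the extra round in [j.+1] is the final test
     that leaves the loop. *)
  have loop j i c' : i + j = n -> pc c' = l.+2 -> within c' -> keeps d c c' ->
      reg c' (tmp d) = part i -> reg c' (tmp d.+1) = i ->
      reach ((steps_e N e1 + (2 + (steps_e N e2 + 4))) * j.+1) c'
        (fun c' => [/\ pc c' = l2 + size c2 + 4, keeps d c c' & reg c' (tmp d) = part n]).
    elim: j i c' => [|j IH] i c' ijn pc' ok' k' rt ru; rewrite mulnS -[in X in reach X]addnA -[2 + _ + _]addnA -[_ + 4 + _]addnA.
    1-2: apply: reach_bind;
      [apply: (IH1 l.+2 env d.+2 rho s c') => //;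
        [by move=> x xr; have := ed x xr; lia
        |exact: sim_keeps k' sm
        |by move=> x xr; case: k' => _ ->; [apply: rE|rewrite /tmp; have := ed x xr; lia]]|].
    1-2: move=> c3 [pc3 k3 r3] ok3; rewrite -/n in r3.
    1-2: have k3' := keeps_trans (leqnn d) k' (keeps_weak (leq_addl 2 d) k3).
    1-2: have ru3 : reg c3 (tmp d.+1) = i by case: k3 => _ ->; rewrite // /tmp; lia.
    1-2: have rt3 : reg c3 (tmp d) = part i by case: k3 => _ ->; rewrite // /tmp; lia.
    1-2: rewrite add2n.
    1-2: eapply reach_op; [by rewrite pc3; exact: P3|exact: ok3|exact: dN
      |by rewrite r3 ru3 /=; lia|rewrite r3 ru3 /= => ok4].
    1-2: eapply reach_jumpz; [exact: ok4|by rewrite pc_set_reg pc3; exact: P4|].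
    1-2: rewrite reg_set eqxx.
      have E0 : (n - i == 0) = true by lia.
      have {}ijn : i = n by lia.
      rewrite E0; apply: reach_done; first exact: ok4.
      rewrite pc_jump reg_jump; split=> //.
        by apply: (keeps_trans (leqnn d) k3'); apply: keeps_set; lia.
      by rewrite reg_set tmp_neq rt3 ijn.
    rewrite (_ : n - i == 0 = false); last by lia.
    apply: reach_bind.
      apply: (IH2 l2 (d.+1 :: env) d.+2 (i :: rho) s) => //.
      + by rewrite /= er.
      + by move=> [|x] //= xr; have := ed x xr; lia.
      + by rewrite pc_jump pc_set_reg pc3.
      + by apply: (sim_keeps (d := d)) sm; apply: (keeps_trans (leqnn d) k3'); apply: keeps_set; lia.
      + by apply: rN2; lia.
      + move=> [|x] xr; first by rewrite reg_jump reg_set /= tmp_neq ru3.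
        rewrite reg_jump reg_set /=; have /= xd := ed x xr; case: eqP => [E|_].
          by move: E; rewrite /tmp; lia.
        by case: k3' => _ ->; [apply: rE|rewrite /tmp; lia].
    move=> c5 [pc5 k5 r5] ok5.
    have k4 v l' : keeps d c3 (jump_to (set_reg c3 (tmp d.+2) v) l').
      by apply: (keeps_set (d := d)); lia.
    have k6 : keeps d c c5.
      apply: (keeps_trans (leqnn d) k3'); apply: (keeps_trans (leqnn d) (k4 _ _)).
      by apply: keeps_weak k5; lia.
    have [ru5 rt5] : reg c5 (tmp d.+1) = i /\ reg c5 (tmp d) = part i.
      case: k5 => _ k5; rewrite !k5 ?reg_jump ?reg_set ?tmp_neq ?ru3 ?rt3 //; rewrite /tmp; lia.
    have pS : eval_binop (if o then Mul else Add) (part i) (eval s (i :: rho) e2) = part i.+1.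
      by rewrite /part !big_nat_recr //=; case: (o).
    rewrite !addSn add0n.
    eapply reach_op; [by rewrite pc5; exact: P5|exact: ok5|exact: dNt
      |by rewrite r5 rt5 pS; apply: partB; lia|rewrite r5 rt5 pS => ok6].
    eapply reach_const; [by rewrite pc_set_reg pc5; exact: P6|exact: ok6|exact: dN|by []|move=> ok7].
    eapply reach_op; [by rewrite !pc_set_reg pc5; exact: P7|exact: ok7|exact: dNu
      |by rewrite !reg_set !tmp_neq eqxx ru5 /=; lia|rewrite !reg_set !tmp_neq eqxx ru5 /= => ok8].
    eapply reach_jump; [exact: ok8|by rewrite !pc_set_reg pc5; exact: P8|].
    apply: (IH i.+1) => //; first by lia.
    + apply: (keeps_trans (leqnn d) k6); rewrite /jump_to.
      suff: keeps d c5 (set_reg (set_reg (set_reg c5 (tmp d) (part i.+1)) (tmp d.+2) 1) (tmp d.+1) (i + 1)).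
        by [].
      by do 3 (apply: keeps_setr; first lia); apply: keeps_refl.
    + by rewrite reg_jump !reg_set !tmp_neq eqxx.
    + by rewrite reg_jump !reg_set eqxx addn1.
  apply: reach_weaken (loop n 0 c1 (add0n n) pc1 ok1 k1 r1 r1') _ _.
    by rewrite leq_mul2l ltnS nN orbT.
  move=> c' [pc' k' rt]; split=> //.
  by rewrite pc' /l2 !size_cat /= !size_cat /= -/l2 -/c2; lia.
Qed.

Lemma sim_setv s c c' x v :
  x < nvars -> sim s c -> memory c' = memory c ->
  (forall y, y <= nvars -> reg c' y = if y == x then v else reg c y) ->
  sim (setv s x v) c'.
Proof.
move=> xn [sv sb sa s0] mm rr; split.
- move=> y yn; rewrite rr ?(ltnW yn) //= -[eqn y x]/(y == x).
  by case: eqP => // _; apply: sv.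
- by rewrite rr // sb gtn_eqF.
- by move=> a i h; rewrite /cell mm; apply: sa.
- by move=> i h; rewrite /cell mm; apply: s0.
Qed.

Lemma sim_set_cell s c a i v :
  (a == 0) && (i < base) || (0 < a < narr) -> sim s c ->
  sim (seta s a i v) (set_cell c (if a == 0 then i else addr a i) v).
Proof.
move=> ai [sv sb sa s0]; split=> //= [b j bn|j jb]; rewrite cell_set -[eqn _ a]/(_ == a).
  case: (altP (a =P 0)) ai => [->|a0] ai.
    by rewrite sa // /addr; case: eqP; case: eqP; lia.
  have E : (addr b j == addr a i) = (b == a) && (j == i).
    apply/eqP/andP => [|[/eqP-> /eqP->] //]; rewrite /addr => /eqP.
    rewrite -!addnA eqn_add2l => /eqP H.
    have bE : b = a.
      by have := congr1 (modn^~ narr) H; rewrite !modnMDl !modn_small; lia.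
    by split; apply/eqP => //; move: H; rewrite bE /narr; lia.
  by rewrite E sa //; case: (b == a); case: (j == i).
case: (altP (a =P 0)) ai => [->|a0] ai; first by rewrite s0.
by rewrite s0 // [0 == a]eq_sym (negPf a0); case: eqP => // E; move: jb; rewrite E /addr; lia.
Qed.

(** The rule [ev_loop] re-enters a loop whose counter has already advanced, so the induction needs a
    bound that charges the remaining rounds only. *)
Definition time_c c s :=
  if c is CLoop x _ c0 then 2 + (5 + steps_c N c0) * (N.+1 - vr s x) else steps_c N c.

Lemma time_c_le c s : time_c c s <= steps_c N c.
Proof. by case: c => //= x y c; rewrite leq_add2l leq_mul2l leq_subr orbT. Qed.

Lemma comp_e0 d e l s c :
  wfe 0 e -> code_at l (comp_e l [::] d e) -> pc c = l -> within c -> sim s c ->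
  bounded s -> tmp (depth_e d e) < NR -> bits_e N L e <= LB ->
  reach (steps_e N e) c (fun c' => [/\ pc c' = l + size (comp_e l [::] d e),
                       keeps d c c', reg c' (tmp d) = eval s [::] e & sim s c']).
Proof.
move=> we C pcc ok sm bs dN eL.
have := @comp_eP e l [::] d [::] s c we erefl _ C pcc ok sm bs.
move=> /(_ (fun _ => ltac:(by [])) (fun _ => ltac:(by []))
           (fun _ => ltac:(by [])) dN eL) H.
apply: reach_weaken H (leqnn _) _ => c' [pc' k r]; split=> //.
exact: sim_keeps k sm.
Qed.

(** The shape of the bound is stable under sequences: [t1 * (1 + p) + t2 * (1 + q) <= (t1 + t2) * (1
    + (p + q))]. In a while loop the tick of a round pays for its test and its body, also when loops
    are nested. *)
Lemma comp_cP c s s' : ev c s s' -> forall l cf,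
  wfc c -> code_at l (comp_c l c) -> pc cf = l -> within cf -> sim s cf -> bounded s ->
  tmp (depth_c c) < NR -> bits_c N L c <= LB ->
  [/\ tk s <= tk s', bounded s' &
    reach (time_c c s * (1 + (tk s' - tk s))) cf
      (fun cf' => pc cf' = l + size (comp_c l c) /\ sim s' cf')].
Proof.
elim=> {c s s'} /=.
- move=> s l cf _ _ pcc ok sm bs _ _; split=> //.
  by apply: reach_done => //; rewrite addn0.
- move=> s x e vb l cf /andP[xn we] /code_at_cat[C1 /code_at_cons[C2 /code_at_cons[C3 _]]].
  move=> pcc ok sm bs dN eL; split=> //; first exact: bounded_setv.
  rewrite subnn addn0 muln1; apply: reach_bind; first exact: (comp_e0 we C1 pcc ok sm bs dN eL).
  move=> c1 [pc1 k1 r1 sm1] ok1.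
  have xt : (tmp 0 == x) = false by rewrite /tmp; lia.
  have xN : x < NR by move: dN; rewrite /tmp /nvars in xn *; lia.
  have eB : eval s [::] e < 2 ^ LB by apply: ltn_exp2W (eval_bound _ _ _) eL.
  eapply reach_const; [by rewrite pc1; exact: C2|exact: ok1|exact: xN|by lia|move=> ok2].
  eapply reach_op; [by rewrite pc_set_reg pc1; exact: C3|exact: ok2|exact: xN
    |by rewrite !reg_set eqxx xt r1|rewrite !reg_set eqxx xt r1 => ok3].
  apply: reach_done => //; rewrite !pc_set_reg pc1 size_cat /=; split; first by lia.
  apply: (sim_setv (c := c1)) => // y _; rewrite !reg_set; case: eqP => //.
- move=> s x e eb vb l cf /andP[xn we] /code_at_cat[C1 /code_at_cons[C2 _]].
  move=> pcc ok sm bs dN eL; split=> //; first exact: bounded_setv.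
  rewrite subnn addn0 muln1; apply: reach_bind; first exact: (comp_e0 we C1 pcc ok sm bs dN eL).
  move=> c1 [pc1 k1 r1 sm1] ok1.
  have xN : x < NR by move: dN; rewrite /tmp /nvars in xn *; lia.
  eapply reach_load; [by rewrite pc1; exact: C2|exact: ok1|exact: xN|rewrite r1 => ok2].
  apply: reach_done => //; rewrite !pc_set_reg pc1 size_cat /=; split; first by lia.
  have E : cell c1 (eval s [::] e) = ar s 0 (eval s [::] e) by case: sm1 => _ _ _ ->.
  by rewrite E; apply: (sim_setv (c := c1)) => // y _; rewrite !reg_set.
- move=> s a e1 e2 iI vL l cf /and4P[a0 aN w1 w2] /code_at_cat[C1 /code_at_cat[C2]].
  move=> /code_at_cat[C3 /code_at_cons[C4 _]] pcc ok sm bs.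
  rewrite !tmp_maxn !gtn_max => /andP[/andP[dN dN2] dN1] eL.
  split=> //; first exact: bounded_seta.
  have [eL1 eL2] : bits_e N L e1 <= LB /\ bits_e N L e2 <= LB by lia.
  rewrite subnn addn0 muln1; apply: reach_bind; first exact: (comp_e0 w2 C1 pcc ok sm bs dN2 eL2).
  move=> c1 [pc1 k1 r1 sm1] ok1.
  apply: reach_bind; first exact: (comp_e0 w1 C2 pc1 ok1 sm1 bs dN1 eL1).
  move=> c2 [pc2 k2 r2 sm2] ok2; rewrite -[6]/(5 + 1).
  have rb : reg c2 nvars = base by case: sm2.
  apply: reach_bind.
    by apply: (comp_addrP C3 pc2 ok2 _ aN r2 rb (eval_bound (rho := [::]) bs w1 _)); rewrite ?bits_e_gt0 //; lia.
  move=> c3 [pc3 k3 r3] ok3.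
  have r3' : reg c3 (tmp 0) = eval s [::] e2.
    by case: k3 => _ ->; [case: k2 => _ ->|].
  have aM : reg c3 (tmp 1) < MS.
    rewrite r3 (leq_trans _ MS_ge) // /addr mulSn [narr + _]addnC addnA -addnS leq_add //.
    by rewrite leq_add2l leq_mul2r iI orbT.
  eapply reach_set_cell; [exact: ok3|by rewrite pc3; exact: C4|exact: aM|rewrite r3 r3' => ok4].
  apply: reach_done => //; rewrite pc_set_cell pc3 !size_cat size_comp_addr /=.
  split; first by lia.
  have := @sim_set_cell s c3 a (eval s [::] e1) (eval s [::] e2).
  rewrite a0 aN orbT gtn_eqF //; apply=> //.
  by apply: sim_keeps k3 sm2.
- move=> s e1 e2 ib vL l cf /andP[w1 w2] /code_at_cat[C1 /code_at_cat[C2]].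
  move=> /code_at_cons[C4 _] pcc ok sm bs.
  rewrite !tmp_maxn !gtn_max => /andP[/andP[dN dN1] dN2] eL.
  split=> //; first exact: bounded_seta.
  have [eL1 eL2] : bits_e N L e1 <= LB /\ bits_e N L e2 <= LB by lia.
  rewrite subnn addn0 muln1; apply: reach_bind; first exact: (comp_e0 w1 C1 pcc ok sm bs dN1 eL1).
  move=> c1 [pc1 k1 r1 sm1] ok1.
  apply: reach_bind; first exact: (comp_e0 w2 C2 pc1 ok1 sm1 bs dN2 eL2).
  move=> c2 [pc2 k2 r2 sm2] ok2.
  have r1' : reg c2 (tmp 0) = eval s [::] e1 by case: k2 => _ ->.
  eapply reach_set_cell; [exact: ok2|by rewrite pc2; exact: C4|by rewrite r1'; lia|].
  rewrite r1' r2 => ok3.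
  apply: reach_done => //; rewrite pc_set_cell pc2 !size_cat /=.
  split; first by lia.
  have := @sim_set_cell s c2 0 (eval s [::] e1) (eval s [::] e2).
  by rewrite ib; apply.
- move=> c1 c2 s1 s2 s3 _ IH1 _ IH2 l cf /andP[w1 w2] /code_at_cat[C1 C2] pcc ok sm bs.
  rewrite tmp_maxn gtn_max => /andP[d1 d2] bL.
  have [t12 bs2 R1] := IH1 l cf w1 C1 pcc ok sm bs d1 (leq_trans (leq_addr _ _) bL).
  have {}IH2 c' := IH2 _ c' w2 C2.
  have b2 : bits_c N L c2 <= LB by lia.
  case: R1 (IH2) => k [c' [kk st [pc' sm']]].
  have ok' : within c' by elim: st.
  move=> /(_ c' pc' ok' sm' bs2 d2 b2)[t23 bs3 R2]; split=> //; first by lia.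
  have R1 : reach k cf (fun x => x = c') by exists k, c'.
  apply: (reach_weaken (reach_bind R1 (fun _ e _ => ltac:(rewrite e; exact: R2)))).
    have := time_c_le c1 s1; have := time_c_le c2 s2; nia.
  by move=> c3 [pc3 sm3]; rewrite pc3 size_cat addnA.
- move=> e c1 c2 s s' _ IH l cf /and3P[we w1 w2] /code_at_cat[C1 /code_at_cons[C2]].
  case/code_at_cat=> C3 /code_at_cons[C4 C5] pcc ok sm bs.
  rewrite !tmp_maxn !gtn_max => /and3P[de d1 d2] bL.
  have eL : bits_e N L e <= LB by lia.
  case: (comp_e0 we C1 pcc ok sm bs de eL) => k [c3 [kk st [pc3 k3 r3 sm3]]].
  have ok3 : within c3 by elim: st.
  have R1 : reach k cf (fun x => x = c3) by exists k, c3.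
  set B := steps_c N c1 + steps_c N c2.
  set D := tk s' - tk s.
  set l1 := (l + size (comp_e l [::] 0 e)).+1.
  set l2 := (l1 + size (comp_c l1 c1)).+1; rewrite -/l1 in C3 C4 C5 C2.
  rewrite -/l2 in C2 C4 C5.
  suff: [/\ tk s <= tk s', bounded s' & reach (2 + B * (1 + D)) c3
      (fun cf' => pc cf' = l2 + size (comp_c l2 c2) /\ sim s' cf')].
    case=> t12 bs2 R2; split=> //.
    apply: (reach_weaken (reach_bind R1 (fun _ e _ => ltac:(rewrite e; exact: R2)))).
      by rewrite -/B -/D; nia.
    by move=> c4 [pc4 sm4]; rewrite pc4 !size_cat /= !size_cat /= -/l1 -/l2; split=> //; lia.
  move: IH; case: ifPn => E0 IH.
  - have := IH _ (jump_to c3 l2) w2 C5 erefl ok3 sm3 bs d2.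
    case=> [|t12 bs2 R2]; [by lia|split=> //; rewrite -/D in R2].
    eapply reach_jumpz; [exact: ok3|by rewrite pc3; exact: C2|rewrite r3 E0].
    apply: (reach_weaken R2) => //.
    by have := time_c_le c2 s; rewrite /B; nia.
  - have := IH _ (jump_to c3 l1) w1 C3 erefl ok3 sm3 bs d1.
    case=> [|t12 bs2 R2]; [by lia|split=> //; rewrite -/D in R2].
    eapply reach_jumpz; [exact: ok3|by rewrite pc3; exact: C2|rewrite r3 (negPf E0) pc3].
    have R3 : reach (time_c c1 s * (1 + D) + 1) (jump_to c3 l1)
        (fun cf' => pc cf' = l2 + size (comp_c l2 c2) /\ sim s' cf').
      apply: reach_bind R2 _ => c4 [pc4 sm4] ok4.
      eapply reach_jump; [exact: ok4|by rewrite pc4; exact: C4|].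
      by apply: reach_done; first exact: ok4; split; [exact: erefl|exact: sm4].
    by apply: (reach_weaken R3) => //; have := time_c_le c1 s; rewrite /B; nia.
- move=> x y c s xy l cf /and3P[xn yn wc] /code_at_cons[C1 /code_at_cons[C2 _]].
  move=> pcc ok sm bs dN bL; split=> //; rewrite subnn addn0 muln1.
  have [sv _ _ _] := sm.
  have [rx ry] : reg cf x = vr s x /\ reg cf y = vr s y.
    by rewrite !sv //; rewrite /nsmall /nvars in xn yn *; lia.
  have t0 : tmp 0 < NR by apply: leq_ltn_trans dN; rewrite tmp_leq.
  have E0 : vr s y - vr s x = 0 by lia.
  rewrite 2!addSn.
  eapply reach_op; [by rewrite pcc; exact: C1|exact: ok|exact: t0
    |by rewrite rx ry /= E0; have := one_lt; lia|rewrite rx ry /= E0 => ok2].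
  eapply reach_jumpz; [exact: ok2|by rewrite pc_set_reg pcc; exact: C2|].
  rewrite reg_set eqxx /=; apply: reach_done; first exact: ok2.
  rewrite pc_jump size_cat /=; split; first by lia.
  by apply: sim_keeps sm; apply: (keeps_set (d := 0)).
- move=> x y c s s1 s2 xy _ IH1 x1 _ IH2 l cf /[dup] wf /and3P[xn yn wc] /[dup] CC.
  move=> /code_at_cons[C1 /code_at_cons[C2 /code_at_cat[C3 /code_at_cons[C4]]]].
  move=> /code_at_cons[C5 /code_at_cons[C6 _]] pcc ok sm bs dN bL.
  have [sv _ _ _] := sm.
  have [xv yv] : x < nvars /\ y < nvars by rewrite /nsmall /nvars in xn yn *; lia.
  have [rx ry] : reg cf x = vr s x /\ reg cf y = vr s y by rewrite !sv.
  have t0 : tmp 0 < NR by apply: leq_ltn_trans dN; rewrite tmp_leq.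
  have xNR : x < NR by apply: leq_ltn_trans t0; rewrite /tmp; lia.
  have yN : vr s y <= N by case: bs => _ ->.
  have NB : N < 2 ^ LB by apply: ltn_exp2W N_L _; lia.
  have L1 := one_lt.
  set c1 := jump_to (set_reg cf (tmp 0) (vr s y - vr s x)) l.+2.
  have dB : vr s y - vr s x < 2 ^ LB by lia.
  have ok1 : within c1 by apply: within_set_reg.
  have sm1 : sim s c1 by apply: sim_keeps sm; apply: (keeps_set (d := 0)).
  have bL1 : bits_c N L c <= LB by lia.
  have [t01 bs1 R1] := IH1 l.+2 c1 wc C3 erefl ok1 sm1 bs dN bL1.
  have xt : (x == tmp 0) = false by rewrite /tmp; lia.
  have tx : (tmp 0 == x) = false by rewrite /tmp; lia.
  set s1' := setv s1 x (vr s x).+1.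
  have R2 : reach (time_c c s * (1 + (tk s1 - tk s)) + 3) c1
      (fun cf' => pc cf' = l /\ sim s1' cf').
    apply: reach_bind R1 _ => c4 [pc4 sm4] ok4.
    have [sv4 _ _ _] := sm4; have rx4 : reg c4 x = vr s x by rewrite sv4.
    eapply reach_const; [by rewrite pc4; exact: C4|exact: ok4|exact: t0|exact: L1|move=> ok5].
    eapply reach_op; [by rewrite pc_set_reg pc4; exact: C5|exact: ok5|exact: xNR
      |by rewrite !reg_set eqxx xt rx4 /=; lia|rewrite !reg_set eqxx xt rx4 /= => ok6].
    eapply reach_jump; [exact: ok6|by rewrite !pc_set_reg pc4; exact: C6|].
    apply: reach_done; [exact: ok6|split; first by []].
    apply: (sim_setv (c := set_reg c4 (tmp 0) 1)) => //.
      by apply: sim_keeps sm4; apply: (keeps_set (d := 0)).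
    by move=> z _; rewrite reg_jump !reg_set addn1.
  have bs1' : bounded s1'.
    apply: bounded_setv => //; rewrite /vbound; apply/andP; split; first by lia.
    by apply/implyP => _; lia.
  have [k [c4 [kk st [pc4 sm4]]]] := R2.
  have ok4 : within c4 by elim: st.
  have [t12 bs2 R3] := IH2 l c4 wf CC pc4 ok4 sm4 bs1' dN bL.
  have {}t12 : tk s1 <= tk s2 by [].
  split=> //; first by lia.
  have R4 : reach k c1 (fun z => z = c4) by exists k, c4.
  have R5 := reach_bind R4 (fun _ e _ => ltac:(rewrite e; exact: R3)).
  apply: (reach_weaken (k1 := (k + (2 + (5 + steps_c N c) * (N.+1 - vr s1' x)) *
                                   (1 + (tk s2 - tk s1))).+2) _ _ (fun _ => id)).
    eapply reach_op; [by rewrite pcc; exact: C1|exact: ok|exact: t0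
      |by rewrite rx ry|rewrite rx ry /= => ok2].
    eapply reach_jumpz; [exact: ok2|by rewrite pc_set_reg pcc; exact: C2|].
    rewrite reg_set eqxx (_ : _ - _ == 0 = false) ?pc_set_reg ?pcc; last by lia.
    exact: R5.
  have -> : vr s1' x = (vr s x).+1 by rewrite /= -[eqn x x]/(x == x) eqxx.
  have E1 := time_c_le c s; set B := steps_c N c in E1 *.
  have -> : N.+1 - vr s x = (N.+1 - (vr s x).+1).+1 by lia.
  move: (N.+1 - (vr s x).+1) => a.
  have -> : tk s2 - tk s = (tk s1 - tk s) + (tk s2 - tk s1) by lia.
  move: (tk s1 - tk s) (tk s2 - tk s1) kk => p q kk.
  have : time_c c s * (1 + p) <= B * (1 + p) by rewrite leq_mul2r E1 orbT.
  nia.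
- move=> e c s E0 l cf /andP[we wc] /code_at_cat[C1 /code_at_cons[C2 _]] pcc ok sm bs.
  rewrite !tmp_maxn !gtn_max => /andP[de dc] bL.
  have eL : bits_e N L e <= LB by lia.
  split=> //; rewrite subnn addn0 muln1 -addnA.
  apply: reach_bind; first exact: (comp_e0 we C1 pcc ok sm bs de eL).
  move=> c3 [pc3 k3 r3 sm3] ok3.
  eapply reach_jumpz; [exact: ok3|by rewrite pc3; exact: C2|rewrite r3 E0 /=].
  apply: reach_done; [exact: ok3|split; last exact: sm3].
  by rewrite pc_jump !size_cat /= !size_cat /=; lia.
- move=> e c s s1 s2 E0 _ IH1 _ IH2 l cf /[dup] wf /andP[we wc] /[dup] CC.
  move=> /code_at_cat[C1 /code_at_cons[C2 /code_at_cat[C3 /code_at_cons[C4 _]]]].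
  move=> pcc ok sm bs /[dup] dN; rewrite !tmp_maxn !gtn_max => /andP[de dc] bL.
  have eL : bits_e N L e <= LB by lia.
  have cL : bits_c N L c <= LB by lia.
  set l1 := (l + size (comp_e l [::] 0 e)).+1; rewrite -/l1 in C2 C3 C4.
  have [k [c3 [kk st [pc3 k3 r3 sm3]]]] := comp_e0 we C1 pcc ok sm bs de eL.
  have ok3 : within c3 by elim: st.
  have R1 : reach k cf (fun z => z = c3) by exists k, c3.
  have [t01 bs1 R2] := IH1 l1 (jump_to c3 l1) wc C3 erefl ok3 sm3 bs dc cL.
  have R3 : reach (time_c c s * (1 + (tk s1 - tk s)) + 1) (jump_to c3 l1)
      (fun cf' => pc cf' = l /\ sim (tick s1) cf').
    apply: reach_bind R2 _ => c4 [pc4 sm4] ok4.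
    eapply reach_jump; [exact: ok4|by rewrite pc4; exact: C4|].
    by apply: reach_done; first exact: ok4; split; [exact: erefl|exact: sm4].
  have [k' [c4 [kk' st' [pc4 sm4]]]] := R3.
  have ok4 : within c4 by elim: st'.
  have [t12 bs2 R4] := IH2 l c4 wf CC pc4 ok4 sm4 bs1 dN bL.
  have {}t12 : (tk s1).+1 <= tk s2 by [].
  split=> //; first by lia.
  have R5 : reach k' (jump_to c3 l1) (fun z => z = c4) by exists k', c4.
  have R6 := reach_bind R5 (fun _ e _ => ltac:(rewrite e; exact: R4)).
  have R7 := reach_bind (k2 := (k' + (steps_e N e + 2 + steps_c N c) *
      (1 + (tk s2 - (tk s1).+1))).+1) R1 (fun _ e ok => ltac:(rewrite e;
     eapply reach_jumpz; [exact: ok3|by rewrite pc3; exact: C2|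
       rewrite r3 (introF eqP E0) pc3; exact: R6])).
  apply: (reach_weaken R7) => //.
  have E1 := time_c_le c s; set B := steps_c N c in E1 *.
  have -> : tk s2 - tk s = (tk s1 - tk s) + (tk s2 - (tk s1).+1) + 1 by lia.
  move: (tk s1 - tk s) (tk s2 - (tk s1).+1) kk' => p q kk'.
  have : time_c c s * (1 + p) <= B * (1 + p) by rewrite leq_mul2r E1 orbT.
  nia.
Qed.

End Compilation.

(** * Frames and weakest preconditions *)

Definition CFor x y c := CSeq (CAsg x (ECst 0)) (CLoop x y c).

Fixpoint modv c : seq nat :=
  match c with
  | CSkip | CSet _ _ _ | CPut _ _ => [::]
  | CAsg x _ | CGet x _ => [:: x]
  | CSeq c1 c2 | CIf _ c1 c2 => modv c1 ++ modv c2
  | CLoop x _ c => x :: modv c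
  | CWhile _ c => modv c
  end.

Fixpoint moda c : seq nat :=
  match c with
  | CSkip | CAsg _ _ | CGet _ _ => [::]
  | CSet a _ _ => [:: a]
  | CPut _ _ => [:: 0]
  | CSeq c1 c2 | CIf _ c1 c2 => moda c1 ++ moda c2
  | CLoop _ _ c | CWhile _ c => moda c
  end.

Fixpoint tickless c : bool :=
  match c with
  | CSeq c1 c2 | CIf _ c1 c2 => tickless c1 && tickless c2
  | CLoop _ _ c => tickless c
  | CWhile _ _ => false
  | _ => true
  end.

(** Most parts of an invariant survive because a command does not touch what they speak of. With
    this record each such obligation becomes a membership test in a concrete list. *)
Record frm c s s' : Prop := Frm {
  frm_v : forall x, x \notin modv c -> vr s' x = vr s x;
  frm_a : forall a, a \notin moda c -> ar s' a = ar s a;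
  frm_le : tk s <= tk s';
  frm_tk : tickless c -> tk s' = tk s }.

Section Logic.
Variables base N L Ix : nat.
Notation ev := (ev base N L Ix).
Notation bounded := (bounded N L).
Notation vbound := (vbound N L).

Lemma frm_trans c s1 s2 s3 : frm c s1 s2 -> frm c s2 s3 -> frm c s1 s3.
Proof.
move=> [v1 a1 l1 t1] [v2 a2 l2 t2]; split.
- by move=> x xc; rewrite v2 ?v1.
- by move=> x xc; rewrite a2 ?a1.
- exact: leq_trans l2.
- by move=> tc; rewrite t2 ?t1.
Qed.

Lemma frm_sub c c' s s' : {subset modv c <= modv c'} -> {subset moda c <= moda c'} ->
  (tickless c' -> tickless c) -> frm c s s' -> frm c' s s'.
Proof.
move=> sv sa st [v a l t]; split=> //.
- by move=> x xc; apply: v; apply: contra xc; apply: sv.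
- by move=> x xc; apply: a; apply: contra xc; apply: sa.
- by move=> /st /t.
Qed.

Lemma ev_frm c s s' : ev c s s' -> frm c s s'.
Proof.
elim=> {c s s'} //.
- by move=> s x e _; split=> //= y; rewrite inE -[eqn y x]/(y == x) => /negPf ->.
- by move=> s x e _ _; split=> //= y; rewrite inE -[eqn y x]/(y == x) => /negPf ->.
- by move=> s a e1 e2 _ _; split=> //= b; rewrite inE -[eqn b a]/(b == a) => /negPf ->.
- by move=> s e1 e2 _ _; split=> //= b; rewrite inE -[eqn b 0]/(b == 0) => /negPf ->.
- move=> c1 c2 s1 s2 s3 _ F1 _ F2; apply: (@frm_trans _ _ s2); apply: frm_sub; try eassumption.
  + by move=> x; rewrite /= mem_cat => ->.
  + by move=> x; rewrite /= mem_cat => ->.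
  + by case/andP.
  + by move=> x; rewrite /= mem_cat => ->; rewrite orbT.
  + by move=> x; rewrite /= mem_cat => ->; rewrite orbT.
  + by case/andP.
- move=> e c1 c2 s s' _; apply: frm_sub; case: ifP => _.
  + by move=> x; rewrite /= mem_cat => ->; rewrite orbT.
  + by move=> x; rewrite /= mem_cat => ->.
  + by move=> x; rewrite /= mem_cat => ->; rewrite orbT.
  + by move=> x; rewrite /= mem_cat => ->.
  + by case/andP.
  + by case/andP.
- move=> x y c s s1 s2 _ _ F _ _ F2; apply: frm_trans F2.
  have {}F : frm (CLoop x y c) s s1.
    by apply: frm_sub F => // z; rewrite /= inE orbC => ->.
  apply: frm_trans F _; split=> //= z.
  by rewrite inE negb_or -[eqn z x]/(z == x) => /andP[/negPf ->].
- move=> e c s s1 s2 _ _ F _ F2.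
  case: F F2 => v a l t [v2 a2 l2 t2]; split=> //=.
  + by move=> x xc; rewrite v2 ?v.
  + by move=> x xc; rewrite a2 ?a.
  + by apply: leq_trans l2; apply: leqW.
Qed.

Definition WP c (Q : state -> Prop) s :=
  bounded s -> exists s', [/\ ev c s s', bounded s' & Q s'].

Lemma WP_conseq c (Q R : state -> Prop) s :
  WP c R s -> (forall s', frm c s s' -> bounded s -> bounded s' -> R s' -> Q s') -> WP c Q s.
Proof.
move=> H RQ bs; have [s' [e b r]] := H bs; exists s'; split=> //.
by apply: RQ => //; apply: ev_frm.
Qed.

Lemma WP_skip (Q : state -> Prop) s : Q s -> WP CSkip Q s.
Proof. by move=> q bs; exists s; split=> //; apply: ev_skip. Qed.

Lemma WP_asg x e (Q : state -> Prop) s :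
  (bounded s -> vbound x (eval s [::] e)) ->
  Q (setv s x (eval s [::] e)) -> WP (CAsg x e) Q s.
Proof.
move=> vb q bs; exists (setv s x (eval s [::] e)); split=> //.
  by apply: ev_asg; apply: vb.
by apply: bounded_setv => //; apply: vb.
Qed.

Lemma WP_get x e (Q : state -> Prop) s :
  eval s [::] e < base -> (bounded s -> vbound x (ar s 0 (eval s [::] e))) ->
  Q (setv s x (ar s 0 (eval s [::] e))) -> WP (CGet x e) Q s.
Proof.
move=> eb vb q bs; exists (setv s x (ar s 0 (eval s [::] e))); split=> //.
  by apply: ev_get => //; apply: vb.
by apply: bounded_setv => //; apply: vb.
Qed.

Lemma WP_set a e1 e2 (Q : state -> Prop) s :
  (bounded s -> eval s [::] e1 <= Ix) -> (bounded s -> eval s [::] e2 < 2 ^ L) ->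
  Q (seta s a (eval s [::] e1) (eval s [::] e2)) -> WP (CSet a e1 e2) Q s.
Proof.
move=> ib vb q bs; exists (seta s a (eval s [::] e1) (eval s [::] e2)); split=> //.
  by apply: ev_set; [apply: ib|apply: vb].
by apply: bounded_seta => //; apply: vb.
Qed.

Lemma WP_put e1 e2 (Q : state -> Prop) s :
  (bounded s -> eval s [::] e1 < base) -> (bounded s -> eval s [::] e2 < 2 ^ L) ->
  Q (seta s 0 (eval s [::] e1) (eval s [::] e2)) -> WP (CPut e1 e2) Q s.
Proof.
move=> ib vb q bs; exists (seta s 0 (eval s [::] e1) (eval s [::] e2)); split=> //.
  by apply: ev_put; [apply: ib|apply: vb].
by apply: bounded_seta => //; apply: vb.
Qed.

Lemma WP_seq c1 c2 (Q : state -> Prop) s : WP c1 (WP c2 Q) s -> WP (CSeq c1 c2) Q s.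
Proof.
move=> H bs; have [s1 [e1 b1 /(_ b1)[s2 [e2 b2 q]]]] := H bs.
by exists s2; split=> //; apply: ev_seq e1 e2.
Qed.

Lemma WP_if e c1 c2 (Q : state -> Prop) s :
  (eval s [::] e <> 0 -> WP c1 Q s) -> (eval s [::] e = 0 -> WP c2 Q s) ->
  WP (CIf e c1 c2) Q s.
Proof.
move=> H1 H2 bs; have : exists s', [/\ ev (if eval s [::] e == 0 then c2 else c1) s s',
    bounded s' & Q s'].
  by case: ifP => /eqP E; [apply: H2|apply: H1].
by case=> s' [e' b q]; exists s'; split=> //; apply: ev_if.
Qed.

(* The invariant may not mention the loop variable [x]. *)
Lemma WP_for x y c (I : nat -> state -> Prop) (Q : state -> Prop) s :
  [&& x < nsmall, y < nsmall, x \notin modv c, y \notin modv c & x != y] ->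
  I 0 s ->
  (forall i s' v, I i s' -> I i (setv s' x v)) ->
  (forall i s', i < vr s y -> frm (CFor x y c) s s' -> vr s' x = i -> bounded s' ->
     I i s' -> WP c (I i.+1) s') ->
  (forall s', frm (CFor x y c) s s' -> bounded s' -> I (vr s y) s' -> Q s') ->
  WP (CFor x y c) Q s.
Proof.
case/and5P=> xn yn xc yc xy I0 Ix' Istep Q' bs.
have F0 v : frm (CFor x y c) s (setv s x v).
  by split=> //= z; rewrite !inE negb_or -[eqn z x]/(z == x) => /andP[/negPf ->].
have vb0 : vbound x 0 by rewrite /vbound expn_gt0 implybT.
have bs0 : bounded (setv s x 0) by apply: bounded_setv.
have yE s' : frm (CFor x y c) s s' -> vr s' y = vr s y.
  by case=> v _ _ _; apply: v; rewrite /= !inE !negb_or eq_sym xy yc.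
suff H j i s' : i + j = vr s y -> frm (CFor x y c) s s' -> vr s' x = i -> bounded s' ->
    I i s' -> exists s2, [/\ ev (CLoop x y c) s' s2, frm (CFor x y c) s s2,
     bounded s2 & I (vr s y) s2].
  have x0 : vr (setv s x 0) x = 0 by rewrite /= -[eqn x x]/(x == x) eqxx.
  have [s2 [e2 f2 b2 i2]] := H _ 0 _ (add0n _) (F0 0) x0 bs0 (Ix' _ _ _ I0).
  exists s2; split=> //; last exact: Q'.
  by apply: ev_seq e2; apply: ev_asg.
elim: j i s' => [|j IH] i s' ij F xi b Ii.
  exists s'; split=> //; last by rewrite -ij addn0.
  by apply: ev_loop_end; rewrite yE // xi -ij addn0.
have iy : i < vr s y by lia.
have [s1 [e1 b1 I1]] := Istep i s' iy F xi b Ii b.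
have f1 := ev_frm e1.
have x1 : vr s1 x = vr s' x by case: f1 => v _ _ _; apply: v.
have F1 : frm (CFor x y c) s (setv s1 x i.+1).
  apply: frm_trans F _; case: f1 => v a l t; split=> //=.
  + by move=> z; rewrite !inE !negb_or -[eqn z x]/(z == x) => /and3P[/negPf -> _]; apply: v.
have vb1 : vbound x i.+1.
  have yN : vr s' y <= N by case: b => _ -> .
  have yL : vr s' y < 2 ^ L by case: b => ->.
  by rewrite /vbound; rewrite yE // in yN yL; rewrite (leq_ltn_trans iy) //=; apply/implyP; lia.
have x2 : vr (setv s1 x i.+1) x = i.+1 by rewrite /= -[eqn x x]/(x == x) eqxx.
have ij' : i.+1 + j = vr s y by lia.
have [s2 [e2 f2 b2 i2]] := IH _ _ ij' F1 x2 (bounded_setv b1 vb1) (Ix' _ _ _ I1).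
exists s2; split=> //; apply: ev_loop x1 _ => //; first by rewrite xi yE.
by rewrite xi.
Qed.

(** The tick counter is itself the variant: each round raises it, and a round may start only while
    it is below [T]. *)
Lemma WP_while e c (T : nat) (I Q : state -> Prop) s :
  I s ->
  (forall s', frm (CWhile e c) s s' -> bounded s' -> I s' -> eval s' [::] e <> 0 ->
    tk s' < T /\ WP c (fun s'' => I (tick s'')) s') ->
  (forall s', frm (CWhile e c) s s' -> bounded s' -> I s' -> eval s' [::] e = 0 -> Q s') ->
  WP (CWhile e c) Q s.
Proof.
move=> I0 Istep Q' bs.
suff H j s' : T - tk s' < j -> frm (CWhile e c) s s' -> bounded s' -> I s' ->
    exists s2, [/\ ev (CWhile e c) s' s2, bounded s2 & Q s2].
  by apply: (H (T - tk s).+1 s).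
elim: j s' => // j IH s' Tj F b Ii.
have [E0|E0] := altP (eval s' [::] e =P 0).
  by exists s'; split=> //; [apply: ev_while_end|apply: Q'].
have [tT W] := Istep s' F b Ii (elimN eqP E0).
have [s1 [e1 b1 I1]] := W b.
have f1 := ev_frm e1.
have [||||s2 [e2 b2 q2]] := IH (tick s1) => //.
- by case: f1 => _ _ l _ /=; lia.
- apply: frm_trans F _; case: f1 => v a l t; split=> //.
  exact: leqW.
by exists s2; split=> //; apply: ev_while e1 e2; apply/eqP.
Qed.

End Logic.

(** * States of the search *)

Section Radix.
Variable rho : nat -> nat.

(** Place values of a mixed radix system with radix [rho i] at place [i]: constantly 4 for the
    states, [choices] for the guesses. *)
Definition weight k := \prod_(0 <= i < k) rho i.
Definition digit x k := x %/ weight k %% rho k.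

Lemma weightS k : weight k.+1 = weight k * rho k.
Proof. by rewrite /weight big_nat_recr. Qed.

Lemma weight_gt0 N : (forall i, i < N -> 0 < rho i) -> 0 < weight N.
Proof.
elim: N => [|N IH] r0; first by rewrite /weight big_nil.
by rewrite weightS muln_gt0 r0 // IH // => i iN; apply: r0; apply: ltnW.
Qed.

Lemma dvdn_weight i N : i <= N -> weight i %| weight N.
Proof.
move/subnKC <-; elim: (N - i) => [|d IH]; first by rewrite addn0.
by rewrite addnS weightS dvdn_mulr.
Qed.

Lemma digit_mod i N x : i < N -> digit (x %% weight N) i = digit x i.
Proof.
move=> iN; have /dvdnP[q ->] := dvdn_weight iN.
rewrite /digit weightS mulnA [_ * rho i]mulnC mulnA -modn_divl.
by rewrite modn_dvdm // dvdn_mulr.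
Qed.

Lemma digit_inj N x y :
  (forall i, i < N -> 0 < rho i) -> x < weight N -> y < weight N ->
  (forall i, i < N -> digit x i = digit y i) -> x = y.
Proof.
elim: N x y => [|N IH] x y r0 xN yN E; first by move: xN yN; rewrite /weight big_nil; lia.
have r0' i : i < N -> 0 < rho i by move=> iN; apply: r0; apply: ltnW.
have w0 := weight_gt0 r0'.
rewrite (divn_eq x (weight N)) (divn_eq y (weight N)); congr (_ * _ + _).
  have := E N (leqnn _); rewrite /digit !modn_small //.
    by rewrite ltn_divLR // mulnC -weightS.
  by rewrite ltn_divLR // mulnC -weightS.
apply: IH; rewrite ?ltn_mod // => i iN.
by rewrite !digit_mod // E // ltnW.
Qed.

Lemma digit_ex N (d : nat -> nat) :
  (forall i, i < N -> d i < rho i) ->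
  exists x, x < weight N /\ forall i, i < N -> digit x i = d i.
Proof.
elim: N => [|N IH] dr; first by exists 0; rewrite /weight big_nil.
have r0 i : i < N -> 0 < rho i by move=> iN; have := dr i (ltnW iN); lia.
have w0 := weight_gt0 r0.
have [x [xN xd]] := IH (fun i h => dr i (ltnW h)).
exists (d N * weight N + x); split.
  rewrite weightS [_ * rho N]mulnC (@leq_trans ((d N).+1 * weight N)) //.
    by rewrite mulSn addnC ltn_add2r.
  by rewrite leq_mul2r dr ?orbT.
move=> i; rewrite ltnS leq_eqVlt => /predU1P[->|iN].
  by rewrite /digit divnMDl // divn_small // addn0 modn_small // dr.
by rewrite -(digit_mod _ iN) modnMDl modn_small // xd.
Qed.

(** There is no carry, because the digit at [k] is 0 before and [t] is a legal digit there. *)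
Lemma digit_add N x k t l :
  (forall i, i < N -> 0 < rho i) -> k < N -> l < N -> digit x k = 0 -> t < rho k ->
  digit (x + t * weight k) l = if l == k then t else digit x l.
Proof.
move=> r0 kN lN xk tk.
have w0 : 0 < weight k by apply: weight_gt0 => i ik; apply: r0; apply: ltn_trans kN.
have r0k := r0 _ kN.
have E : (x + t * weight k) %/ weight k = x %/ weight k + t by rewrite divnDMl.
case: (ltngtP l k) => [lk|kl|->].
- by rewrite -(digit_mod _ lk) addnC modnMDl digit_mod.
- have /dvdnP[q qE] := dvdn_weight kl.
  rewrite /digit qE weightS [q * _]mulnC !divnMA divnDMl //.
  rewrite (_ : (x %/ weight k + t) %/ rho k = x %/ weight k %/ rho k) //.
  move: xk; rewrite /digit => xk.
  have Eq := divn_eq (x %/ weight k) (rho k); rewrite xk addn0 in Eq.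
  by rewrite [X in (X + _) %/ _]Eq divnMDl // (divn_small tk) addn0.
- rewrite /digit E -modnDml; move: xk; rewrite /digit => ->.
  by rewrite add0n modn_small.
Qed.

Lemma ltn_add_weight N x k t :
  (forall i, i < N -> 0 < rho i) -> x < weight N -> k < N -> digit x k = 0 -> t < rho k ->
  x + t * weight k < weight N.
Proof.
move=> r0 xN kN xk tk.
have w0 : 0 < weight k by apply: weight_gt0 => i ik; apply: r0; apply: ltn_trans kN.
have r0k := r0 _ kN.
have /dvdnP[q qE] := dvdn_weight kN; rewrite qE weightS in xN *.
have xq : x %/ weight k %/ rho k < q by rewrite -divnMA ltn_divLR ?muln_gt0 ?w0 // mulnC.
rewrite -ltn_divLR ?muln_gt0 ?w0 // divnMA divnDMl //.
move: xk; rewrite /digit => xk.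
have Eq := divn_eq (x %/ weight k) (rho k); rewrite xk addn0 in Eq.
rewrite [X in (X + _) %/ _]Eq divnMDl //.
by rewrite (divn_small tk) addn0.
Qed.

(** A state and the vertex placed last thus determine the preceding state, which is how [output]
    walks back. *)
Lemma digit_sub N x k t :
  (forall i, i < N -> 0 < rho i) -> k < N -> digit x k = 0 -> t < rho k ->
  x + t * weight k - digit (x + t * weight k) k * weight k = x.
Proof. by move=> r0 kN xk tk; rewrite (digit_add r0 kN kN xk tk) eqxx addnK. Qed.

Lemma digit0 k : (forall i, i <= k -> 0 < rho i) -> digit 0 k = 0.
Proof. by move=> r0; rewrite /digit div0n mod0n. Qed.

End Radix.

Lemma inj_surj_below m (f : nat -> nat) :
  (forall x, x < m -> f x < m) ->
  (forall x y, x < m -> y < m -> f x = f y -> x = y) ->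
  forall d, d < m -> exists2 x, x < m & f x = d.
Proof.
move=> fm fi d dm.
have u : uniq [seq f x | x <- iota 0 m].
  rewrite map_inj_in_uniq ?iota_uniq // => x y; rewrite !mem_iota => xm ym.
  exact: fi.
have sub : {subset [seq f x | x <- iota 0 m] <= iota 0 m}.
  by move=> y /mapP[x]; rewrite !mem_iota => xm ->; apply: fm.
have [|_ E] := uniq_min_size u sub; first by rewrite size_map.
have : d \in iota 0 m by rewrite mem_iota.
by rewrite -E => /mapP[x]; rewrite mem_iota => xm ->; exists x.
Qed.

(** * The order in which the positions are filled *)

Section Rank.
Variables m b1 : nat.
Hypothesis b1_gt0 : 0 < b1.

(* Positions are filled in the lexicographic order of (offset within the
   segment, segment). *)
Definition before y x := (y %% b1 < x %% b1) || ((y %% b1 == x %% b1) && (y < x)).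
Definition rank x := \sum_(0 <= y < m) before y x.
(** The inverse of [rank] below [m], given by a sum since that is what the expressions of the
    program can evaluate. *)
Definition posn d := \sum_(0 <= x < m) (rank x == d) * x.

Lemma before_trans : transitive before.
Proof. by rewrite /before => y x z; lia. Qed.

Lemma before_total x y : x != y -> before x y || before y x.
Proof. by rewrite /before; lia. Qed.

Lemma beforexx x : before x x = false.
Proof. by rewrite /before; lia. Qed.

Lemma rank_count x : rank x = count (before^~ x) (iota 0 m).
Proof. by rewrite /rank big_mkcond /= -sum1_count [RHS]big_mkcond /= /index_iota subn0; apply: eq_bigr => i _; case: (before i x). Qed.

Lemma rank_before y x : y < m -> before y x -> rank y < rank x.
Proof.
move=> ym yx; rewrite !rank_count.
have -> : count (before^~ y) (iota 0 m) = count (before^~ y) (filter (before^~ x) (iota 0 m)).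
  rewrite count_filter; apply: eq_count => z /=.
  by case zy: (before z y) => //=; rewrite (before_trans zy yx).
rewrite -size_filter -[X in _ < X]size_filter.
rewrite -filter_predI.
have yin : y \in filter (before^~ x) (iota 0 m) by rewrite mem_filter yx mem_iota.
rewrite filter_predI; set t := filter (before^~ x) _ in yin *.
rewrite size_filter -(count_predC (before^~ y) t) -addn1 leq_add2l -has_count.
by apply/hasP; exists y => //=; rewrite beforexx.
Qed.

Lemma rank_lt x : x < m -> rank x < m.
Proof.
move=> xm; rewrite rank_count -[X in _ < X](size_iota 0) -(count_predC (before^~ x)).
rewrite -addn1 leq_add2l -has_count; apply/hasP; exists x; first by rewrite mem_iota.
by rewrite /= beforexx.
Qed.

Lemma rank_inj x y : x < m -> y < m -> rank x = rank y -> x = y.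
Proof.
move=> xm ym E; apply/eqP; apply: contraT => /before_total/orP[] /rank_before => /(_ _).
  by rewrite E ltnn => /(_ xm).
by rewrite E ltnn => /(_ ym).
Qed.

Lemma posn_rank x : x < m -> posn (rank x) = x.
Proof.
move=> xm; rewrite /posn big_mkord (bigD1 (Ordinal xm)) //= eqxx mul1n big1 ?addn0 // => i ix.
case: eqP => // /(rank_inj (ltn_ord i) xm) E; case/negP: ix; apply/eqP; exact: val_inj.
Qed.

Lemma rank_posn d : d < m -> rank (posn d) = d.
Proof.
move=> dm; have [x xm <-] := inj_surj_below rank_lt rank_inj dm.
by rewrite posn_rank.
Qed.

Lemma posn_lt d : d < m -> posn d < m.
Proof.
move=> dm; have [x xm <-] := inj_surj_below rank_lt rank_inj dm.
by rewrite posn_rank.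
Qed.

Lemma posn_le d : posn d <= m.
Proof.
have [/posn_lt/ltnW //|md] := ltnP d m.
rewrite /posn big_nat big1 // => x xm; case: eqP => // E.
by have := rank_lt xm; rewrite E ltnNge md.
Qed.

Lemma posn_inj d e : d < m -> e < m -> posn d = posn e -> d = e.
Proof. by move=> dm em E; rewrite -(rank_posn dm) -(rank_posn em) E. Qed.

Lemma posn_before d e : d < e -> e < m -> before (posn d) (posn e).
Proof.
move=> de em; have dm := ltn_trans de em.
have : posn d != posn e by apply/eqP => /(posn_inj dm em) E; rewrite E ltnn in de.
case/before_total/orP => // /(rank_before (posn_lt em)).
by rewrite !rank_posn // => ed; have := ltn_trans de ed; rewrite ltnn.
Qed.

(** If [x] lay in an earlier segment than [y], then, its offset not being larger, the distance would
    be at least [b1]. If it lay two or more segments later, the distance would exceed [b1], as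
    offsets differ by less than [b1]. *)
Lemma before_segments x y : before x y -> (x < y + b1) && (y < x + b1) ->
  x %/ b1 = y %/ b1 \/ x %/ b1 = (y %/ b1).+1.
Proof.
rewrite /before; have xE := divn_eq x b1; have yE := divn_eq y b1.
have xr := ltn_pmod x b1_gt0; have yr := ltn_pmod y b1_gt0.
set p := x %/ b1 in xE *; set q := y %/ b1 in yE *.
set r := x %% b1 in xE xr *; set t := y %% b1 in yE yr *.
move=> xy /andP[h1 h2]; have [pq|[pq|[pq|qp]]] : p = q \/ p = q.+1 \/ p < q \/ q.+1 < p by lia.
- by left.
- by right.
- have : p.+1 * b1 <= q * b1 by rewrite leq_mul2r pq orbT.
  by rewrite mulSn => ?; exfalso; lia.
- have : q.+2 * b1 <= p * b1 by rewrite leq_mul2r qp orbT.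
  by rewrite !mulSn => ?; exfalso; lia.
Qed.

(** In the same segment only the offsets differ. In the next segment the distance is [b1] minus the
    difference of the offsets, and these are distinct: equal offsets together with [before x y]
    would force [x < y]. *)
Lemma segments_before x y : before x y ->
  x %/ b1 = y %/ b1 \/ x %/ b1 = (y %/ b1).+1 -> (x < y + b1) && (y < x + b1).
Proof.
rewrite /before; have xE := divn_eq x b1; have yE := divn_eq y b1.
have xr := ltn_pmod x b1_gt0; have yr := ltn_pmod y b1_gt0.
set p := x %/ b1 in xE *; set q := y %/ b1 in yE *.
set r := x %% b1 in xE xr *; set t := y %% b1 in yE yr *.
by move=> xy [pq|pq]; rewrite pq ?mulSn in xE; lia.
Qed.

End Rank.

Definition dig S k := digit (fun=> 4) S k.

Lemma dig_add m S k t l : k < m -> l < m -> dig S k = 0 -> t < 4 ->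
  dig (S + t * weight (fun=> 4) k) l = if l == k then t else dig S l.
Proof. by move=> km lm Sk t4; apply: (@digit_add _ m). Qed.

(* [au], [al]: whether the ends of an edge are placed; [su], [sl]: their
   segments.  In the right one of two neighbouring segments, the end of an
   edge is placed first. *)
Definition compat (au : bool) su (al : bool) sl :=
  [&& su <= sl.+1, sl <= su.+1, (su == sl.+1) ==> (al ==> au) & (sl == su.+1) ==> (au ==> al)].

(** [compat] is invariant under translation. Subtracting [p - 2] from both segments moves a parent
    in segment [p] to 2, the normal form in which the states are counted; [1 < p] prevents
    truncation. *)
Lemma compat_shift au al h p y z : 1 < p -> p <= h.+1 -> y + p = z + 2 ->
  compat au h al z -> compat au (h.+1 - p).+1 al y.
Proof.
move=> p2 ph yz; rewrite /compat; have -> : z = y + p - 2 by lia.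
case: au al => [] [] /=; rewrite ?andbT ?implybT ?implybF; lia.
Qed.

(** * The search for a fixed guess: soundness and completeness *)

Section Search.
Variables (m b1 : nat) (adj : nat -> nat -> bool) (typ : nat -> bool) (par f : nat -> nat).
Notation W := (weight (fun=> 4)).

(** Digits 1, 2 and 3 of an unguessed vertex stand for the segment left of its parent, the same one
    and the one to the right. With digit 0 an unguessed vertex has no segment yet and the value is
    meaningless. *)
Definition segd S k := if typ k then f (par k) + dig S k - 2 else f k.
Definition placed S := \sum_(0 <= k < m) (0 < dig S k).
(** The shift by [2 * m] leaves room for guesses that run below the first segment, so that truncated
    subtraction is exact throughout; see [guess_ge]. *)
Definition segn d := 2 * m + posn m b1 d %/ b1.
(** The next position dictates the segment, so there is at most one digit with which [k] can be
    placed. An impossible placement gives 0 or a number above 3, which [step] rejects. *)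
Definition newdig S k :=
  if typ k then segn (placed S) + 2 - f (par k) else nat_of_bool (f k == segn (placed S)).
Definition place S k := S + newdig S k * W k.
(** Placed vertices come earlier in the filling order, so by [before_segments] these are the only
    two segments that a placed neighbour may have. *)
Definition back S k :=
  all (fun l => [&& adj k l & 0 < dig S l] ==>
         (segd S l == segn (placed S)) || (segd S l == (segn (placed S)).+1)) (iota 0 m).
(** This is the pruning test on which the count of the states rests: it links the digit of [w] to
    the guesses and placements around [w]. Along an actual ordering the true segment of [w] is the
    witness [g]. *)
Definition valid S :=
  all (fun w => typ w ==>
         has (fun g => ((0 < dig S w) ==> (segd S w == g)) &&
            all (fun l => adj w l && ~~ typ l ==> compat (0 < dig S w) g (0 < dig S l) (f l))
              (iota 0 m))
          (iota 0 (3 * m))) (iota 0 m).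
Definition step S k :=
  [&& dig S k == 0, 0 < newdig S k, newdig S k < 4, back S k & valid (place S k)].

Inductive trace : nat -> seq nat -> Prop :=
| trace0 : trace 0 [::]
| traceS S ks k : trace S ks -> k < m -> step S k -> trace (place S k) (rcons ks k).

Lemma ltn_place S k : S < W m -> k < m -> step S k -> place S k < W m.
Proof. by move=> Sm km /and5P[/eqP ? _ ? _ _]; apply: ltn_add_weight. Qed.

Lemma dig_place S k l : k < m -> l < m -> step S k ->
  dig (place S k) l = if l == k then newdig S k else dig S l.
Proof. by move=> km lm /and5P[/eqP ? _ ? _ _]; apply: (@dig_add m). Qed.

Lemma placed_place S k : k < m -> step S k -> placed (place S k) = (placed S).+1.
Proof.
move=> km st; rewrite /placed !big_mkord (bigD1 (Ordinal km)) //= [in RHS](bigD1 (Ordinal km)) //=.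
rewrite dig_place // eqxx; case/and5P: (st) => /eqP -> -> _ _ _; rewrite add0n add1n; congr _.+1.
apply: eq_bigr => i ik; rewrite dig_place //; case: eqP => // E.
by case/negP: ik; apply/eqP/val_inj.
Qed.

Lemma place_sub S k : k < m -> step S k -> place S k - dig (place S k) k * W k = S.
Proof. by move=> km /and5P[/eqP ? _ ? _ _]; apply: (@digit_sub _ m). Qed.

Lemma placed_le S : placed S <= m.
Proof.
rewrite /placed; have : \sum_(0 <= k < m) (0 < dig S k) <= \sum_(0 <= k < m) 1.
  by apply: leq_sum => i _; apply: leq_b1.
by rewrite sum_nat_const_nat subn0 muln1.
Qed.

Lemma step_placed S k : k < m -> step S k -> placed S < m.
Proof. by move=> km st; have := placed_le (place S k); rewrite placed_place. Qed.

Lemma segd_new S k : k < m -> ~~ typ (par k) -> step S k ->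
  segd (place S k) k = segn (placed S).
Proof.
move=> km _ st; rewrite /segd dig_place // eqxx; case/and5P: st => _ + _ _ _.
rewrite /newdig; case: (typ k) => [|]; first by lia.
by case: eqP => // -> .
Qed.

Record trace_spec S ks : Prop := TraceSpec {
  ts_lt : S < W m;
  ts_uniq : uniq ks;
  ts_below : all (ltn^~ m) ks;
  ts_size : size ks = placed S;
  ts_mem : forall k, k < m -> (k \in ks) = (0 < dig S k);
  ts_seg : forall i, i < size ks -> segd S (nth 0 ks i) = segn i;
  ts_back : forall i j, i < j -> j < size ks -> adj (nth 0 ks j) (nth 0 ks i) ->
    segn i = segn j \/ segn i = (segn j).+1 }.

Hypothesis typ_par : forall k, k < m -> typ k -> ~~ typ (par k).

Lemma traceP S ks : trace S ks -> trace_spec S ks.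
Proof.
elim=> {S ks} [|S ks k tr [lt un be sz me se ba] km st].
  split=> //; first by apply: weight_gt0.
    by rewrite /placed big_nat big1 // => i _; rewrite /dig digit0.
  by move=> k km; rewrite /dig digit0.
have kks : k \notin ks by rewrite me //; case/and5P: st => /eqP ->.
split.
- exact: ltn_place.
- by rewrite rcons_uniq kks.
- by rewrite all_rcons /= km.
- by rewrite size_rcons sz placed_place.
- move=> l lm; rewrite mem_rcons inE me // dig_place //; case: eqP => // _.
  by case/and5P: st => _ -> .
- move=> i; rewrite size_rcons ltnS leq_eqVlt nth_rcons => /predU1P[->|ik].
    rewrite ltnn eqxx sz; case tk: (typ k); last first.
      by rewrite /segd tk; case/and5P: st => _; rewrite /newdig tk; case: eqP.
    by apply: segd_new => //; apply: typ_par.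
  rewrite ik -(se _ ik) /segd dig_place //; last exact: (allP be) (mem_nth 0 ik).
  by case: eqP => // E; rewrite -E mem_nth in kks.
- move=> i j ij; rewrite size_rcons ltnS leq_eqVlt !nth_rcons => /predU1P[jE|jk].
    have ik : i < size ks by rewrite -jE.
    rewrite jE ltnn eqxx ik => a; case/and5P: (st) => _ _ _ /allP/(_ (nth 0 ks i)) + _.
    have im : nth 0 ks i < m by exact: (allP be) (mem_nth 0 ik).
    rewrite mem_iota im a -me // mem_nth // se // -sz => /(_ isT)/=.
    by case/orP=> /eqP; [left|right].
  by rewrite jk (ltn_trans ij jk); apply: ba.
Qed.

Hypothesis b1_gt0 : 0 < b1.
Hypothesis adj_sym : forall k l, k < m -> l < m -> adj k l = adj l k.

(** Of two adjacent vertices, the one placed later was checked against the other by [back], and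
    [segments_before] turns this into a bound on the distance. *)
Lemma trace_sound S ks : trace S ks -> placed S = m ->
  forall k l, k < m -> l < m -> adj k l ->
  posn m b1 (index k ks) < posn m b1 (index l ks) + b1.
Proof.
move=> /traceP[lt un be sz me se ba] Sm.
have kin k : k < m -> k \in ks.
  have := @uniq_min_size _ ks (iota 0 m) un; case.
  - by move=> x /(allP be); rewrite mem_iota.
  - by rewrite size_iota sz Sm.
  by move=> _ E km; rewrite E mem_iota.
have H i j : i < j -> j < m -> adj (nth 0 ks j) (nth 0 ks i) ->
   (posn m b1 i < posn m b1 j + b1) && (posn m b1 j < posn m b1 i + b1).
  move=> ij jm a; apply: segments_before => //; first exact: posn_before.
  by have := ba i j ij; rewrite sz Sm => /(_ jm a); rewrite /segn; lia.
move=> k l km lm a; have kk := kin k km; have ll := kin l lm.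
have ik : index k ks < m by rewrite -Sm -sz index_mem.
have il : index l ks < m by rewrite -Sm -sz index_mem.
case: (ltngtP (index k ks) (index l ks)) => [kl|lk|->].
- by have := H _ _ kl il; rewrite !nth_index // adj_sym // => /(_ a) /andP[].
- by have := H _ _ lk ik; rewrite !nth_index // => /(_ a) /andP[].
- by rewrite -addn1 leq_add2l.
Qed.

(** The search can imitate the ordering [p]: it places the vertices by increasing rank of their
    positions, and [before_segments] makes every check succeed. *)
Lemma complete (p : nat -> nat) :
  (forall k, k < m -> p k < m) ->
  (forall k l, k < m -> l < m -> p k = p l -> k = l) ->
  (forall k l, k < m -> l < m -> adj k l -> p k < p l + b1) ->
  (forall k, k < m -> typ k -> par k < m /\ adj k (par k)) ->
  (forall k, k < m -> ~~ typ k -> f k = 2 * m + p k %/ b1) ->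
  exists S ks, trace S ks /\ placed S = m.
Proof.
move=> pm pi pa tp fB.
have pk k l : k < m -> l < m -> adj k l -> before b1 (p k) (p l) ->
    p k %/ b1 = p l %/ b1 \/ p k %/ b1 = (p l %/ b1).+1.
  by move=> km lm a /before_segments; apply=> //; rewrite !pa // adj_sym.
have near k l : k < m -> l < m -> adj k l ->
   p k %/ b1 <= (p l %/ b1).+1 /\ p l %/ b1 <= (p k %/ b1).+1.
  move=> km lm a; have [E|] := eqVneq (p k) (p l); first by rewrite E; lia.
  have a' : adj l k by rewrite adj_sym.
  by case/(before_total b1_gt0)/orP => [/(pk _ _ km lm a)|/(pk _ _ lm km a')]; lia.
(* The digits of the state in which exactly the first [d] positions of the filling order are
   occupied. *)
pose dg d k := if rank m b1 (p k) < d then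
   (if typ k then 2 * m + p k %/ b1 + 2 - f (par k) else 1) else 0.
have dgB d k : k < m -> rank m b1 (p k) < d -> 0 < dg d k < 4.
  move=> km kd; rewrite /dg kd; case tk: (typ k) => //.
  have [pm' a] := tp k km tk; rewrite fB ?typ_par //.
  by have := near _ _ km pm' a; lia.
have plc S d : d <= m -> (forall k, k < m -> dig S k = dg d k) -> placed S = d.
  move=> dm E.
  transitivity (\sum_(0 <= x < m) (rank m b1 (p x) < d)).
    rewrite /placed big_nat [RHS]big_nat; apply: eq_bigr => k km; rewrite E //.
    by case: (ltnP (rank m b1 (p k)) d) => kd; [have /andP[-> _] := dgB _ _ km kd|rewrite /dg [_ < d]ltnNge kd].
  rewrite -[RHS](size_iota 0) big_mkcond /= /index_iota subn0.
  have -> : \sum_(i <- iota 0 m) (if true then nat_of_bool (rank m b1 (p i) < d) else 0) =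
     count (ltn^~ d) [seq rank m b1 (p i) | i <- iota 0 m].
    by rewrite count_map -sum1_count [RHS]big_mkcond /=; apply: eq_bigr => i _; case: ltnP.
  (* The ranks of the [m] vertices are a permutation of the numbers below [m], so exactly [d] of
     them are below [d]. *)
  have /permP -> : perm_eq [seq rank m b1 (p i) | i <- iota 0 m] (iota 0 m).
    have sz : size [seq rank m b1 (p i) | i <- iota 0 m] = size (iota 0 m) by rewrite size_map.
    have u : uniq [seq rank m b1 (p i) | i <- iota 0 m].
      rewrite map_inj_in_uniq ?iota_uniq // => x y; rewrite !mem_iota => xm ym /(rank_inj b1_gt0).
      by move=> /(_ (pm _ xm) (pm _ ym)); apply: pi.
    apply: uniq_perm; rewrite ?iota_uniq //.
    apply: (uniq_min_size u _ _).2; last by rewrite sz.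
    by move=> y /mapP[x]; rewrite !mem_iota => xm ->; apply: rank_lt => //; apply: pm.
  rewrite -(subnKC dm) iotaD count_cat add0n.
  have c1 : count (ltn^~ d) (iota 0 d) = d.
    have /eqP := size_iota 0 d; rewrite eq_sym => /eqP dE.
    by apply/eqP; rewrite [X in _ == X]dE -all_count; apply/allP => x; rewrite mem_iota.
  have c2 : count (ltn^~ d) (iota d (m - d)) = 0.
    by apply/eqP; rewrite -leqn0 leqNgt -has_count; apply/hasPn => x; rewrite mem_iota /=; lia.
  by rewrite c1 c2 addn0 size_iota.
have sgE S d k : k < m -> d <= m -> (forall k, k < m -> dig S k = dg d k) -> 0 < dig S k ->
    segd S k = 2 * m + p k %/ b1.
  move=> km dm E; rewrite /segd E // /dg; case: ifP => // kd _; case tk: (typ k).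
    have [pm' a] := tp k km tk; rewrite fB ?typ_par //.
    have := near _ _ km pm' a; move: (p k %/ b1) (p (par k) %/ b1) => x y; lia.
  by rewrite fB // tk.
have val S d : d <= m -> (forall k, k < m -> dig S k = dg d k) -> valid S.
  move=> dm E; apply/allP => w; rewrite mem_iota => /= wm; apply/implyP => tw.
  apply/hasP; exists (2 * m + p w %/ b1).
    by rewrite mem_iota /=; have := leq_div (p w) b1; have := pm w wm; lia.
  apply/andP; split; first by apply/implyP => dw; rewrite (sgE S d).
  apply/allP => l; rewrite mem_iota => /= lm; apply/implyP => /andP[a tl].
  have pl k : k < m -> (0 < dig S k) = (rank m b1 (p k) < d).
    move=> km; rewrite E //; case: (ltnP (rank m b1 (p k)) d) => kd; first by case/andP: (dgB _ _ km kd).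
    by rewrite /dg [_ < d]ltnNge kd.
  rewrite /compat fB // !pl //; have [n1 n2] := near _ _ wm lm a.
  have al : adj l w by rewrite adj_sym.
  have wl : (p w %/ b1 = (p l %/ b1).+1) -> rank m b1 (p l) < d -> rank m b1 (p w) < d.
    move=> q rl; have : p w != p l by apply/eqP => e; move: q; rewrite e; lia.
    case/(before_total b1_gt0)/orP => [/(rank_before b1_gt0 (pm _ wm))|/(pk _ _ lm wm al)]; last by lia.
    by move=> h; apply: ltn_trans h rl.
  have lw : (p l %/ b1 = (p w %/ b1).+1) -> rank m b1 (p w) < d -> rank m b1 (p l) < d.
    move=> q rl; have : p w != p l by apply/eqP => e; move: q; rewrite e; lia.
    case/(before_total b1_gt0)/orP => [/(pk _ _ wm lm a)|/(rank_before b1_gt0 (pm _ lm))]; first by lia.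
    by move=> h; apply: ltn_trans h rl.
  apply/and4P; split; [lia|lia| |].
    by apply/implyP => /eqP q; apply/implyP; apply: wl; lia.
  by apply/implyP => /eqP q; apply/implyP; apply: lw; lia.
suff H d : d <= m -> exists S ks, trace S ks /\ forall k, k < m -> dig S k = dg d k.
  have [S [ks [tr E]]] := H m (leqnn m).
  by exists S, ks; split=> //; apply: plc E.
elim: d => [|d IH] dm.
  by exists 0, [::]; split; [apply: trace0|move=> k km; rewrite /dig digit0].
have [S [ks [tr E]]] := IH (ltnW dm).
(* The vertex that [p] assigns to the next position to be filled. *)
have [k km pkd] := inj_surj_below pm pi (posn_lt b1_gt0 dm).
have rk : rank m b1 (p k) = d by rewrite pkd rank_posn.
have Sd := plc S d (ltnW dm) E.
have sd : segn (placed S) = 2 * m + p k %/ b1 by rewrite Sd /segn pkd.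
have nd : newdig S k = dg d.+1 k.
  rewrite /newdig /dg rk ltnSn sd; case tk: (typ k) => //.
  by rewrite fB ?tk // eqxx.
have k0 : dig S k = 0 by rewrite E // /dg rk ltnn.
have n4 : 0 < newdig S k < 4 by rewrite nd dgB // rk.
have E' l : l < m -> dig (place S k) l = dg d.+1 l.
  move=> lm; rewrite (@dig_add m) //; last by case/andP: n4.
  case: eqP => [->//|lk]; rewrite E // /dg.
  suff -> : (rank m b1 (p l) < d) = (rank m b1 (p l) < d.+1) by [].
  rewrite ltnS [RHS]leq_eqVlt; case: eqP => // rl.
  by case: lk; apply: pi => //; apply: (rank_inj b1_gt0 (pm _ lm) (pm _ km)); rewrite rk.
exists (place S k), (rcons ks k); split=> //; apply: traceS => //.
apply/and5P; split; rewrite ?k0 //; [by case/andP: n4|by case/andP: n4| |exact: val E'].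
apply/allP => l; rewrite mem_iota => /= lm; apply/implyP => /andP[a dl].
rewrite sd (sgE S d) //; last exact: ltnW.
have lk : before b1 (p l) (p k).
  rewrite pkd; have rl : rank m b1 (p l) < d.
    by move: dl; rewrite E // /dg; case: (ltnP (rank m b1 (p l)) d).
  by rewrite -(posn_rank b1_gt0 (pm _ lm)); apply: posn_before.
have al : adj l k by rewrite adj_sym.
by have [->|->] := pk _ _ lm km al lk; rewrite ?eqxx // addnS eqxx orbT.
Qed.

End Search.

(** * Counting the states *)

Lemma card_ord_pred n (P : pred nat) : #|[pred i : 'I_n | P i]| = count P (iota 0 n).
Proof. by rewrite -val_enum_ord count_map cardE /enum_mem size_filter count_filter; apply: eq_count => i /=; rewrite !inE andbT. Qed.

(* Segments are relative to the one of the parent of the unguessed vertex,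
   shifted to 2.  [dw]: digit of that vertex; [s]: its segment is [s.+1];
   [y]: code of a child, [2 * guess digit + placed]. *)
Definition head_ok (a : bool) dw s := ((0 < dw) ==> (s.+1 == dw)) && compat (0 < dw) s.+1 a 2.
Definition child_ok dw s y := compat (0 < dw) s.+1 (odd y) y./2.

(** Three segments, placed or not, make six combinations, and the parent excludes exactly one:
    unplaced on the right of a placed parent, or placed on the left of an unplaced one. *)
Lemma head_ok_count a :
  \sum_(dw < 4) count (head_ok a dw) (iota 0 3) <= 5.
Proof. by rewrite !big_ord_recl big_ord0; case: a. Qed.

(** Three of the five guesses for a child are within one segment of [s.+1]. Combined with its
    placement they make six codes, one of which is excluded for the same reason as above. *)
Lemma child_ok_count (dw : 'I_4) s : s \in iota 0 3 ->
  (0 < dw) ==> (s.+1 == dw) -> count (child_ok dw s) (iota 0 10) <= 5.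
Proof. by case: dw => [[|[|[|[|]]]] //= h]; rewrite !inE => /or3P[] /eqP ->. Qed.

(** For one child the product [5 * 5] of the two preceding bounds is too large. Counting each code
    once, however many segments [s] admit it, saves three, and [5 * 22 <= 4 * 28]. *)
Lemma single_child_count a :
  \sum_(dw < 4) count (fun y => has (fun s => head_ok a dw s && child_ok dw s y) (iota 0 3))
    (iota 0 10) <= 22.
Proof. by rewrite !big_ord_recl big_ord0; case: a. Qed.

Section Count.
Variables (m : nat) (root : 'I_m) (typ : pred 'I_m) (par : 'I_m -> 'I_m).
Hypothesis typ_root : ~~ typ root.
Hypothesis typ_par : forall k, k != root -> typ (par k) = ~~ typ k.
Hypothesis par_par : forall k, k != root -> par k != root -> par (par k) < k.

Local Notation code := {ffun 'I_m -> 'I_10}.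

Definition children w := [set x | [&& x != root, ~~ typ x & par x == w]].
Definition block_ok w (c : code) :=
  (c w < 4) && has (fun s => head_ok (odd (c (par w))) (c w) s &&
    [forall (x | x \in children w), child_ok (c w) s (c x)]) (iota 0 3).

Definition tails (C : {set 'I_m}) a (dw : 'I_4) : {set code} :=
  [set v : code | (ord0.-support v \subset C) &&
     has (fun s => head_ok a dw s && [forall (x | x \in C), child_ok dw s (v x)]) (iota 0 3)].

Lemma card_pffun (C : {set 'I_m}) (P : pred nat) :
  #|[set v : code | (ord0.-support v \subset C) && [forall (x | x \in C), P (v x)]]| <=
  (count P (iota 0 10)) ^ #|C|.
Proof.
rewrite -card_ord_pred -(card_pffun_on ord0 (mem C)) cardsE subset_leq_card //.
apply/subsetP => v; rewrite !inE => /andP[sv /forall_inP Pv].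
by apply/pffun_onP; split=> // y /imageP[x xC ->]; rewrite inE; apply: Pv.
Qed.

Lemma tails_le_union (C : {set 'I_m}) a dw :
  #|tails C a dw| <=
  (count (fun y => has (fun s => head_ok a dw s && child_ok dw s y) (iota 0 3)) (iota 0 10)) ^ #|C|.
Proof.
apply: leq_trans (card_pffun _ _); apply: subset_leq_card; apply/subsetP => v; rewrite !inE.
case/andP=> -> /hasP[s si /andP[h /forall_inP ch]]; apply/forall_inP => x xC.
by apply/hasP; exists s; rewrite // h ch.
Qed.

Lemma tails_le_sum (C : {set 'I_m}) a dw : #|tails C a dw| <= count (head_ok a dw) (iota 0 3) * 5 ^ #|C|.
Proof.
pose B s := [set v : code | (ord0.-support v \subset C) &&
   [forall (x | x \in C), child_ok dw s (v x)]].
have sub : tails C a dw \subset \bigcup_(s <- iota 0 3 | head_ok a dw s) B s.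
  apply/subsetP => v; rewrite inE => /andP[sv /hasP[s si /andP[h ch]]].
  by rewrite (big_rem s) //= h inE inE sv ch.
apply: leq_trans (subset_leq_card sub) _.
have le : #|\bigcup_(s <- iota 0 3 | head_ok a dw s) B s| <=
    \sum_(s <- iota 0 3 | head_ok a dw s) #|B s|.
  elim/big_ind2: _ => // [|A n1 A' n2 h1 h2]; first by rewrite cards0.
  by apply: leq_trans (leq_card_setU _ _) _; apply: leq_add.
apply: leq_trans le _; rewrite -sum1_count big_distrl /= big_seq_cond [leqRHS]big_seq_cond.
apply: leq_sum => s /andP[si /andP[h _]]; rewrite mul1n (leq_trans (card_pffun _ _)) //.
have := child_ok_count si h.
by case: #|C| => // n h5; rewrite leq_exp2r.
Qed.

Lemma tails_sum (C : {set 'I_m}) a : 5 ^ #|C| * \sum_(dw < 4) #|tails C a dw| <= 4 * 28 ^ #|C|.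
Proof.
case: #|C| (tails_le_union C a) (tails_le_sum C a) => [|[|n]] U S.
- rewrite !expn0 mul1n; apply: leq_trans (leq_sum _ (fun i _ => U i)) _.
  by rewrite sum_nat_const card_ord.
- rewrite !expn1; have := leq_trans (leq_sum _ (fun i _ => U i)) (single_child_count a).
  by move: (\sum_(dw < 4) _) => x; lia.
- have : \sum_(dw < 4) #|tails C a dw| <= 5 * 5 ^ n.+2.
    apply: leq_trans (leq_sum _ (fun i _ => S i)) _.
    by rewrite -big_distrl leq_mul2r head_ok_count orbT.
  move: (\sum_(dw < 4) _) => x xS.
  apply: (@leq_trans (5 ^ n.+2 * (5 * 5 ^ n.+2))); first by rewrite leq_mul2l xS orbT.
  (* Two children are the critical case: [5 * 25 ^ 2 = 3125 <= 3136 = 4 * 28 ^ 2]. Each further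
     child multiplies the sides by 25 and 28. *)
  rewrite mulnCA -expnMn; elim: n {U S xS} => [|n IH]; first by [].
  by rewrite ![_ ^ n.+3]expnS; move: IH; rewrite -/(5 * 5); lia.
Qed.

(** The coordinates that are fixed after the blocks of the unguessed vertices below [j], a block
    being such a vertex with its guessed children. The count adds the blocks one at a time, in the
    order of their indices. *)
Definition upto j : {set 'I_m} :=
  [set x | [|| x == root, typ x && (x < j) | [&& x != root, ~~ typ x & par x < j]]].
Definition codes j : {set code} :=
  [set c : code | [&& ord0.-support c \subset upto j, c root < 2 &
                  [forall (w | typ w && (w < j)), block_ok w c]]].

Lemma card_codes0 : #|codes 0| <= 2.
Proof.
apply: (@leq_trans #|'I_2|); last by rewrite card_ord.
pose h (c : code) : 'I_2 := inord (c root).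
rewrite -(card_in_imset (f := h) (D := codes 0)); first exact: max_card.
move=> c c'; rewrite !inE => /and3P[/subsetP s1 c1 _] /and3P[/subsetP s2 c2 _].
move/(congr1 val); rewrite /= !inordK // => E; apply/ffunP => x.
have [->|xr] := eqVneq x root; first exact: val_inj.
have N y : x \in upto 0 -> y by rewrite inE (negPf xr) ltn0 andbF /= ltn0 !andbF.
have {}s1 := contraT (fun h => N false (s1 x h)).
have {}s2 := contraT (fun h => N false (s2 x h)).
by move: s1 s2 => /eqP-> /eqP->.
Qed.

Lemma codes_skip (j : 'I_m) : ~~ typ j -> codes j.+1 = codes j.
Proof.
move=> tj.
have E x : typ x && (x < j.+1) = typ x && (x < j).
  by case tx: (typ x) => //=; rewrite ltnS leq_eqVlt; case: eqP => // /val_inj xj; rewrite xj (negPf tj) in tx.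
have U : upto j.+1 = upto j.
  apply/setP => x; rewrite !inE E; case: eqVneq => //= xr; congr (_ || _).
  case tx: (typ x) => //=; rewrite ltnS leq_eqVlt; case: eqP => // /val_inj xj.
  by have := typ_par xr; rewrite xj (negPf tj) tx.
apply/setP => c; rewrite !inE U; congr [&& _, _ & _].
by apply: eq_forallb => x; rewrite E.
Qed.

Definition erase (j : 'I_m) (c : code) : code :=
  [ffun x => if (x == j) || (x \in children j) then ord0 else c x].

(** The condition for an earlier block [w] reads [w], its parent and its children. None of these is
    erased: if [par w] were a child of [j], then [par_par] would give [j < w]. *)
Lemma erase_codes (j : 'I_m) c : typ j -> c \in codes j.+1 -> erase j c \in codes j.
Proof.
move=> tj; rewrite !inE => /and3P[/subsetP sc c1 /forall_inP cok]; apply/and3P; split.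
- apply/subsetP => x; rewrite !inE ffunE; case: ifP => //; rewrite !inE.
  move=> /negbT; rewrite !negb_or !negb_and !negbK => /andP[xj xch] /sc; rewrite !inE !ltnS.
  case: eqVneq xch => //= xr; case tx: (typ x) => /=.
    by rewrite orbF leq_eqVlt -[_ == j :> nat]/(x == j) (negPf xj) orbF.
  by move=> pj; rewrite leq_eqVlt -[par x == j :> nat]/(par x == j) (negPf pj).
- rewrite ffunE; case: ifP => //.
- apply/forall_inP => w /andP[tw wj]; have := cok w; rewrite tw ltnS (ltnW wj) => /(_ isT).
  have keep x : x != j -> x \notin children j -> erase j c x = c x.
    by move=> h1 h2; rewrite ffunE (negPf h1) (negPf h2).
  have wj' : w != j by apply/eqP => E; rewrite E ltnn in wj.
  rewrite /block_ok keep //; last by rewrite inE tw /= andbF.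
  have wr : w != root by apply: contraNneq typ_root => <-.
  rewrite keep.
  + case/andP=> -> /hasP[s si /andP[h /forall_inP ch]]; apply/hasP; exists s; rewrite // h /=.
    apply/forall_inP => x xw; rewrite keep; first exact: ch.
      by apply/eqP => E; move: xw; rewrite E inE tj andbF.
    by move: xw; rewrite !inE => /and3P[-> -> /eqP->].
  + by apply/eqP => E; have := typ_par wr; rewrite E tj tw.
  + rewrite inE; apply/negP => /and3P[pr _ /eqP pj].
    by have := par_par wr pr; rewrite pj ltnNge ltnW.
Qed.

(** A member of the fibre is determined by the digit of [j] and the codes of its children. The code
    of the parent of [j] is not erased, so its placement bit can be read off [c']. *)
Lemma fiber_le (j : 'I_m) c' : typ j ->
  #|[set c in codes j.+1 | erase j c == c']| <=
  \sum_(dw < 4) #|tails (children j) (odd (c' (par j))) dw|.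
Proof.
move=> tj; set a := odd _; under eq_bigr do rewrite -sum1_card.
rewrite pair_big_dep /= sum1_card.
pose h (c : code) : 'I_4 * code :=
  (inord (c j), [ffun x => if x \in children j then c x else ord0]).
have c4 c : c \in codes j.+1 -> c j < 4.
  rewrite inE => /and3P[_ _ /forall_inP/(_ j)]; rewrite tj ltnSn => /(_ isT).
  by case/andP.
rewrite -(card_in_imset (f := h)).
  apply: subset_leq_card; apply/subsetP => p /imsetP[c]; rewrite inE => /andP[cC /eqP E] ->.
  suff : (h c).2 \in tails (children j) a (h c).1 by [].
  rewrite inE /=; have jc4 := c4 c cC; rewrite inordK //; move: cC.
  rewrite inE => /and3P[_ _ /forall_inP/(_ j)]; rewrite tj ltnSn => /(_ isT).
  case/andP=> _ /hasP[s si /andP[hd /forall_inP ch]]; apply/andP; split.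
    by apply/subsetP => x; rewrite inE ffunE; case: ifP.
  have jr : j != root by apply: contraNneq typ_root => <-.
  suff : has (fun s => head_ok a (c j) s &&
     [forall (x | x \in children j), child_ok (c j) s ((h c).2 x)]) (iota 0 3) by [].
  apply/hasP; exists s; rewrite // /a -E ffunE; case: ifP => [|_].
    rewrite inE => /orP[/eqP e|/and3P[pr _ /eqP pp]].
      by have := typ_par jr; rewrite e tj.
    by have := par_par jr pr; rewrite pp ltnn.
  by rewrite hd; apply/forall_inP => x xC; rewrite ffunE xC; apply: ch.
move=> c d; rewrite inE => /andP[cC /eqP E]; rewrite inE => /andP[dC /eqP E'].
case=> /(congr1 val) /=; rewrite !inordK ?c4 // => Ej /ffunP Et.
apply/ffunP => x; have [->|xj] := eqVneq x j; first exact: val_inj.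
have [xC|xC] := boolP (x \in children j).
  by have := Et x; rewrite !ffunE xC.
have /ffunP/(_ x) : erase j c = erase j d by rewrite E E'.
by rewrite !ffunE (negPf xj) (negPf xC).
Qed.

Lemma codes_block (j : 'I_m) : typ j ->
  5 ^ #|children j| * #|codes j.+1| <= 4 * 28 ^ #|children j| * #|codes j|.
Proof.
move=> tj; rewrite -[#|codes j.+1|]sum1_card (partition_big (erase j) (mem (codes j))) /=; last first.
  by move=> c; apply: erase_codes.
rewrite -[#|codes j|]sum1_card !big_distrr /=; apply: leq_sum => c' _; rewrite muln1.
apply: leq_trans (tails_sum (children j) (odd (c' (par j)))); rewrite leq_mul2l; apply/orP; right.
apply: leq_trans (fiber_le c' tj); rewrite sum1_card.
by apply: eq_leq; apply: eq_card => c; rewrite [RHS]inE.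
Qed.

Definition guessed := [set x | (x != root) && ~~ typ x].

Lemma codes_le j : j <= m ->
  5 ^ (\sum_(w : 'I_m | typ w && (w < j)) #|children w|) * #|codes j| <=
  2 * 4 ^ #|[set w : 'I_m | typ w && (w < j)]| *
  28 ^ (\sum_(w : 'I_m | typ w && (w < j)) #|children w|).
Proof.
elim: j => [|j IH] jm.
  rewrite big_pred0 => [|w]; last by rewrite ltn0 andbF.
  by rewrite mul1n muln1 (leq_trans card_codes0) // leq_pmulr // expn_gt0.
have {}IH := IH (ltnW jm); pose o := Ordinal jm.
have E x : typ x && (x < j.+1) = (typ x && (x < j)) || (typ x && (x == o)).
  by rewrite ltnS leq_eqVlt -[x == j :> nat]/(x == o); case: (typ x) => //=; rewrite orbC.
have [to|to] := boolP (typ o); last first.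
  have E' x : typ x && (x < j.+1) = typ x && (x < j).
    by rewrite E; case: eqP => [->|_]; rewrite ?andbF ?orbF // (negPf to).
  rewrite (codes_skip to) (eq_bigl _ _ E').
  by rewrite (_ : [set w : 'I_m | typ w && (w < j.+1)] = [set w : 'I_m | typ w && (w < j)]) //;
     apply/setP => x; rewrite !inE E'.
have -> : [set w : 'I_m | typ w && (w < j.+1)] = o |: [set w : 'I_m | typ w && (w < j)].
  by apply/setP => x; rewrite !inE E orbC; case: eqP => [->|_]; rewrite ?to ?andbF.
rewrite cardsU1 inE ltnn andbF add1n.
have -> : \sum_(w : 'I_m | typ w && (w < j.+1)) #|children w| =
   #|children o| + \sum_(w : 'I_m | typ w && (w < j)) #|children w|.
  rewrite (bigD1 o) /=; last by rewrite to ltnS /= .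
  congr addn; apply: eq_bigl => x; rewrite E; case: eqP => [->|_]; last by rewrite !andbT andbF orbF.
  by rewrite ltnn !andbF.
have h2 := leq_mul (codes_block to) (leqnn (5 ^ (\sum_(w : 'I_m | typ w && (w < j)) #|children w|))).
have h1 := leq_mul (leqnn (4 * 28 ^ #|children o|)) IH.
rewrite !expnD expnS; move: h1 h2.
by rewrite /=; lia.
Qed.

Lemma sum_children : \sum_(w : 'I_m | typ w) #|children w| = #|guessed|.
Proof.
rewrite -[#|guessed|]sum1_card [RHS](partition_big par typ) /=; last first.
  by move=> x; rewrite inE => /andP[xr tx]; rewrite typ_par.
by apply: eq_bigr => w tw; rewrite -sum1_card; apply: eq_bigl => x; rewrite !inE andbA.
Qed.

Definition valid_codes : {set code} :=
  [set c : code | (c root < 2) && [forall (w | typ w), block_ok w c]].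

(** The blocks contribute a factor 4 for each unguessed vertex and [28 / 5] for each guessed child;
    the factor 2 is the placement bit of the root. *)
Theorem card_valid_codes :
  5 ^ #|guessed| * #|valid_codes| <= 2 * 4 ^ #|[set w | typ w]| * 28 ^ #|guessed|.
Proof.
have := codes_le (leqnn m).
have T (w : 'I_m) : typ w && (w < m) = typ w by rewrite ltn_ord andbT.
rewrite (eq_bigl _ _ T) sum_children.
have -> : [set w : 'I_m | typ w && (w < m)] = [set w | typ w].
  by apply/setP => w; rewrite !inE T.
suff -> : codes m = valid_codes by [].
apply/setP => c; rewrite !inE; have -> /= : ord0.-support c \subset upto m.
  by apply/subsetP => x _; rewrite inE !ltn_ord !andbT; case: eqVneq => //= _; case: (typ x).
by congr andb; apply: eq_forallb => w; rewrite T.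
Qed.

End Count.

(* A spanning tree rooted at [root] and its 2-colouring [typ]. *)
Record tree m (adj : nat -> nat -> bool) (typ : nat -> bool) par root : Prop := Tree {
  tree_root : root < m;
  tree_typ_root : ~~ typ root;
  tree_par : forall k, k < m -> par k < m;
  tree_typ : forall k, k < m -> k != root -> typ (par k) = ~~ typ k;
  tree_adj : forall k, k < m -> k != root -> adj k (par k) /\ adj (par k) k;
  tree_par_par : forall k, k < m -> k != root -> par k != root -> par (par k) < k }.

Lemma leq_exp2r0 a b e : a <= b -> a ^ e <= b ^ e.
Proof. by case: e => // e ab; rewrite leq_exp2r. Qed.

(** * Guesses, and the bound on the pairs of a guess and a state *)

Section Guess.
Variables (m : nat) (adj : nat -> nat -> bool) (typ : nat -> bool) (par : nat -> nat).
Variable root : nat.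
Hypothesis T : tree m adj typ par root.

(** An unguessed vertex has one choice, hence a digit that is always 0 and takes no room in the
    number of a guess. *)
Definition choices k := if k == root then m else if typ k then 1 else 5.
Definition nguess := weight choices m.

(** Grandparents have smaller indices, so recursion on a bound for the index suffices; by
    [guess_upto_stable] any large enough bound gives the same value. The root is settled in the base
    case, because its index need not be 0. *)
Fixpoint guess_upto g n : nat -> nat :=
  if n is n'.+1 then
    fun k => if (k == n') && ~~ typ k && (k != root)
             then guess_upto g n' (par (par k)) + digit choices g k - 2
             else guess_upto g n' k
  else fun k => if k == root then 2 * m + digit choices g root else 0.
Definition guess g := guess_upto g m.

Lemma choices_gt0 k : k < m -> 0 < choices k.
Proof. by rewrite /choices => km; case: ifP => _; [lia|case: ifP]. Qed.

Lemma guess_upto_stable g n n' k : (k < n <= n') || (k == root) ->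
  guess_upto g n' k = guess_upto g n k.
Proof.
have root_stable i : guess_upto g i root = 2 * m + digit choices g root.
  elim: i => [|i IH] /=; first by rewrite eqxx.
  by rewrite eqxx andbF.
case/orP=> [/andP[kn /subnKC <-]|/eqP->]; last by rewrite !root_stable.
elim: (n' - n) => [|d IH]; first by rewrite addn0.
rewrite addnS /=; case: eqP => [E|_] //=.
by move: kn; rewrite E; lia.
Qed.

Lemma grandparent_lt k : k < m -> ~~ typ k -> k != root ->
  typ (par k) /\ (~~ typ (par (par k))) /\ (par (par k) < k).
Proof.
move=> km tk kr; have tp := tree_typ T km kr; rewrite tk in tp.
have pr : par k != root by apply: contraTneq tp => ->; apply: tree_typ_root T.
split=> //; split; last exact: (tree_par_par T).
by rewrite (tree_typ T) ?tp //; apply: (tree_par T).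
Qed.

Lemma guess_root g : guess g root = 2 * m + digit choices g root.
Proof. by rewrite /guess (@guess_upto_stable g 0) ?eqxx ?orbT //= eqxx. Qed.

Lemma guess_step g k : k < m -> ~~ typ k -> k != root ->
  guess g k = guess g (par (par k)) + digit choices g k - 2.
Proof.
move=> km tk kr; have [tp [tpp lt]] := grandparent_lt km tk kr.
rewrite /guess (@guess_upto_stable g k.+1) ?ltnSn ?km //= eqxx tk kr /=.
by rewrite (@guess_upto_stable g k m) // lt ltnW.
Qed.

(** A vertex lies at most 2 segments left of its grandparent, whose index is smaller. So at most
    [2 * k] of the initial [2 * m] is lost, and the [- 2] of the decoding never truncates. *)
Lemma guess_ge g k : k < m -> ~~ typ k -> 2 <= guess g k /\ 2 * m <= guess g k + 2 * k
  \/ k = root /\ 2 * m <= guess g k.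
Proof.
elim/ltn_ind: k => k IH km tk; have [->|kr] := eqVneq k root.
  by right; rewrite guess_root; lia.
left; have [tp [tpp lt]] := grandparent_lt km tk kr; rewrite guess_step //.
by have := IH _ lt (ltn_trans lt km) tpp; lia.
Qed.

Lemma guess_le g n k : guess_upto g n k <= 3 * m + 3 * n.
Proof.
elim: n k => [|n IH] k /=.
  case: ifP => // _; rewrite (_ : 3 * m = 2 * m + m) ?addn0; last by lia.
  have rm := tree_root T; rewrite leq_add2l ltnW // /digit /choices eqxx ltn_mod; lia.
case: ifP => [/andP[/andP[_ tk] kr]|_]; last by have := IH k; lia.
have d5 : digit choices g k < 5 by rewrite /digit /choices (negPf kr) (negPf tk) ltn_mod.
by have := IH (par (par k)); lia.
Qed.

Definition good g S :=
  valid m adj typ par (guess g) S && all (fun k => ~~ typ k ==> (dig S k <= 1)) (iota 0 m).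

Lemma valid_ext f f' S : (forall k, k < m -> ~~ typ k -> f k = f' k) ->
  valid m adj typ par f S = valid m adj typ par f' S.
Proof.
move=> E; apply: eq_in_all => w; rewrite mem_iota /= => wm; case tw: (typ w) => //=.
apply: eq_in_has => h _; congr andb.
  have wr : w != root by apply: contraTneq tw => ->; apply: tree_typ_root T.
  rewrite /segd tw E //; first exact: (tree_par T).
  by rewrite (tree_typ T) ?tw.
apply: eq_in_all => l; rewrite mem_iota /= => lm.
by case tl: (typ l); rewrite ?andbF //= E // tl.
Qed.

Let rm := tree_root T.
Let rootO := Ordinal rm.
Let parO (k : 'I_m) := insubd rootO (par k).

Let val_parO k : val (parO k) = par k.
Proof. by rewrite val_insubd (tree_par T). Qed.

(** The guess digit and the placement bit of a guessed vertex form one number below 10. The guess of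
    the root has [m] values and is kept apart in [pair_code], whence the factor [m] of the count. *)
Let code_of g S (k : nat) :=
  if typ k then dig S k else if k == root then dig S k else 2 * digit choices g k + dig S k.

Let pair_code (p : 'I_nguess * 'I_(weight (fun=> 4) m)) : 'I_m * {ffun 'I_m -> 'I_10} :=
  (insubd rootO (digit choices p.1 root), [ffun k : 'I_m => inord (code_of p.1 p.2 k)]).

Let good_dig g S k : good g S -> k < m -> ~~ typ k -> dig S k <= 1.
Proof. by case/andP=> _ /allP/(_ k) + km; rewrite mem_iota km => /(_ isT)/implyP; apply. Qed.

Let digit_lt5 g k : k < m -> k != root -> ~~ typ k -> digit choices g k < 5.
Proof. by move=> km kr tk; rewrite /digit /choices (negPf kr) (negPf tk) ltn_mod. Qed.

Let code_lt10 g S k : good g S -> k < m -> code_of g S k < 10.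
Proof.
move=> G km; rewrite /code_of; have d4 : dig S k < 4 by rewrite /dig /digit ltn_mod.
case tk: (typ k); first by lia.
case: eqP => [_|/eqP kr]; first by lia.
by have := digit_lt5 g km kr (negbT tk); have := good_dig G km (negbT tk); lia.
Qed.

Let pairs := [set p : 'I_nguess * 'I_(weight (fun=> 4) m) | good p.1 p.2].

Let pair_code_inj : {in pairs &, injective pair_code}.
Proof.
move=> [g S] [g' S']; rewrite !inE /= => G G' [] /(congr1 val).
have dm x : digit choices x root < m by rewrite /digit /choices eqxx ltn_mod; lia.
rewrite !val_insubd !dm => Er /ffunP Ec.
have E k : k < m -> code_of g S k = code_of g' S' k.
  move=> km; have := Ec (Ordinal km); rewrite !ffunE => /(congr1 val) /=.
  by rewrite !inordK // code_lt10.
have Ed k : k < m -> digit choices g k = digit choices g' k /\ dig S k = dig S' k.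
  move=> km; have := E k km; rewrite /code_of; case tk: (typ k).
    have kr : k != root by apply: contraTneq tk => ->; apply: tree_typ_root T.
    by move=> ->; rewrite /digit /choices (negPf kr) tk !modn1.
  case: eqP => [->|/eqP kr] //.
  by have := good_dig G km (negbT tk); have := good_dig G' km (negbT tk); lia.
congr pair; apply: val_inj => /=.
  apply: (@digit_inj choices m) => //; first exact: choices_gt0.
  by move=> i im; case: (Ed i im).
apply: (@digit_inj (fun=> 4) m) => // i im; by case: (Ed i im).
Qed.

Let typO : pred 'I_m := fun k => typ k.

Let pair_code_valid p : p \in pairs -> (pair_code p).2 \in valid_codes rootO typO parO.
Proof.
case: p => g S; rewrite inE /= => G; set c : {ffun _ -> _} := [ffun _ => _].
have cE (k : 'I_m) : c k = code_of g S k :> nat by rewrite ffunE inordK // code_lt10.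
have cB (k : 'I_m) : ~~ typ k -> odd (c k) = (0 < dig S k) /\
    (k != rootO -> (c k)./2 = digit choices g k).
  move=> tk; rewrite cE /code_of (negPf tk); have := good_dig G (ltn_ord k) tk.
  rewrite -[k == rootO]/(k == root :> nat).
  case: eqP => _; case: (dig S k) => [|[|d]] //= _; rewrite mul2n ?addn0 ?addn1 /=.
    by rewrite odd_double doubleK.
  by rewrite odd_double uphalf_double.
rewrite inE; apply/andP; split.
  rewrite cE /code_of; have := tree_typ_root T => tr; rewrite (negPf tr) eqxx.
  exact: good_dig G rm tr.
apply/forall_inP => w; rewrite {1}/typO => tw.
have wr : val w != root by apply: contraTneq tw => ->; apply: tree_typ_root T.
have tp : ~~ typ (par w) by rewrite (tree_typ T) // negbK.
have pm := tree_par T (ltn_ord w).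
have [awp apw] := tree_adj T (ltn_ord w) wr.
have fp2 : 2 <= guess g (par w) by have := guess_ge g pm tp; lia.
have cw : c w = dig S w :> nat by rewrite cE /code_of tw.
have tpO : ~~ typ (parO w) by rewrite val_parO.
have [cp _] := cB (parO w) tpO; rewrite val_parO in cp.
rewrite /block_ok cp cw; have -> /= : dig S w < 4 by rewrite /dig /digit ltn_mod.
case/andP: (G) => /allP/(_ (val w)); rewrite mem_iota ltn_ord tw => /(_ isT)/hasP[h _].
case/andP=> /implyP hw /allP hl _.
have /hl : par w \in iota 0 m by rewrite mem_iota.
rewrite awp tp /= => cwp.
have hseg : 0 < dig S w -> guess g (par w) + dig S w - 2 = h.
  by move=> /hw; rewrite /segd tw => /eqP.
have hp : guess g (par w) <= h.+1 /\ h <= (guess g (par w)).+1 by case/and4P: cwp; lia.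
suff : has (fun s => head_ok (0 < dig S (par w)) (dig S w) s &&
  [forall (x | x \in children rootO typO parO w), child_ok (dig S w) s (c x)]) (iota 0 3) by [].
(* Relative to the parent moved to 2, the segment [h] becomes [h + 2 - guess g (par w)], and
   [head_ok] expects one less. *)
apply/hasP; exists (h.+1 - guess g (par w)); first by rewrite mem_iota; lia.
apply/andP; split.
  apply/andP; split; last by apply: compat_shift cwp; rewrite 1?addnC; case: hp.
  by apply/implyP => dw; apply/eqP; have := hseg dw; lia.
apply/forall_inP => x; rewrite inE => /and3P[xr tx /eqP px].
have pxw : par x = w by rewrite -px val_parO.
have xr' : val x != root by [].
have /hl : val x \in iota 0 m by rewrite mem_iota ltn_ord.
have [axp apx] := tree_adj T (ltn_ord x) xr'; rewrite pxw in apx.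
rewrite apx tx /=.
rewrite guess_step // pxw /child_ok; have [-> /(_ xr) ->] := cB x tx.
by apply: compat_shift => //; [case: hp|rewrite subnK ?ltn_addr // addnC].
Qed.

Lemma count_good :
  5 ^ #|guessed rootO typO| * \sum_(0 <= g < nguess) count (good g) (iota 0 (weight (fun=> 4) m)) <=
  m * (2 * 4 ^ #|[set w | typO w]| * 28 ^ #|guessed rootO typO|).
Proof.
have -> : \sum_(0 <= g < nguess) count (good g) (iota 0 (weight (fun=> 4) m)) = #|pairs|.
  rewrite big_mkord -sum1dep_card (eq_bigr (fun g : 'I_nguess =>
     \sum_(S < weight (fun=> 4) m | good g S) 1)).
    by rewrite pair_big_dep.
  by move=> g _; rewrite -sum1_count -(big_mkord (good g) (fun=> 1)) /index_iota subn0.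
rewrite -(card_in_imset pair_code_inj).
have sub : pair_code @: pairs \subset setX [set: 'I_m] (valid_codes rootO typO parO).
  by apply/subsetP => q /imsetP[p pp ->]; rewrite !inE /=; have := pair_code_valid pp; rewrite inE.
have := subset_leq_card sub; rewrite cardsX cardsT card_ord => le.
have H : 5 ^ #|guessed rootO typO| * #|valid_codes rootO typO parO| <=
    2 * 4 ^ #|[set w | typO w]| * 28 ^ #|guessed rootO typO|.
  apply: card_valid_codes.
  - exact: tree_typ_root T.
  - by move=> k kr; rewrite /typO val_parO (tree_typ T).
  - move=> k kr; rewrite -[parO k == _]/(val (parO k) == root) !val_parO; exact: (tree_par_par T).
apply: leq_trans (leq_mul (leqnn m) H); rewrite mulnCA leq_mul2l le orbT //.
Qed.

Definition state_bound n := (2 * n * 19 ^ n) %/ 4 ^ n.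

Hypothesis balanced : \sum_(0 <= k < m) ~~ typ k <= (\sum_(0 <= k < m) typ k).+1.

Let card_typ : #|[set w | typO w]| = \sum_(0 <= k < m) typ k.
Proof. by rewrite -sum1dep_card big_mkcond big_mkord; apply: eq_bigr => i _; rewrite /typO; case: (typ i). Qed.

Let card_untyp : #|guessed rootO typO|.+1 = \sum_(0 <= k < m) ~~ typ k.
Proof.
rewrite /guessed big_mkord (bigD1 rootO) //= (tree_typ_root T) add1n; congr _.+1.
rewrite -sum1dep_card big_mkcond [RHS]big_mkcond; apply: eq_bigr => i _ /=.
by rewrite /typO; case: (i != rootO); case: (typ i).
Qed.

Let card_total : #|guessed rootO typO| + #|[set w | typO w]| + 1 = m.
Proof.
rewrite addnAC addn1 card_untyp card_typ -big_split /= -[RHS]muln1 -[RHS]mul1n.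
rewrite (eq_bigr (fun=> 1)) ?sum_nat_const_nat ?subn0 ?mul1n // => i _; by case: (typ i).
Qed.

Let nguessE : nguess = m * 5 ^ #|guessed rootO typO|.
Proof.
rewrite /nguess /weight big_mkord (bigD1 rootO) //= /choices eqxx; congr muln.
rewrite -prod_nat_const /guessed big_mkcond [RHS]big_mkcond; apply: eq_bigr => i _ /=.
rewrite inE /typO -[i == rootO]/(i == root :> nat).
by case: eqP => //= _; case: (typ i).
Qed.

(** The counts come with exponent [m.-1], as the root only gives a factor [m]; raising the exponent
    to [n] is harmless because [4 <= 19]. *)
Let scale n x : m <= n -> x * 4 ^ m.-1 <= 2 * m * 19 ^ m.-1 -> x <= state_bound n.
Proof.
move=> mn; rewrite /state_bound leq_divRL ?expn_gt0 // => h.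
have e : 4 ^ (n - m).+1 <= 19 ^ (n - m).+1 by rewrite leq_exp2r.
have E c : c ^ n = c ^ m.-1 * c ^ (n - m).+1 by rewrite -expnD; congr expn; lia.
have := leq_mul h e; rewrite !E !mulnA => /leq_trans; apply.
by rewrite !leq_mul2r !leq_mul2l mn !orbT.
Qed.

Lemma nguess_bound n : m <= n -> nguess <= state_bound n.
Proof.
move=> mn; apply: scale => //; rewrite nguessE.
move: card_total balanced; rewrite -card_untyp -card_typ.
move: #|guessed rootO typO| #|[set w | typO w]| => b w <- bw; rewrite addn1 /=.
have [e ->] : exists e, w = b + e by exists (w - b); lia.
(* Per guessed vertex and an unguessed partner, [5 * 4 ^ 2 = 80 <= 361 = 19 ^ 2]; each of the [e]
   surplus unguessed vertices needs [4 <= 19]. *)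
rewrite -!mulnA; have h : 5 ^ b * 4 ^ (b + (b + e)) <= 19 ^ (b + (b + e)).
  have -> : 5 ^ b * 4 ^ (b + (b + e)) = 80 ^ b * 4 ^ e.
    by rewrite !expnD (_ : 80 = 5 * (4 * 4)) // !expnMn -!mulnA.
  have -> : 19 ^ (b + (b + e)) = 361 ^ b * 19 ^ e.
    by rewrite !expnD (_ : 361 = 19 * 19) // !expnMn -!mulnA.
  by rewrite leq_mul // leq_exp2r0.
by move: h; move: (4 ^ (b + (b + e))) (19 ^ (b + (b + e))) (5 ^ b) => x y z; nia.
Qed.

Lemma good_bound n : m <= n ->
  \sum_(0 <= g < nguess) count (good g) (iota 0 (weight (fun=> 4) m)) <= state_bound n.
Proof.
move=> mn; apply: scale => //; move: count_good.
move: card_total balanced; rewrite -card_untyp -card_typ.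
move: #|guessed rootO typO| #|[set w | typO w]| (\sum_(0 <= g < nguess) _) => b w x mE bw.
have [e wE] : exists e, w = b + e by exists (w - b); lia.
have m1 : m.-1 = b + (b + e) by lia.
rewrite {w bw mE}wE.
have c0 : 0 < 5 ^ b by rewrite expn_gt0.
move=> H; rewrite -(leq_pmul2l c0) mulnA m1.
(* This is [4 * 28 / 5 < (19 / 4) ^ 2] in integers: [4 * 28 * 4 ^ 2 = 1792 <= 1805 = 5 * 19 ^ 2].
   Each of the [e] surplus unguessed vertices needs [16 <= 19]. *)
have h : 4 ^ (b + e) * 28 ^ b * 4 ^ (b + (b + e)) <= 5 ^ b * 19 ^ (b + (b + e)).
  have -> : 4 ^ (b + e) * 28 ^ b * 4 ^ (b + (b + e)) = 1792 ^ b * 16 ^ e.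
    rewrite !expnD (_ : 1792 = 4 * 28 * (4 * 4)) // (_ : 16 = 4 * 4) // !expnMn.
    by move: (4 ^ b) (28 ^ b) (4 ^ e) => p q r; lia.
  have -> : 5 ^ b * 19 ^ (b + (b + e)) = 1805 ^ b * 19 ^ e.
    rewrite !expnD (_ : 1805 = 5 * 19 * 19) // !expnMn.
    by move: (5 ^ b) (19 ^ b) (19 ^ e) => p q r; lia.
  by rewrite leq_mul // leq_exp2r0.
have := leq_mul H (leqnn (4 ^ (b + (b + e)))); move=> /leq_trans; apply.
have := leq_mul (leqnn (2 * m)) h.
move: (4 ^ (b + e)) (28 ^ b) (4 ^ (b + (b + e))) (5 ^ b) (19 ^ (b + (b + e))) => p q r t u; lia.
Qed.

End Guess.

(** * The program *)

Declare Scope expr_scope.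
Delimit Scope expr_scope with X.
Bind Scope expr_scope with expr.
Notation "x + y" := (EBin OAdd x y) : expr_scope.
Notation "x - y" := (EBin OSub x y) : expr_scope.
Notation "x * y" := (EBin OMul x y) : expr_scope.
Notation "x %/ y" := (EBin ODiv x y) : expr_scope.
Notation "x %% y" := (EBin OMod x y) : expr_scope.
Notation "x == y" := (EBin OEq x y) : expr_scope.
Notation "x < y" := (EBin OLt x y) : expr_scope.
Notation "# k" := (ECst k) (at level 0, k at level 0) : expr_scope.
Notation "! x" := (EVar x) (at level 0, x at level 0) : expr_scope.
Notation "? i" := (EBnd i) (at level 0, i at level 0) : expr_scope.
Notation Esum := (EBig false).
Notation Eprod := (EBig true).

Declare Scope cmd_scope.
Delimit Scope cmd_scope with C.
Bind Scope cmd_scope with cmd.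
Notation "x ::= e" := (CAsg x e%X) (at level 60) : cmd_scope.
Notation "a @ i ::= e" := (CSet a i%X e%X) (at level 60, i at level 50) : cmd_scope.
Notation "c1 ;; c2" := (CSeq c1 c2) (at level 70, right associativity) : cmd_scope.
Notation "'when' e 'do' c" := (CIf e%X c%C CSkip) (at level 65, e at level 50, c at level 65) : cmd_scope.

Definition vN := 0. Definition vM := 1. Definition vM3 := 2. Definition vI := 3.
Definition vK := 4. Definition vY := 5. Definition vB := 6. Definition vB1 := 7.
Definition vRoot := 8. Definition vJ := 9.
Definition vOff := 12. Definition vFound := 13. Definition vGs := 14. Definition vG := 15.
Definition vStamp := 16. Definition vSp := 17. Definition vS := 18. Definition vGoal := 19.
Definition vT := 20. Definition vS2 := 21. Definition vD := 22. Definition vSeg := 23.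

(** [aOrd] lists the vertices of the current component in the order of discovery. [aPar], [aTyp] and
    [aF] are indexed by places in that list, [aVis] and [aOut] by vertices, [aMark] and [aPred] by
    states. *)
Definition aAdj := 1. Definition aVis := 2. Definition aOrd := 3. Definition aPar := 4.
Definition aTyp := 5. Definition aF := 6. Definition aMark := 7. Definition aPred := 8.
Definition aStk := 9. Definition aOut := 10.

Section Program.
Local Open Scope expr_scope.

Definition eDig S k := (S %/ Eprod k #4) %% #4.
Definition eSeg S k :=
  EArr aTyp k * (EArr aF (EArr aPar k) + eDig S k - #2) + (#1 - EArr aTyp k) * EArr aF k.
Definition eBefore y x :=
  (y %% !vB1 < x %% !vB1) + (y %% !vB1 == x %% !vB1) * (y < x).
Definition ePos d := Esum !vM ((Esum !vM (eBefore ?0 ?1) == d) * ?0).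
Definition ePlaced S := Esum !vM (#0 < eDig S ?0).
Definition eNew k :=
  EArr aTyp k * (!vSeg + #2 - EArr aF (EArr aPar k)) + (#1 - EArr aTyp k) * (EArr aF k == !vSeg).
Definition eAdj k l := EArr aAdj (EArr aOrd k * !vN + EArr aOrd l).
(** A universal statement is expressed by the vanishing of the sum of its violations, a conditional
    by a product with 0 or 1. *)
Definition eBack S k :=
  #0 == Esum !vM (eAdj k ?0 * (#0 < eDig S ?0) *
     (#1 - ((eSeg S ?0 == !vSeg) + (eSeg S ?0 == !vSeg + #1)))).
Definition eCompat au su al sl :=
  (su < sl + #2) * (sl < su + #2) * (#1 - (su == sl + #1) * al * (#1 - au)) *
  (#1 - (sl == su + #1) * au * (#1 - al)).
(** The outer sum counts the unguessed vertices for which the number of fitting segments is 0. *)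
Definition eValid S :=
  #0 == Esum !vM (EArr aTyp ?0 *
    (#0 == Esum !vM3 ((#1 - (#0 < eDig S ?1) * (#1 - (eSeg S ?1 == ?0))) *
      (#0 == Esum !vM (eAdj ?2 ?0 * (#1 - EArr aTyp ?0) *
         (#1 - eCompat (#0 < eDig S ?2) ?1 (#0 < eDig S ?0) (EArr aF ?0))))))).
Definition eChoices k :=
  (k == !vRoot) * !vM + (#1 - (k == !vRoot)) * (EArr aTyp k + (#1 - EArr aTyp k) * #5).

Local Open Scope cmd_scope.

(** The adjacency matrix is copied because well-formed expressions read only arrays of positive
    index; the ordering will later be written over the input. *)
Definition load_graph :=
  CGet vN #0 ;;
  CFor vI vN (CFor vY vN (
    CGet vT (#1 + !vI * !vN + !vY) ;;
    aAdj @ !vI * !vN + !vY ::= !vT)).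

(** Breadth-first search with [aOrd] as the queue and [vM] as its length. The loop bound has to stay
    fixed, so the loop runs up to [vN] and skips what lies beyond [vM]. *)
Definition grow :=
  aVis @ !vI ::= #1 ;; aOrd @ #0 ::= !vI ;; aTyp @ #0 ::= #0 ;; vM ::= #1 ;;
  CFor vK vN (when !vK < !vM do CFor vY vN (
    when EArr aAdj (EArr aOrd !vK * !vN + !vY) * (#1 - EArr aVis !vY) do (
      aVis @ !vY ::= #1 ;; aOrd @ !vM ::= !vY ;; aPar @ !vM ::= !vK ;;
      aTyp @ !vM ::= #1 - EArr aTyp !vK ;; vM ::= !vM + #1))).

(** If the guessed class is too large, the colours are swapped. The old root then becomes unguessed,
    so the tree is rerooted at its first child, vertex 1. That index is the smallest one left, which
    keeps grandparents smaller than their grandchildren. *)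
Definition recolour :=
  vRoot ::= #0 ;; aPar @ #0 ::= #0 ;;
  when #2 * Esum !vM (EArr aTyp ?0) + #1 < !vM do (
    vRoot ::= #1 ;; aPar @ #0 ::= #1 ;;
    CFor vK vM (aTyp @ !vK ::= #1 - EArr aTyp !vK)).

Definition decode :=
  aF @ !vRoot ::= #2 * !vM + (!vG %/ Eprod !vRoot (eChoices ?0)) %% !vM ;;
  CFor vK vM (when (#1 - EArr aTyp !vK) * (#1 - (!vK == !vRoot)) do (
    aF @ !vK ::= EArr aF (EArr aPar (EArr aPar !vK)) +
                 (!vG %/ Eprod !vK (eChoices ?0)) %% #5 - #2)).

(** Storing the vertex placed last is enough to retrace the path, since its digit in the state tells
    what to subtract. *)
Definition expand :=
  vT ::= eNew !vK ;; vS2 ::= !vS + !vT * Eprod !vK #4 ;;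
  when (eDig !vS !vK == #0) * (#0 < !vT) * (!vT < #4) * eBack !vS !vK * eValid !vS2 *
     (#1 - (EArr aMark !vS2 == !vStamp)) do (
    aMark @ !vS2 ::= !vStamp ;; aPred @ !vS2 ::= !vK ;;
    aStk @ !vSp ::= !vS2 ;; vSp ::= !vSp + #1).

Definition search_body :=
  vSp ::= !vSp - #1 ;; vS ::= EArr aStk !vSp ;; vD ::= ePlaced !vS ;;
  CIf (!vD == !vM)
    (vFound ::= #1 ;; vGoal ::= !vS)
    (vSeg ::= #2 * !vM + ePos !vD %/ !vB1 ;; CFor vK vM expand).

(** Raising the stamp invalidates all marks of earlier searches at constant cost. *)
Definition search :=
  vStamp ::= !vStamp + #1 ;; aMark @ #0 ::= !vStamp ;; aStk @ #0 ::= #0 ;; vSp ::= #1 ;;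
  CWhile !vSp search_body.

Definition guess_loop :=
  CWhile ((!vG < !vGs) * (!vFound == #0)) (decode ;; search ;; vG ::= !vG + #1).

(** [vB1] is the segment length, one more than the bandwidth, and lengths are tried in increasing
    order. After a success the remaining rounds do nothing. *)
Definition solve :=
  vM3 ::= #3 * !vM ;; vFound ::= #0 ;; vGs ::= Eprod !vM (eChoices ?0) ;;
  CFor vB vM (when !vFound == #0 do (vB1 ::= !vB + #1 ;; vG ::= #0 ;; guess_loop)).

(** The path is retraced from its end: round [vJ] removes the vertex that was placed with number
    [vM - 1 - vJ], and [ePos] translates this number into a position. *)
Definition output :=
  vS ::= !vGoal ;;
  CFor vJ vM (
    vK ::= EArr aPred !vS ;; vD ::= !vM - #1 - !vJ ;;
    aOut @ EArr aOrd !vK ::= !vOff + ePos !vD + #1 ;;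
    vS ::= !vS - eDig !vS !vK * Eprod !vK #4).

Definition component := grow ;; recolour ;; solve ;; output ;; vOff ::= !vOff + !vM.

Definition bandwidth_cmd :=
  load_graph ;;
  CFor vI vN (when EArr aVis !vI == #0 do component) ;;
  CFor vI vN (CPut !vI (EArr aOut !vI)).

End Program.

Definition nregs := 64.

(** The base address of the arrays is the length of the input, known only at run time. *)
Definition prologue : program :=
  [:: IConst (tmp 0) 0; ILoad (tmp 1) (tmp 0); IOp Mul (tmp 1) (tmp 1) (tmp 1);
      IConst (tmp 0) 1; IOp Add nvars (tmp 1) (tmp 0)].

Definition bandwidth_program : program := prologue ++ comp_c 5 bandwidth_cmd.

Lemma bandwidth_wf : wfc bandwidth_cmd. Proof. by vm_compute. Qed.

Lemma bandwidth_depth : (tmp (depth_c bandwidth_cmd) < nregs)%N. Proof. by vm_compute. Qed.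

Lemma bandwidth_operands : all (operands_ok nregs) bandwidth_program.
Proof. by vm_compute. Qed.

(** * Total correctness of the program *)

Definition size_bound n := 3 * n + 1.
(** A generous choice: the largest numbers are the stamps, which are bounded through [tick_bound] by
    roughly [2 ^ (7 * n)]. *)
Definition bit_bound n := 10 * n + 10.
Definition index_bound n := 4 ^ n.
Definition array_base n := n * n + 1.

Lemma small_lt_exp2 n x : x <= (n + 2) ^ 4 -> x < 2 ^ bit_bound n.
Proof.
move=> xn; apply: leq_ltn_trans xn _; apply: (@leq_ltn_trans (2 ^ (4 * n.+2))).
  by rewrite mulnC expnM leq_exp2r // addn2 ltnW // ltn_expl.
by rewrite ltn_exp2l // /bit_bound; lia.
Qed.

Lemma size_bound_lt n : size_bound n < 2 ^ bit_bound n.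
Proof. by apply: small_lt_exp2; rewrite /size_bound !expnS expn0; nia. Qed.

Lemma base_lt n : array_base n < 2 ^ bit_bound n.
Proof. by apply: small_lt_exp2; rewrite /array_base !expnS expn0; nia. Qed.

Lemma sqr_le_exp4 n : n * n <= 4 ^ n.
Proof.
rewrite (_ : 4 = 2 * 2) // expnMn leq_mul //; exact: ltnW (ltn_expl _ _).
Qed.

Lemma le_exp4 n : n <= 4 ^ n.
Proof. exact: ltnW (ltn_expl _ _). Qed.

(** * Loading the graph and growing a component *)

Section Program.
Variable n : nat.
Variable E : nat -> nat -> bool.

Notation WP := (WP (array_base n) (size_bound n) (bit_bound n) (index_bound n)).
Notation bounded := (bounded (size_bound n) (bit_bound n)).
Notation vbound := (vbound (size_bound n) (bit_bound n)).

Lemma vbound_small x v : v <= size_bound n -> vbound x v.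
Proof. by move=> vN; rewrite /vbound (leq_ltn_trans vN (size_bound_lt n)) vN implybT. Qed.

Lemma vbound_large x v : nsmall <= x -> v < 2 ^ bit_bound n -> vbound x v.
Proof. by move=> xn vL; rewrite /vbound vL ltnNge xn. Qed.

Definition graph_input s :=
  ar s 0 0 = n /\ forall i j, i < n -> j < n -> ar s 0 (1 + i * n + j) = E i j.

Definition graph_loaded s :=
  vr s vN = n /\ forall i j, i < n -> j < n -> ar s aAdj (i * n + j) = E i j.

Lemma pair_lt i j : i < n -> j < n -> i * n + j < n * n.
Proof.
move=> i_n jn; apply: (@leq_trans (i.+1 * n)); first by rewrite mulSn addnC ltn_add2r.
by rewrite leq_mul2r i_n orbT.
Qed.

Lemma pair_inj i j i' j' : j < n -> j' < n -> i * n + j = i' * n + j' -> i = i' /\ j = j'.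
Proof.
move=> jn jn' e; have jE : j = j'.
  by have := congr1 (modn^~ n) e; rewrite /= !modnMDl !modn_small.
split=> //; move: e; rewrite jE => /addIn /eqP; rewrite eqn_pmul2r; [by move/eqP|lia].
Qed.

Lemma load_graph_spec s : graph_input s -> WP load_graph graph_loaded s.
Proof.
case=> s0 sE; rewrite /load_graph.
apply: WP_seq; apply: WP_get => /=; [by rewrite /array_base; lia| |].
  by rewrite s0 => _; apply: vbound_small; rewrite /size_bound; lia.
set s1 := setv _ _ _; have n1 : vr s1 vN = n by [].
pose I i t := vr t vN = n /\ forall k j, k < i -> j < n -> ar t aAdj (k * n + j) = E k j.
apply: (WP_for (I := I)) => //.
  rewrite n1 => i t i_n F ti bt [tn tE].
  have r0 : ar t 0 = ar s 0 by rewrite (frm_a F).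
  pose J j u := [/\ vr u vN = n, vr u vI = i, ar u 0 = ar s 0,
     forall k j, k < i -> j < n -> ar u aAdj (k * n + j) = E k j &
     forall k, k < j -> ar u aAdj (i * n + k) = E i k].
  apply: (WP_for (I := J)) => //.
  + rewrite tn => j u jn F' uj bu [un ui u0 uE uE'].
    have ij := pair_lt i_n jn.
    apply: WP_seq; apply: WP_get => /=; rewrite ?ui ?un ?uj.
    * by rewrite /array_base -addnA add1n addn1 ltnS.
    * by move=> _; rewrite u0 sE //; apply: vbound_small; rewrite /size_bound; lia.
    apply: WP_set => /=; rewrite ?ui ?un ?uj.
    * by move=> _; rewrite (leq_trans (ltnW ij)) // sqr_le_exp4.
    * by move=> _; rewrite u0 sE //; apply: leq_ltn_trans (leq_b1 _) _; apply: small_lt_exp2;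
       rewrite !expnS expn0; nia.
    split=> //=.
    * move=> k j' ki jn'; case: eqP => [/(pair_inj jn' jn)[kE _]|_]; last exact: uE.
      by rewrite kE ltnn in ki.
    * move=> k; rewrite ltnS leq_eqVlt => /predU1P[->|kj].
        by rewrite eqxx u0 sE.
      by rewrite eqn_add2l (ltn_eqF kj); apply: uE'.
  + move=> t' F' bt' [tn' _ _ tE1 tE2]; split=> // k j; rewrite ltnS leq_eqVlt tn in tE2 *.
    by case/predU1P => [->|ki] jn; [apply: tE2|apply: tE1].
by rewrite n1 => t F bt.
Qed.

Hypothesis E_sym : forall u v, E u v = E v u.

Definition vertices s := mkseq (ar s aOrd) (vr s vM).

(** [D] is the set of vertices of the components treated before; [k] and [l] are places in the
    queue, not vertices. *)
Record grown (D : pred nat) v0 s : Prop := Grown {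
  gr_gt0 : 0 < vr s vM;
  gr_root : ar s aOrd 0 = v0;
  gr_new : forall k, k < vr s vM -> ar s aOrd k < n /\ ~~ D (ar s aOrd k);
  gr_inj : forall k l, k < vr s vM -> l < vr s vM -> ar s aOrd k = ar s aOrd l -> k = l;
  gr_vis : forall v, v < n -> ar s aVis v = D v || (v \in vertices s);
  gr_typ0 : ar s aTyp 0 = 0;
  gr_tree : forall k, 0 < k < vr s vM ->
    [/\ ar s aPar k < k, E (ar s aOrd (ar s aPar k)) (ar s aOrd k) &
        ar s aTyp k + ar s aTyp (ar s aPar k) = 1] }.

Lemma uniq_vertices s : (forall k l, k < vr s vM -> l < vr s vM ->
  ar s aOrd k = ar s aOrd l -> k = l) -> uniq (vertices s).
Proof.
move=> inj; rewrite map_inj_in_uniq ?iota_uniq // => k l.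
by rewrite !mem_iota => km lm; apply: inj.
Qed.

Lemma mem_vertices s k : k < vr s vM -> ar s aOrd k \in vertices s.
Proof. by move=> km; apply: map_f; rewrite mem_iota. Qed.

Lemma verticesP s v : reflect (exists2 k, k < vr s vM & ar s aOrd k = v) (v \in vertices s).
Proof.
apply: (iffP mapP) => [[k]|[k km <-]]; first by rewrite mem_iota => km ->; exists k.
by exists k; rewrite // mem_iota.
Qed.

Lemma grown_le D v0 s : grown D v0 s -> vr s vM <= n.
Proof.
move=> G; rewrite -[leqRHS](size_iota 0) -[leqLHS](size_mkseq (ar s aOrd)).
apply: uniq_leq_size; first exact: uniq_vertices (gr_inj G).
by move=> v /verticesP[k km <-]; rewrite mem_iota; case: (gr_new G km).
Qed.

Lemma grown_setv D v0 s x v : x != vM -> grown D v0 s -> grown D v0 (setv s x v).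
Proof.
rewrite eq_sym -[vM == x]/(eqn vM x) => /negPf xm [g0 g1 g2 g3 g4 g5 g6].
by split; rewrite /vertices /= ?xm.
Qed.

Lemma grown_add D v0 s s' y k : grown D v0 s -> y < n -> ~~ D y -> y \notin vertices s ->
  k < vr s vM -> E (ar s aOrd k) y ->
  vr s' vM = (vr s vM).+1 ->
  (forall v, ar s' aVis v = if v == y then 1 else ar s aVis v) ->
  (forall j, ar s' aOrd j = if j == vr s vM then y else ar s aOrd j) ->
  (forall j, ar s' aPar j = if j == vr s vM then k else ar s aPar j) ->
  (forall j, ar s' aTyp j = if j == vr s vM then 1 - ar s aTyp k else ar s aTyp j) ->
  grown D v0 s'.
Proof.
move=> G yn Dy yv km Eky m' v' o' p' t'.
have lt j : j < vr s vM -> (j == vr s vM) = false by move=> h; rewrite ltn_eqF.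
have V : vertices s' = rcons (vertices s) y.
  rewrite /vertices m' /mkseq -addn1 iotaD map_cat cats1 /= o' eqxx; congr rcons.
  by apply/eq_in_map => j; rewrite mem_iota o' => /lt ->.
have ordne j : j < vr s vM -> ar s aOrd j <> y.
  by move=> jm e; rewrite -e mem_vertices in yv.
split; rewrite ?m' //.
- by rewrite o' lt ?(gr_gt0 G) // (gr_root G).
- move=> j; rewrite ltnS leq_eqVlt o' => /predU1P[->|jm]; first by rewrite eqxx.
  by rewrite lt //; apply: gr_new G _ jm.
- move=> i j; rewrite !ltnS [i <= _]leq_eqVlt [j <= _]leq_eqVlt !o'.
  case/predU1P => [->|im]; case/predU1P => [->|jm] //; rewrite ?eqxx ?lt //.
  + by move=> e; case: (ordne j jm).
  + by move=> e; case: (ordne i im).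
  + exact: gr_inj G _ _ im jm.
- move=> v vn; rewrite V mem_rcons inE v' (gr_vis G vn).
  by case: eqP => [->|_] /=; rewrite ?orbT.
- by rewrite t' lt ?(gr_gt0 G) // (gr_typ0 G).
- move=> j /andP[j0]; rewrite ltnS leq_eqVlt !p' !o' => /predU1P[->|jm].
    rewrite eqxx lt // !t' eqxx lt //; split=> //.
    case: (posnP k) => [->|k0]; first by rewrite (gr_typ0 G).
    by have [|_ _] := gr_tree G (k := k); [rewrite k0|lia].
  have [|h1 h2 h3] := gr_tree G (k := j); first by rewrite j0.
  by rewrite lt // !t' !lt //; lia.
Qed.

Lemma grow_spec D s : graph_loaded s -> vr s vI < n -> ~~ D (vr s vI) ->
  (forall v, v < n -> ar s aVis v = D v) ->
  WP grow (fun s' => grown D (vr s vI) s' /\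
     forall k y, k < vr s' vM -> y < n -> E (ar s' aOrd k) y -> ar s' aVis y = 1) s.
Proof.
move=> [sn sE] vn Dv visD; rewrite /grow.
have Z1 : 1 < 2 ^ bit_bound n by apply: small_lt_exp2; rewrite !expnS expn0; nia.
have ZN k : k <= n -> k < 2 ^ bit_bound n.
  by move=> kn; apply: small_lt_exp2; rewrite !expnS expn0; nia.
have IN k : k <= n -> k <= index_bound n by move=> kn; apply: leq_trans (le_exp4 n).
apply: WP_seq; apply: WP_set => /=; [by move=> _; apply/IN/ltnW|by []|].
apply: WP_seq; apply: WP_set => /=; [by []|by move=> _; apply/ZN/ltnW|].
apply: WP_seq; apply: WP_set => /=; [by []|by move=> _; apply: ZN|].
apply: WP_seq; apply: WP_asg => /=; first by move=> _; apply: vbound_small; rewrite /size_bound; lia.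
set s1 := setv _ _ _.
(* All neighbours of the first [k] entries of the queue have been visited. *)
pose C k t := forall i y, i < k -> i < vr t vM -> y < n -> E (ar t aOrd i) y -> ar t aVis y = 1.
pose I k t := grown D (vr s vI) t /\ C k t.
have G1 : grown D (vr s vI) s1.
  split=> //=.
  - by case.
  - by case=> // -[].
  - by move=> v v_n; rewrite mem_seq1 visD //; case: eqP => [->|_]; rewrite ?orbT ?orbF.
  - by move=> [|k] //; rewrite ltnS andbC ltn0.
apply: (WP_for (I := I)) => //.
- by move=> i t v [G Ct]; split=> //; apply: grown_setv.
- have -> : vr s1 vN = n by [].
  move=> k t kn F tk bt [Gt Ct].
  have tn : vr t vN = n by rewrite (frm_v F).
  have tE : ar t aAdj = ar s aAdj by rewrite (frm_a F).
  apply: WP_if => /=; rewrite tk; last first.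
    by case: ltnP => // mk _; apply: WP_skip; split=> // i y ik im; apply: Ct; lia.
  case: ltnP => // km _.
  pose J j u := [/\ grown D (vr s vI) u, k < vr u vM, vr u vK = k, C k u &
     forall y, y < j -> E (ar u aOrd k) y -> ar u aVis y = 1].
  apply: (WP_for (I := J)) => //.
  - by move=> i u v [G *]; split=> //; apply: grown_setv.
  - rewrite tn => y u yn F' uy bu [Gu kmu uk Cu Cy].
    have un : vr u vN = n by rewrite (frm_v F').
    have uE : ar u aAdj = ar s aAdj by rewrite (frm_a F').
    have [okn _] := gr_new Gu kmu.
    have vle v : v < n -> ar u aVis v <= 1 by move=> h; rewrite (gr_vis Gu h) leq_b1.
    apply: WP_if => /=; rewrite uE uk uy un sE //; last first.
      move=> e0; apply: WP_skip; split=> // z; rewrite ltnS leq_eqVlt => /predU1P[->|]; last exact: Cy.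
      by move=> Ez; rewrite Ez in e0; have := vle y yn; lia.
    have := vle y yn; case Ey: (E _ _) => //; case vy: (ar u aVis y) => [|] // _ _.
    have mn := grown_le Gu.
    have [yD yv] : ~~ D y /\ y \notin vertices u.
      by move: vy; rewrite (gr_vis Gu yn); case: (D y); case: (y \in _).
    (* The new vertex and the entries of the queue are distinct numbers below [n]. *)
    have mlt : vr u vM < n.
      have : size (y :: vertices u) <= size (iota 0 n).
        apply: uniq_leq_size => /=; first by rewrite yv (uniq_vertices (gr_inj Gu)).
        move=> v; rewrite inE => /predU1P[->|/verticesP[j jm <-]]; first by rewrite mem_iota.
        by rewrite mem_iota; case: (gr_new Gu jm).
      by rewrite /= size_mkseq size_iota.
    apply: WP_seq; apply: WP_set => /=; rewrite ?uy; [by move=> _; apply/IN/ltnW|by []|].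
    apply: WP_seq; apply: WP_set => /=; rewrite ?uy; [by move=> _; apply: IN|by move=> _; apply/ZN/ltnW|].
    apply: WP_seq; apply: WP_set => /=; rewrite ?uk; [by move=> _; apply: IN|by move=> _; apply: ZN; lia|].
    apply: WP_seq; apply: WP_set => /=; rewrite ?uk; [by move=> _; apply: IN|by move=> _; apply: leq_ltn_trans Z1; rewrite leq_subr|].
    apply: WP_asg => /=; first by move=> _; apply: vbound_small; rewrite /size_bound; lia.
    set u' := setv _ _ _.
    have oE j : ar u' aOrd j = if j == vr u vM then y else ar u aOrd j by [].
    have vE v : ar u' aVis v = if v == y then 1 else ar u aVis v by [].
    have lt j : j < vr u vM -> (j == vr u vM) = false by move=> h; rewrite ltn_eqF.
    have mE : vr u' vM = (vr u vM).+1 by rewrite /= addn1.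
    split=> //.
    + by apply: (grown_add (s := u) (y := y) (k := k)).
    + by rewrite mE; lia.
    + move=> i z ik im zn; rewrite oE lt; last by lia.
      by rewrite vE; case: eqP => // _; apply: Cu => //; lia.
    + move=> z; rewrite ltnS oE lt // vE leq_eqVlt; case: eqP => //= _ zy; exact: Cy.
  - move=> u F' bu [Gu kmu uk Cu Cy]; split=> // i z; rewrite ltnS leq_eqVlt => /predU1P[->|ik].
      by move=> _ zn; apply: Cy; rewrite tn.
    exact: Cu.
- have -> : vr s1 vN = n by [].
  move=> t F bt [Gt Ct]; split=> // k y km yn; apply: Ct => //.
  exact: leq_trans km (grown_le Gt).
Qed.

End Program.

(** * Choosing the guessed colour class and the root *)

Section Program.
Variable n : nat.
Variable E : nat -> nat -> bool.
Hypothesis E_sym : forall u v, E u v = E v u.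

Notation WP := (WP (array_base n) (size_bound n) (bit_bound n) (index_bound n)).
Notation bounded := (bounded (size_bound n) (bit_bound n)).
Notation vbound := (vbound (size_bound n) (bit_bound n)).

Definition edge s k l := E (ar s aOrd k) (ar s aOrd l).
Definition colour s k := 0 < ar s aTyp k.

Record rooted s : Prop := Rooted {
  rt_tree : tree (vr s vM) (edge s) (colour s) (ar s aPar) (vr s vRoot);
  rt_typ : forall k, k < vr s vM -> ar s aTyp k = colour s k;
  rt_balanced : \sum_(0 <= k < vr s vM) ~~ colour s k <=
                (\sum_(0 <= k < vr s vM) colour s k).+1 }.

Lemma small_bits k : k <= n + 1 -> k < 2 ^ bit_bound n.
Proof. by move=> kn; apply: small_lt_exp2; rewrite !expnS expn0; nia. Qed.

Lemma small_index k : k <= n -> k <= index_bound n.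
Proof. by move=> kn; apply: leq_trans (le_exp4 n). Qed.

Lemma sum_negb m (P : pred nat) :
  \sum_(0 <= k < m) ~~ P k + \sum_(0 <= k < m) P k = m.
Proof.
rewrite -big_split /= (eq_bigr (fun=> 1)) ?sum_nat_const_nat ?subn0 ?muln1 // => i _.
by case: (P i).
Qed.

Lemma recolour_spec D v0 s : grown n E D v0 s -> WP recolour rooted s.
Proof.
move=> G; have mn := grown_le G; have m0 := gr_gt0 G; rewrite /recolour.
apply: WP_seq; apply: WP_asg => /=; first by move=> _; apply: vbound_small.
apply: WP_seq; apply: WP_set => //=.
  by move=> _; apply: small_bits.
set s1 := seta _ _ _ _.
have par1 k : ar s1 aPar k = if k == 0 then 0 else ar s aPar k by [].
have typ1 k : ar s1 aTyp k = ar s aTyp k by [].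
have ord1 k : ar s1 aOrd k = ar s aOrd k by [].
have tr k : 0 < k < vr s vM -> [/\ ar s aPar k < k,
     E (ar s aOrd (ar s aPar k)) (ar s aOrd k) & ar s aTyp k + ar s aTyp (ar s aPar k) = 1].
  exact: (gr_tree G).
have t0 := gr_typ0 G.
have tle k : k < vr s vM -> ar s aTyp k <= 1.
  by case: k => [|k] km; [rewrite t0|have [_ _] := tr k.+1 km; lia].
have sumE : \sum_(0 <= i < vr s vM) ar s aTyp i = \sum_(0 <= i < vr s vM) (0 < ar s aTyp i).
  by rewrite big_nat [RHS]big_nat; apply: eq_bigr => i /tle; case: (ar s aTyp i) => [|[|]].
have neg := sum_negb (vr s vM) (fun k => 0 < ar s aTyp k).
apply: WP_if => /=; case: ltnP => //; rewrite sumE => flip _; last first.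
  apply: WP_skip; split=> //=; last by rewrite /colour /=; lia.
    split=> //=; rewrite ?par1 ?/colour /=.
    - by rewrite t0.
    - by move=> k km; case: eqP => // k0; have [|h _ _] := tr k; lia.
    - move=> k km k0; rewrite (negPf k0); have [|_ _] := tr k; first by rewrite lt0n k0.
      by move=> e; have := tle k km; move: e; case: (ar s aTyp k) => [|[|?]]; lia.
    - move=> k km k0; rewrite (negPf k0) /edge /=; have [|_ e _] := tr k; first by rewrite lt0n k0.
      by rewrite E_sym.
    - move=> k km k0; rewrite (negPf k0) => p0; rewrite (negPf p0).
      have [|h _ _] := tr k; first by rewrite lt0n k0.
      have [|h' _ _] := tr (ar s aPar k); first by rewrite lt0n p0; lia.
      exact: ltn_trans h' h.
  by move=> k km; rewrite /colour /=; case: (ar s aTyp k) (tle k km) => [|[|]].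
have m2 : 1 < vr s vM.
  by case: (vr s vM) m0 flip => [|[|]] //; rewrite big_nat1 t0.
apply: WP_seq; apply: WP_asg => /=; first by move=> _; apply: vbound_small; rewrite /size_bound; lia.
apply: WP_seq; apply: WP_set => //=.
  by move=> _; apply: small_bits; lia.
set s2 := seta _ _ _ _.
pose I k t := forall j, ar t aTyp j = if j < k then 1 - ar s aTyp j else ar s aTyp j.
apply: (WP_for (I := I)) => //.
  have -> : vr s2 vM = vr s vM by [].
  move=> k t km F tk bt It; apply: WP_set => /=; rewrite tk.
  - by move=> _; apply: small_index; lia.
  - by move=> _; apply: leq_ltn_trans (leq_subr _ _) _; apply: small_bits; lia.
  move=> j /=; rewrite !It; case: eqP => [->|jk]; first by rewrite ltnn ltnSn.
  by rewrite ltnS [j <= k]leq_eqVlt; case: eqP.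
have -> : vr s2 vM = vr s vM by [].
move=> t F bt It.
have mE : vr t vM = vr s vM by rewrite (frm_v F).
have rE : vr t vRoot = 1 by rewrite (frm_v F).
have pE k : ar t aPar k = if k == 0 then 1 else ar s aPar k.
  by rewrite (frm_a F) //=; case: eqP.
have oE k : ar t aOrd k = ar s aOrd k by rewrite (frm_a F).
have tE k : k < vr s vM -> ar t aTyp k = 1 - ar s aTyp k by move=> km; rewrite It km.
have p1 : ar s aPar 1 = 0 by have [|h _ _] := tr 1; [rewrite m2|case: (ar s aPar 1) h].
have t1 : ar s aTyp 1 = 1 by have [|_ _] := tr 1; [rewrite m2|rewrite p1 t0 addn0].
have cE k : k < vr s vM -> colour t k = ~~ (0 < ar s aTyp k).
  by move=> km; rewrite /colour tE // subn_gt0; have := tle k km; lia.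
split; rewrite mE ?rE.
- split=> //.
  + by rewrite cE // t1.
  + by move=> k km; rewrite pE; case: eqP => // /eqP k0; have [|h _ _] := tr k; lia.
  + move=> k km k1; rewrite pE; case: eqP => [->|/eqP k0]; first by rewrite !cE // t1 t0.
    have [|h _ e] := tr k; first by rewrite lt0n k0.
    by rewrite !cE //; [lia|apply: ltn_trans h km].
  + move=> k km k1; rewrite /edge pE !oE E_sym; case: eqP => [->|/eqP k0].
      by have [|_ e _] := tr 1; [rewrite m2|rewrite p1 in e; rewrite E_sym e].
    by have [|_ e _] := tr k; [rewrite lt0n k0|].
  (* For a vertex below the old root 0 the grandparent is now 1, the new root; the vertex itself is
     neither 0 nor 1. *)
  + move=> k km k1; rewrite !pE; have [//|k0] := eqVneq k 0; move=> p1'.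
    have [|h _ _] := tr k; first by rewrite lt0n k0.
    case: eqP => [_|/eqP p0]; first by lia.
    have [|h' _ _] := tr (ar s aPar k); first by rewrite lt0n p0; lia.
    exact: ltn_trans h' h.
- by move=> k km; rewrite cE // tE //; case: (ar s aTyp k) (tle k km) => [|[|]].
- rewrite (eq_big_nat _ _ (F2 := fun k => nat_of_bool (0 < ar s aTyp k))); last first.
    by move=> k km; rewrite cE // negbK.
  rewrite [X in _ <= X.+1](eq_big_nat _ _ (F2 := fun k => nat_of_bool (~~ (0 < ar s aTyp k)))).
    by lia.
  by move=> k km; rewrite cE.
Qed.

End Program.

Lemma eqn0_sum m (F : nat -> nat) :
  (0 == \sum_(0 <= i < m) F i) = all (fun i => F i == 0) (iota 0 m).
Proof.
by rewrite eq_sym sum_nat_seq_eq0 /index_iota subn0; apply: eq_all => i.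
Qed.

Lemma muln_bool (a b : bool) : a * b = a && b :> nat.
Proof. by case: a; rewrite ?mul1n ?mul0n. Qed.

Lemma negb_bool (a : bool) : 1 - a = ~~ a :> nat.
Proof. by case: a. Qed.

(** * Values of the expressions of the program *)

Section Program.
Variable n : nat.
Variable E : nat -> nat -> bool.
Hypothesis E_sym : forall u v, E u v = E v u.

Record ready s : Prop := Ready {
  rd_graph : graph_loaded n E s;
  rd_ord : forall k, k < vr s vM -> ar s aOrd k < n;
  rd_rooted : rooted E s;
  rd_3m : vr s vM3 = 3 * vr s vM }.

Definition step_in s := step (vr s vM) (vr s vB1) (edge E s) (colour s) (ar s aPar) (ar s aF).
Definition place_in s := place (vr s vM) (vr s vB1) (colour s) (ar s aPar) (ar s aF).

Section Eval.
Variables (s : state) (rho : seq nat).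
Hypothesis R : ready s.
Local Notation m := (vr s vM).
Local Notation b1 := (vr s vB1).

Lemma eval_adj a b : eval s rho a < m -> eval s rho b < m ->
  eval s rho (eAdj a b) = edge E s (eval s rho a) (eval s rho b).
Proof. by case: R => -[sn sE] so _ _ am bm /=; rewrite sn sE // so. Qed.

Lemma eval_pos d : eval s rho (ePos (EVar d)) = posn m b1 (vr s d).
Proof.
rewrite /posn /=; apply: eq_bigr => x _; congr (nat_of_bool (_ == _) * _).
apply: eq_bigr => y _; rewrite /before.
by case: (ltngtP (y %% b1) (x %% b1)) => _ /=; rewrite ?mul0n ?mul1n ?addn0 ?add0n.
Qed.

Lemma eval_seg S k : eval s rho k < m ->
  eval s rho (eSeg (EVar S) k) = segd (colour s) (ar s aPar) (ar s aF) (vr s S) (eval s rho k).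
Proof.
move=> km; rewrite /segd /= (rt_typ (rd_rooted R) km).
by case: (colour s _); rewrite ?mul0n ?mul1n ?addn0 ?add0n.
Qed.

Lemma eval_new k : eval s rho k < m -> vr s vSeg = segn m b1 (placed m (vr s vS)) ->
  eval s rho (eNew k) =
  newdig m b1 (colour s) (ar s aPar) (ar s aF) (vr s vS) (eval s rho k).
Proof.
move=> km sg; rewrite /newdig /= (rt_typ (rd_rooted R) km) -sg.
by case: (colour s _); rewrite ?mul0n ?mul1n ?addn0 ?add0n.
Qed.

End Eval.

Lemma eval_back s k : ready s -> vr s k < vr s vM ->
  vr s vSeg = segn (vr s vM) (vr s vB1) (placed (vr s vM) (vr s vS)) ->
  eval s [::] (eBack (EVar vS) (EVar k)) =
  back (vr s vM) (vr s vB1) (edge E s) (colour s) (ar s aPar) (ar s aF) (vr s vS) (vr s k).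
Proof.
move=> R km sg.
rewrite -[LHS]/(nat_of_bool (0 == \sum_(0 <= l < vr s vM)
   (eval s [:: l] (eAdj (EVar k) (EBnd 0)) * (0 < dig (vr s vS) l) *
    (1 - ((eval s [:: l] (eSeg (EVar vS) (EBnd 0)) == vr s vSeg) +
          (eval s [:: l] (eSeg (EVar vS) (EBnd 0)) == vr s vSeg + 1)))))).
rewrite eqn0_sum /back; congr nat_of_bool; apply: eq_in_all => l; rewrite mem_iota => lm'; have {lm'}lm : l < vr s vM by [].
rewrite eval_adj // eval_seg //= sg addn1.
case: (edge E s _ _) => //; case: (0 < dig _ _) => //=.
by rewrite !mul1n; case: (segd _ _ _ _ _ == segn _ _ _); case: (segd _ _ _ _ _ == _.+1).
Qed.

Lemma eval_compat s rho au su al sl (a b : bool) :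
  eval s rho au = a -> eval s rho al = b ->
  eval s rho (eCompat au su al sl) = compat a (eval s rho su) b (eval s rho sl).
Proof.
move=> ae be; rewrite /= ae be /compat !addn2 !addn1 !ltnS.
rewrite !(muln_bool, negb_bool); congr nat_of_bool.
move: (eval s rho su) (eval s rho sl) => x y.
case: (x <= y.+1); case: (y <= x.+1); case: (x == y.+1); case: (y == x.+1);
  by case: a {ae} => //; case: b {be}.
Qed.

Lemma eval_valid s S : ready s ->
  eval s [::] (eValid (EVar S)) =
  valid (vr s vM) (edge E s) (colour s) (ar s aPar) (ar s aF) (vr s S).
Proof.
move=> R; have tE k := rt_typ (rd_rooted R) (k := k).
pose d := dig (vr s S).
pose bad w g l := eval s [:: l; g; w] (eAdj (EBnd 2) (EBnd 0)) * (1 - ar s aTyp l) *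
   (1 - eval s [:: l; g; w] (eCompat (EBin OLt (ECst 0) (eDig (EVar S) (EBnd 2))) (EBnd 1)
                     (EBin OLt (ECst 0) (eDig (EVar S) (EBnd 0))) (EArr aF (EBnd 0)))).
rewrite -[LHS]/(nat_of_bool (0 == \sum_(0 <= w < vr s vM) (ar s aTyp w *
   (0 == \sum_(0 <= g < vr s vM3) ((1 - (0 < d w) * (1 -
      (eval s [:: g; w] (eSeg (EVar S) (EBnd 1)) == g))) *
      (0 == \sum_(0 <= l < vr s vM) bad w g l)))))).
rewrite eqn0_sum /valid; congr nat_of_bool; apply: eq_in_all => w; rewrite mem_iota => wm'; have {wm'}wm : w < vr s vM by [].
rewrite tE //; case: (colour s w) => //; rewrite mul1n implyTb eqn0_sum (rd_3m R).
rewrite eqb0 -has_predC; apply: eq_in_has => g _; rewrite -[LHS]/(~~ (_ * _ == 0)).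
rewrite eval_seg // eqn0_sum -/d muln_eq0 negb_or negb_bool muln_bool negb_bool.
rewrite !eqb0 !negbK; congr andb; first by case: (0 < d w); case: (_ == g).
apply: eq_in_all => l; rewrite mem_iota => lm'; have {lm'}lm : l < vr s vM by [].
rewrite /bad eval_adj // (@eval_compat _ _ _ _ _ _ (0 < d w) (0 < d l)) //= tE // !negb_bool !muln_bool.
by rewrite eqb0 negb_and negbK implybE.
Qed.

End Program.

(** * Stack search with stamps, for an abstract transition relation *)

Section Worklist.
Variables (m W sigma time0 : nat) (st : nat -> nat -> bool) (nx : nat -> nat -> nat).
Variables (full ok : pred nat).
Hypothesis W_gt0 : 0 < W.
Hypothesis nx_lt : forall S k, S < W -> k < m -> st S k -> nx S k < W.
Hypothesis nx_ok : forall S k, S < W -> k < m -> st S k -> (S == 0) || ok S -> ok (nx S k).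
Hypothesis full_stuck : forall S k, k < m -> full S -> ~~ st S k.

Definition upd (f : nat -> nat) i v := fun j => if j == i then v else f j.
Definition marked (mark : nat -> nat) S := (S < W) && (mark S == sigma).
Definition closed mark (found : nat) S :=
  (full S -> found = 1) /\ forall k, k < m -> st S k -> marked mark (nx S k).

(* While a state [cur] is being expanded ([active]), its successors by vertices
   below [ck] have been marked. *)
Record worklist (active : bool) cur ck mark stk pred sp found goal time : Prop := Worklist {
  wl_mark : forall S, mark S <= sigma;
  wl_zero : marked mark 0;
  wl_stk : forall j, j < sp -> marked mark (stk j);
  wl_cur : active -> marked mark cur;
  wl_ok : forall S, marked mark S -> (S == 0) || ok S;
  wl_pred : forall S, marked mark S -> S = 0 \/
     exists2 S', marked mark S' & [/\ pred S < m, st S' (pred S) & S = nx S' (pred S)];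
  wl_closed : forall S, marked mark S ->
     [\/ exists2 j, j < sp & stk j = S,
         [/\ active, S = cur & forall k, k < ck -> st S k -> marked mark (nx S k)]
       | closed mark found S];
  wl_goal : found = 1 -> marked mark goal /\ full goal;
  wl_found : found <= 1;
  wl_time : time + sp + active <= time0 + count (marked mark) (iota 0 W) }.

(** The additional one is the state 0, where the search starts and which need not satisfy [ok]. *)
Lemma marked_le mark stk pred sp found goal time active cur ck :
  worklist active cur ck mark stk pred sp found goal time ->
  count (marked mark) (iota 0 W) <= (count ok (iota 0 W)).+1.
Proof.
move=> [_ _ _ _ w _ _ _ _ _].
apply: (@leq_trans (count (predU (pred1 0) ok) (iota 0 W))).
  by apply: sub_count => S /w /=.
apply: leq_trans (leq_trans (leq_addr _ _) (eq_leq (count_predUI _ _ _))) _.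
by rewrite -add1n leq_add2r (count_uniq_mem 0 (iota_uniq 0 W)) leq_b1.
Qed.

Lemma worklist_init mark stk pred goal :
  (forall S, mark S < sigma) ->
  worklist false 0 0 (upd mark 0 sigma) (upd stk 0 0) pred 1 0 goal time0.
Proof.
move=> mk; have M S : marked (upd mark 0 sigma) S -> S = 0.
  rewrite /marked /upd; case: (S =P 0) => // _ /andP[_ /eqP e].
  by have := mk S; rewrite e ltnn.
have M0 : marked (upd mark 0 sigma) 0 by rewrite /marked /upd W_gt0 !eqxx.
split=> //.
- by move=> S; rewrite /upd; case: eqP => // _; apply: ltnW.
- by case=> // _; rewrite /upd eqxx.
- by move=> S /M ->.
- by move=> S /M ->; left.
- by move=> S /M ->; apply: Or31; exists 0.
- rewrite addn0 leq_add2l -has_count; apply/hasP; exists 0 => //.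
  by rewrite mem_iota.
Qed.

Lemma worklist_pop mark stk pred sp found goal time cur ck :
  worklist false cur ck mark stk pred sp.+1 found goal time ->
  worklist true (stk sp) 0 mark stk pred sp found goal time.
Proof.
case=> w1 w2 w3 w4 w5 w6 w7 w8 w9 w10; split=> //.
- by move=> j js; apply: w3; apply: ltnW.
- by move=> _; apply: w3.
- move=> S /[dup] mS /w7[[j]|[]//|c]; last by apply: Or33.
  rewrite ltnS leq_eqVlt => /predU1P[-> <-|js <-]; first by apply: Or32.
  by apply: Or31; exists j.
- by rewrite addn1 -addnS addn0 in w10 *.
Qed.

Lemma worklist_full mark stk pred sp found goal time cur ck :
  worklist true cur ck mark stk pred sp found goal time -> full cur ->
  worklist false 0 0 mark stk pred sp 1 cur time.+1.
Proof.
case=> w1 w2 w3 w4 w5 w6 w7 w8 w9 w10 fc; split=> //.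
- move=> S /[dup] mS /w7[[j js <-]|[_ -> _]|[c1 c2]].
  + by apply: Or31; exists j.
  + by apply: Or33; split=> // k km s; have := full_stuck km fc; rewrite s.
  + by apply: Or33.
- by split=> //; apply: w4.
- by rewrite addn0 addSn; move: w10; rewrite addn1.
Qed.

Lemma worklist_done mark stk pred sp found goal time cur :
  worklist true cur m mark stk pred sp found goal time -> ~~ full cur ->
  worklist false 0 0 mark stk pred sp found goal time.+1.
Proof.
case=> w1 w2 w3 w4 w5 w6 w7 w8 w9 w10 fc; split=> //.
- move=> S /[dup] mS /w7[[j js <-]|[_ -> c]|c].
  + by apply: Or31; exists j.
  + by apply: Or33; split=> // f; rewrite f in fc.
  + by apply: Or33.
- by rewrite addn0 addSn; move: w10; rewrite addn1.
Qed.

Lemma worklist_skip mark stk pred sp found goal time cur ck :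
  worklist true cur ck mark stk pred sp found goal time ->
  (st cur ck -> marked mark (nx cur ck)) ->
  worklist true cur ck.+1 mark stk pred sp found goal time.
Proof.
case=> w1 w2 w3 w4 w5 w6 w7 w8 w9 w10 h; split=> //.
move=> S /[dup] mS /w7[[j js <-]|[_ -> c]|c]; [by apply: Or31; exists j| |by apply: Or33].
apply: Or32; split=> // k; rewrite ltnS leq_eqVlt => /predU1P[-> //|]; exact: c.
Qed.

(** The stack height and the number of marked states both grow by one, so the budget [wl_time] is
    preserved: each marked state is on the stack, is being expanded, or has already been paid for by
    a tick. *)
Lemma worklist_push mark stk pred sp found goal time cur ck :
  worklist true cur ck mark stk pred sp found goal time -> ck < m ->
  st cur ck -> mark (nx cur ck) != sigma ->
  worklist true cur ck.+1 (upd mark (nx cur ck) sigma) (upd stk sp (nx cur ck))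
    (upd pred (nx cur ck) ck) sp.+1 found goal time.
Proof.
case=> w1 w2 w3 w4 w5 w6 w7 w8 w9 w10 cm s mk.
have mc := w4 isT; have cW : cur < W by case/andP: mc.
set T := nx cur ck in mk *; have TW : T < W by apply: nx_lt.
have mT : marked (upd mark T sigma) T by rewrite /marked /upd TW !eqxx.
have mS S : marked mark S -> marked (upd mark T sigma) S.
  by rewrite /marked /upd; case: (S =P T) => // -> /andP[-> _]; rewrite eqxx.
have mI S : marked (upd mark T sigma) S -> S = T \/ S <> T /\ marked mark S.
  by rewrite /marked /upd; case: (S =P T) => [|h]; [left|right].
split=> //.
- by move=> S; rewrite /upd; case: eqP.
- exact: mS.
- move=> j; rewrite ltnS leq_eqVlt {2}/upd; case: eqP => //= _ js.
  by apply/mS/w3.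
- by move=> _; apply: mS.
- move=> S /mI[->|[_ /w5 //]]; rewrite nx_ok ?orbT //; exact: w5.
- move=> S /mI[->|[ST /w6[->|[S' mS' [p1 p2 p3]]]]].
  + by right; exists cur; [apply: mS|rewrite /upd eqxx].
  + by left.
  + right; exists S'; first exact: mS.
    by rewrite /upd; case: eqP.
- move=> S /mI[->|[ST /w7[[j js <-]|[_ -> c]|[c1 c2]]]].
  + by apply: Or31; exists sp; rewrite // /upd eqxx.
  + by apply: Or31; exists j; [apply: ltnW|rewrite /upd ltn_eqF].
  + apply: Or32; split=> // k; rewrite ltnS leq_eqVlt => /predU1P[-> //|kc sk].
    by apply/mS/c.
  + by apply: Or33; split=> // k km sk; apply/mS/c2.
- by move=> /w8[h1 h2]; split=> //; apply: mS.
- have -> : count (marked (upd mark T sigma)) (iota 0 W) =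
            (count (marked mark) (iota 0 W)).+1.
    rewrite (eq_in_count (a2 := predU (pred1 T) (marked mark))); last first.
      move=> S; rewrite mem_iota => /= SW; rewrite /marked /upd.
      by case: (S =P T) => [->|//]; rewrite TW eqxx.
    have := count_predUI (pred1 T) (marked mark) (iota 0 W).
    rewrite (count_uniq_mem T (iota_uniq 0 W)) mem_iota /= TW add1n.
    rewrite (_ : count (predI _ _) _ = 0) ?addn0 //.
    apply/eqP; rewrite -leqn0 leqNgt -has_count; apply/hasPn => S _ /=.
    by rewrite /marked; case: (S =P T) => // ->; rewrite (negPf mk) andbF.
  by rewrite addnS addSn addnS ltnS.
Qed.

(** Paths in which each state was entered by the vertex that [pred] holds for it. These are the
    paths that can be retraced from their end; later marks of other states do not disturb them. *)
Inductive chain (pred : nat -> nat) : nat -> seq nat -> Prop :=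
| chain0 : chain pred 0 [::]
| chainS S ks k : chain pred S ks -> k < m -> st S k -> pred (nx S k) = k ->
    chain pred (nx S k) (rcons ks k).

Lemma chain_rcons pred S ks : chain pred S ks -> 0 < size ks ->
  exists S' ks' k, [/\ chain pred S' ks', k < m, st S' k, pred S = k &
                       S = nx S' k /\ ks = rcons ks' k].
Proof. by case=> {S ks} [|S ks k c km s p _] //; exists S, ks, k. Qed.

Variable size_of : nat -> nat.
Hypothesis nx_size : forall S k, k < m -> st S k -> size_of (nx S k) = (size_of S).+1.

(** Each step back along [pred] lowers [size_of], so it ends at the state 0. *)
Lemma worklist_chain active cur ck mark stk pred sp found goal time S :
  worklist active cur ck mark stk pred sp found goal time ->
  marked mark S -> exists ks, chain pred S ks.
Proof.
case=> _ _ _ _ _ w _ _ _ _; have [d] := ubnP (size_of S).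
elim: d S => // d IH S Sd mS; case: (w S mS) => [->|[S' mS' [p1 p2 p3]]].
  by exists [::]; apply: chain0.
have [|ks c] := IH S' _ mS'; first by rewrite p3 nx_size in Sd.
by exists (rcons ks (pred S)); rewrite {1}p3; apply: chainS => //; rewrite -p3.
Qed.

End Worklist.

(** * Decoding a guess *)

Section Program.
Variable n : nat.
Variable E : nat -> nat -> bool.
Hypothesis E_sym : forall u v, E u v = E v u.

Notation WP := (WP (array_base n) (size_bound n) (bit_bound n) (index_bound n)).
Notation bounded := (bounded (size_bound n) (bit_bound n)).
Notation vbound := (vbound (size_bound n) (bit_bound n)).
Notation ready := (ready n E).

Lemma ready_transfer s t : ready s ->
  [/\ vr t vN = vr s vN, vr t vM = vr s vM, vr t vM3 = vr s vM3 & vr t vRoot = vr s vRoot] ->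
  [/\ ar t aAdj = ar s aAdj, ar t aOrd = ar s aOrd, ar t aPar = ar s aPar &
      ar t aTyp = ar s aTyp] -> ready t.
Proof.
case=> [[h1 h2] h3 [h4 h5 h6] h7] [nE mE m3E rE] [adE oE pE tE].
split; rewrite ?mE ?m3E ?oE //; first by split; rewrite ?nE ?adE.
by split; rewrite /edge /colour ?mE ?rE ?oE ?pE ?tE.
Qed.

Lemma eval_weight s rho k : ready s -> eval s rho k <= vr s vM ->
  eval s rho (Eprod k (eChoices (EBnd 0))) =
  weight (choices (vr s vM) (colour s) (vr s vRoot)) (eval s rho k).
Proof.
move=> R km; rewrite /weight; apply: eq_big_nat => i /andP[_ ik].
have im : i < vr s vM by apply: leq_trans km.
rewrite /= /choices (rt_typ (rd_rooted R) im).
by case: eqP => _; case: (colour s i); rewrite /= ?mul0n ?mul1n ?addn0 ?add0n.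
Qed.

Definition guess_in s := guess (vr s vM) (colour s) (ar s aPar) (vr s vRoot) (vr s vG).

Lemma decode_spec s : ready s -> vr s vM <= n ->
  WP decode (fun t => forall k, k < vr s vM -> ~~ colour s k -> ar t aF k = guess_in s k) s.
Proof.
move=> R mn; rewrite /decode; have T := rt_tree (rd_rooted R).
have rm := tree_root T.
have gle k : guess_in s k < 2 ^ bit_bound n.
  apply: leq_ltn_trans (guess_le T _ _ _) _; apply: small_lt_exp2.
  by rewrite !expnS expn0; nia.
have val0 : eval s [::] (ECst 2 * EVar vM +
     (EVar vG %/ Eprod (EVar vRoot) (eChoices (EBnd 0))) %% EVar vM)%X = guess_in s (vr s vRoot).
  rewrite -[eval _ _ _]/(2 * vr s vM +
    (vr s vG %/ eval s [::] (Eprod (EVar vRoot) (eChoices (EBnd 0)))) %% vr s vM).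
  rewrite eval_weight //; last exact: ltnW.
  by rewrite /guess_in guess_root /digit {3}/choices eqxx.
apply: WP_seq; apply: WP_set; rewrite ?val0.
- by move=> _; apply: small_index; apply: leq_trans (ltnW rm) mn.
- by move=> _; apply: gle.
set s1 := seta _ _ _ _.
pose I k t := forall j, j < vr s vM -> ~~ colour s j -> (j < k) || (j == vr s vRoot) ->
   ar t aF j = guess_in s j.
have R1 : ready s1 by apply: ready_transfer R _ _.
apply: (WP_for (I := I)) => //.
- by move=> j jm cj /= /eqP ->; rewrite eqxx.
- have -> : vr s1 vM = vr s vM by [].
  move=> k t km F tk bt It.
  have Rt : ready t by apply: ready_transfer R1 _ _; split; rewrite ?(frm_v F) ?(frm_a F).
  have [tm tr tG] : [/\ vr t vM = vr s vM, vr t vRoot = vr s vRoot & vr t vG = vr s vG].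
    by split; rewrite (frm_v F).
  have [tP tT] : ar t aPar = ar s aPar /\ ar t aTyp = ar s aTyp by split; rewrite (frm_a F).
  have ck : ar s aTyp k = colour s k by apply: (rt_typ (rd_rooted R)).
  apply: WP_if.
    rewrite -[eval _ _ _]/((1 - ar t aTyp (vr t vK)) * (1 - (vr t vK == vr t vRoot))).
    rewrite tk tr tT ck !negb_bool muln_bool; case: (boolP (_ && _)) => // /andP[nk kr] _.
    have [_ [tpp lt]] := grandparent_lt T km nk kr.
    have val : eval t [::] (EArr aF (EArr aPar (EArr aPar (EVar vK))) +
                 (EVar vG %/ Eprod (EVar vK) (eChoices (EBnd 0))) %% ECst 5 - ECst 2)%X
             = guess_in s k.
      rewrite -[eval _ _ _]/(ar t aF (ar t aPar (ar t aPar (vr t vK))) +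
       (vr t vG %/ eval t [::] (Eprod (EVar vK) (eChoices (EBnd 0)))) %% 5 - 2).
      rewrite eval_weight //; last by rewrite -[eval _ _ _]/(vr t vK) tk tm ltnW.
      rewrite -[eval t [::] (EVar vK)]/(vr t vK) tk tP It //; last first.
      + by rewrite lt.
      + exact: ltn_trans km.
      rewrite /guess_in (guess_step T _ km nk kr); congr (_ + _ - 2).
      by rewrite /digit {3}/choices (negPf kr) (negPf nk) /colour tT tr tm tG.
    apply: WP_set; rewrite ?val -?[eval t [::] (EVar vK)]/(vr t vK) ?tk.
    - by move=> _; apply: small_index; lia.
    - by move=> _; apply: gle.
    move=> j jm cj; rewrite /= ltnS leq_eqVlt; case: eqP => [-> _|_] //=.
    exact: It.
  rewrite -[eval _ _ _]/((1 - ar t aTyp (vr t vK)) * (1 - (vr t vK == vr t vRoot))).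
  rewrite tk tr tT ck !negb_bool muln_bool => /eqP; rewrite eqb0 negb_and !negbK => h.
  apply: WP_skip => j jm cj; rewrite ltnS leq_eqVlt => /orP[/orP[/eqP jk|jk]|jr].
  + by apply: It => //; move: h; rewrite -jk (negPf cj) /= => ->; rewrite orbT.
  + by apply: It; rewrite // jk.
  + by apply: It; rewrite // jr orbT.
- by move=> t F bt It k km ck; apply: It => //; rewrite km.
Qed.

End Program.

(** * The search for the guess in memory *)

Section Program.
Variable n : nat.
Variable E : nat -> nat -> bool.
Hypothesis E_sym : forall u v, E u v = E v u.

Notation WP := (WP (array_base n) (size_bound n) (bit_bound n) (index_bound n)).
Notation bounded := (bounded (size_bound n) (bit_bound n)).
Notation vbound := (vbound (size_bound n) (bit_bound n)).
Notation ready := (ready n E).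

Definition nstates s := weight (fun=> 4) (vr s vM).

Lemma nstates_exp s : nstates s = 4 ^ vr s vM.
Proof. by rewrite /nstates /weight prod_nat_const_nat subn0. Qed.

Definition good_in s S :=
  valid (vr s vM) (edge E s) (colour s) (ar s aPar) (ar s aF) S &&
  all (fun k => ~~ colour s k ==> (dig S k <= 1)) (iota 0 (vr s vM)).

Definition complete_state s S := placed (vr s vM) S == vr s vM.

Definition same s t :=
  [/\ [/\ vr t vN = vr s vN, vr t vM = vr s vM, vr t vM3 = vr s vM3 & vr t vRoot = vr s vRoot],
      [/\ ar t aAdj = ar s aAdj, ar t aOrd = ar s aOrd, ar t aPar = ar s aPar &
          ar t aTyp = ar s aTyp],
      vr t vB1 = vr s vB1 & ar t aF = ar s aF].

Lemma same_ready s t : same s t -> ready s -> ready t.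
Proof. by case=> h1 h2 _ _ R; apply: ready_transfer R h1 h2. Qed.

Lemma same_step s t : same s t ->
  step_in E t = step_in E s /\ place_in t = place_in s.
Proof.
case=> -[_ mE _ _] [_ oE pE tE] bE fE.
by rewrite /step_in /place_in /edge /colour mE oE pE tE bE fE.
Qed.

Lemma bits_prod a b : a <= 3 * n + 3 -> b <= 4 ^ n -> a * b < 2 ^ bit_bound n.
Proof.
move=> an bn; apply: (@leq_ltn_trans (2 ^ (n + 2) * 2 ^ (2 * n))).
  rewrite leq_mul //; last by rewrite expnM.
  have := ltn_expl n (isT : 1 < 2); rewrite expnD; lia.
by rewrite -expnD ltn_exp2l // /bit_bound; lia.
Qed.

Lemma index_lt : index_bound n + 1 < 2 ^ bit_bound n.
Proof.
have := @bits_prod 2 (4 ^ n); rewrite /index_bound.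
have : 0 < 4 ^ n by rewrite expn_gt0.
move=> h0 h; have := h _ (leqnn _); lia.
Qed.

Section Search.
Variables (s : state) (sigma time0 : nat).
Hypothesis R : ready s.
Hypothesis mn : vr s vM <= n.
Hypothesis b1_gt0 : 0 < vr s vB1.
Let m := vr s vM.
Let T := rt_tree (rd_rooted R).

Lemma colour_par k : k < m -> colour s k -> ~~ colour s (ar s aPar k).
Proof.
move=> km ck; rewrite (tree_typ T) ?ck //.
by apply: contraTneq ck => ->; apply: tree_typ_root T.
Qed.

Definition inv active cur ck t :=
  worklist m (nstates s) sigma time0 (step_in E s) (place_in s) (complete_state s) (good_in s)
    active cur ck (ar t aMark) (ar t aStk) (ar t aPred) (vr t vSp) (vr t vFound) (vr t vGoal) (tk t).

Lemma nstates_gt0 : 0 < nstates s.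
Proof. by rewrite nstates_exp expn_gt0. Qed.

Lemma nstates_index : nstates s <= index_bound n.
Proof. by rewrite nstates_exp leq_exp2l. Qed.

Lemma place_lt S k : S < nstates s -> k < m -> step_in E s S k -> place_in s S k < nstates s.
Proof. exact: ltn_place. Qed.

(** [step] tests [valid] on the new state, and the digit of a guessed vertex is at most 1 because
    [newdig] is a truth value there. *)
Lemma place_good S k : S < nstates s -> k < m -> step_in E s S k ->
  (S == 0) || good_in s S -> good_in s (place_in s S k).
Proof.
move=> SW km st gS; apply/andP; split; first by case/and5P: (st).
apply/allP => l; rewrite mem_iota => lm'; have {lm'}lm : l < m by [].
apply/implyP => cl; rewrite (dig_place _ _ st) //; case: eqP => [<-|_].
  by rewrite /newdig (negPf cl) leq_b1.
case/orP: gS => [/eqP->|]; first by rewrite /dig digit0.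
by case/andP=> _ /allP/(_ l); rewrite mem_iota => /(_ lm)/implyP; apply.
Qed.

Lemma complete_stuck S k : k < m -> complete_state s S -> ~~ step_in E s S k.
Proof.
by move=> km /eqP f; apply/negP => /(step_placed km); rewrite f ltnn.
Qed.

Lemma newdig_le S k : k < m ->
  newdig m (vr s vB1) (colour s) (ar s aPar) (ar s aF) S k <= 3 * m + 2.
Proof.
move=> km; rewrite /newdig; case: ifP => _; last by apply: leq_trans (leq_b1 _) _; lia.
rewrite /segn; have := posn_le m b1_gt0 (placed m S).
by have := leq_div (posn m (vr s vB1) (placed m S)) (vr s vB1); lia.
Qed.

Definition expanding cur k t :=
  [/\ inv true cur k t, vr t vS = cur, vr t vStamp = sigma, time0 <= tk t &
      vr t vSeg = segn m (vr s vB1) (placed m cur)].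

(** The inequality that bounds the time also bounds the stack, which therefore fits into an array
    indexed up to [4 ^ n]. *)
Lemma inv_sp active cur ck t : inv active cur ck t -> time0 <= tk t ->
  vr t vSp + active <= nstates s.
Proof.
move=> I h; have := wl_time I; have := count_size (marked (nstates s) sigma (ar t aMark)) (iota 0 (nstates s)).
by rewrite size_iota; lia.
Qed.

Lemma expand_spec cur k t : same s t -> k < m -> vr t vK = k -> expanding cur k t ->
  WP expand (expanding cur k.+1) t.
Proof.
move=> sm km tk_ [I tS tst tle tseg]; have Rt := same_ready sm R.
have [[_ mE _ _] [_ oE pE tE] bE fE] := sm.
have curW : cur < nstates s by case/andP: (wl_cur I isT).
set nd := newdig m (vr s vB1) (colour s) (ar s aPar) (ar s aF) cur k.
have ndE : eval t [::] (eNew (EVar vK)) = nd.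
  rewrite (eval_new (n := n) (E := E)) //=; rewrite ?tk_ ?mE ?bE ?tS //.
  by rewrite /nd /colour tE pE fE.
have ndle := newdig_le cur km; rewrite -/nd in ndle.
have w4 j : weight (fun=> 4) j = 4 ^ j by rewrite /weight prod_nat_const_nat subn0.
have plE : cur + nd * 4 ^ k = place_in s cur k by rewrite -w4.
have plB : cur + nd * 4 ^ k < 2 ^ bit_bound n.
  apply: leq_ltn_trans (bits_prod (a := 1 + (3 * m + 2)) (b := 4 ^ m) _ _); last 2 first.
  - by move: mn; rewrite /m; lia.
  - by rewrite leq_exp2l.
  rewrite mulnDl mul1n leq_add // ?leq_mul // ?leq_exp2l ?(ltnW km) //.
  by rewrite -nstates_exp ltnW.
apply: WP_seq; apply: WP_asg; rewrite ndE.
  move=> _; apply: vbound_large => //; apply: small_lt_exp2; rewrite !expnS expn0; move: mn ndle; rewrite /m; nia.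
set t1 := setv _ _ _.
have S2E : eval t1 [::] (EVar vS + EVar vT * Eprod (EVar vK) (ECst 4))%X = place_in s cur k.
  rewrite -plE -[LHS]/(vr t vS + nd * \prod_(0 <= i < vr t vK) 4).
  by rewrite prod_nat_const_nat subn0 tS tk_.
apply: WP_seq; apply: WP_asg; rewrite S2E.
  by move=> _; apply: vbound_large => //; rewrite -plE.
set t2 := setv _ _ _.
have sm2 : same s t2 by [].
have R2 := same_ready sm2 R.
have condE : eval t2 [::] ((eDig (EVar vS) (EVar vK) == ECst 0) * (ECst 0 < EVar vT) *
   (EVar vT < ECst 4) * eBack (EVar vS) (EVar vK) * eValid (EVar vS2) *
     (ECst 1 - (EArr aMark (EVar vS2) == EVar vStamp)))%X =
   step_in E s cur k && (ar t aMark (place_in s cur k) != sigma).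
  have bk : eval t2 [::] (eBack (EVar vS) (EVar vK)) =
    back m (vr s vB1) (edge E s) (colour s) (ar s aPar) (ar s aF) cur k.
    have kt : vr t2 vK < vr t2 vM by rewrite -[vr t2 vM]/(vr t vM) mE -[vr t2 vK]/(vr t vK) tk_.
    have sg2 : vr t2 vSeg = segn (vr t2 vM) (vr t2 vB1) (placed (vr t2 vM) (vr t2 vS)).
      by rewrite -[vr t2 vSeg]/(vr t vSeg) -[vr t2 vM]/(vr t vM) -[vr t2 vB1]/(vr t vB1)
        -[vr t2 vS]/(vr t vS) mE bE tS.
    rewrite (eval_back R2 kt sg2) /edge /colour -[vr t2 vM]/(vr t vM) -[vr t2 vB1]/(vr t vB1)
         -[ar t2 aOrd]/(ar t aOrd) -[ar t2 aPar]/(ar t aPar) -[ar t2 aTyp]/(ar t aTyp)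
         -[ar t2 aF]/(ar t aF) -[vr t2 vS]/(vr t vS) -[vr t2 vK]/(vr t vK).
    by rewrite mE bE oE pE tE fE tS tk_.
  have va : eval t2 [::] (eValid (EVar vS2)) =
    valid m (edge E s) (colour s) (ar s aPar) (ar s aF) (place_in s cur k).
    rewrite (eval_valid _ R2) /edge /colour -[vr t2 vM]/(vr t vM)
       -[ar t2 aOrd]/(ar t aOrd) -[ar t2 aPar]/(ar t aPar) -[ar t2 aTyp]/(ar t aTyp)
         -[ar t2 aF]/(ar t aF) mE oE pE tE fE.
    by [].
  rewrite -[LHS]/(((dig (vr t vS) (vr t vK) == 0) * (0 < nd) * (nd < 4) *
     eval t2 [::] (eBack (EVar vS) (EVar vK)) * eval t2 [::] (eValid (EVar vS2)) *
     (1 - (ar t aMark (place_in s cur k) == vr t vStamp)))).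
  by rewrite bk va tS tk_ tst !(muln_bool, negb_bool) /step_in /step -/nd !andbA.
apply: WP_if; rewrite condE; last first.
  move=> /eqP; rewrite eqb0 negb_and negbK => h; apply: WP_skip; split=> //.
  apply: worklist_skip I _ => st; move: h; rewrite st /= => /eqP e.
  by rewrite /marked e eqxx andbT; apply: place_lt.
case: (boolP (_ && _)) => // /andP[st mk] _.
have plW := place_lt curW km st.
have spW := inv_sp I tle.
have WI := nstates_index.
have IL := index_lt.
apply: WP_seq; apply: WP_set; rewrite -?[eval _ _ (EVar vS2)]/(place_in s cur k).
- by move=> _; apply: leq_trans WI; apply: ltnW.
- by case=> b _ _; apply: b.
apply: WP_seq; apply: WP_set; rewrite -?[eval _ _ (EVar vS2)]/(place_in s cur k).
- by move=> _; apply: leq_trans WI; apply: ltnW.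
- by case=> b _ _; apply: b.
apply: WP_seq; apply: WP_set; rewrite -?[eval _ _ (EVar vS2)]/(place_in s cur k)
   -?[eval _ _ (EVar vSp)]/(vr t vSp).
- by move=> _; apply: leq_trans WI; lia.
- by move=> _; lia.
apply: WP_asg; rewrite -[eval _ [::] (EVar vSp + ECst 1)%X]/(vr t vSp + 1).
  by move=> _; apply: vbound_large => //; lia.
split=> //.
have := worklist_push place_lt place_good I km st mk.
by rewrite /inv /upd /= tk_ tst addn1; apply.
Qed.

Definition looping t := [/\ inv false 0 0 t, vr t vStamp = sigma & time0 <= tk t].

Lemma search_body_spec t : same s t -> looping t -> 0 < vr t vSp ->
  WP search_body (fun t' => looping (tick t')) t.
Proof.
move=> sm [I tst tle] sp0; have Rt := same_ready sm R.
have [[nE mE m3E rE] [adE oE pE tE] bE fE] := sm.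
apply: WP_seq; apply: WP_asg; rewrite -[eval _ [::] (EVar vSp - ECst 1)%X]/(vr t vSp - 1).
  by case=> b _ _; apply: vbound_large => //; apply: leq_ltn_trans (leq_subr _ _) (b _).
set t1 := setv _ _ _.
apply: WP_seq; apply: WP_asg; rewrite -[eval _ [::] (EArr aStk (EVar vSp))]/(ar t aStk (vr t vSp - 1)).
  by case=> _ _ b; apply: vbound_large => //; apply: b.
set cur := ar t aStk _; set t2 := setv _ _ _.
have I2 : inv true cur 0 t2.
  have spE : vr t vSp = (vr t vSp - 1).+1 by lia.
  by move: I; rewrite /inv {1}spE; exact: worklist_pop.
have pm : placed m cur <= m by apply: placed_le.
apply: WP_seq; apply: WP_asg; rewrite -[eval _ _ (ePlaced _)]/(placed (vr t vM) cur) mE.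
  by move=> _; apply: vbound_small; rewrite /size_bound; move: pm mn; rewrite /m; lia.
set t3 := setv _ _ _.
apply: WP_if; rewrite -[eval _ _ _]/(nat_of_bool (placed m cur == vr t vM)) mE.
  case: eqP => // full _; apply: WP_seq; apply: WP_asg.
    by move=> _; apply: vbound_small; rewrite /size_bound /=; lia.
  apply: WP_asg; first by case=> b _ _; apply: vbound_large => //; apply: b.
  split=> //; last exact: leqW.
  by apply: (worklist_full complete_stuck I2); apply/eqP.
case: eqP => // nfull _; apply: WP_seq.
have segE : eval t3 [::] (ECst 2 * EVar vM + ePos (EVar vD) %/ EVar vB1)%X = segn m (vr s vB1) (placed m cur).
  rewrite -[LHS]/(2 * vr t vM + eval t3 [::] (ePos (EVar vD)) %/ vr t vB1) eval_pos.
  by rewrite -[vr t3 vM]/(vr t vM) -[vr t3 vB1]/(vr t vB1) mE bE.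
apply: WP_asg; rewrite segE.
  move=> _; apply: vbound_large => //; apply: small_lt_exp2; rewrite !expnS expn0.
  have := posn_le m b1_gt0 (placed m cur); rewrite /segn.
  have := leq_div (posn m (vr s vB1) (placed m cur)) (vr s vB1).
  by move: mn; rewrite /m; nia.
set t4 := setv _ _ _.
have sm4 : same s t4 by [].
apply: (WP_for (I := fun k u => expanding cur k u)) => //.
- rewrite -[vr t4 vM]/(vr t vM) mE => k u km F uk bu Iu.
  apply: expand_spec => //.
  by split; [split|split| |]; rewrite ?(frm_v F) ?(frm_a F).
- rewrite -[vr t4 vM]/(vr t vM) mE => u F bu [Iu _ us ul _]; split=> //; last exact: leqW.
  by apply: (worklist_done Iu); apply/eqP.
Qed.

Lemma search_loop_spec t : same s t -> looping t ->
  WP (CWhile (EVar vSp) search_body) (fun t' => looping t' /\ vr t' vSp = 0) t.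
Proof.
(* The number of all states is a crude bound that serves termination only; the sharp count is taken
   from [wl_time] after the loop. *)
move=> sm It; apply: (WP_while (T := time0 + nstates s) (I := looping)) => //.
move=> u F bu Iu /eqP; rewrite -lt0n => sp0; have [I _ ul] := Iu.
have smu : same s u.
  have [[nE mE m3E rE] [adE oE pE tE] bE fE] := sm.
  by split; [split|split| |]; rewrite ?(frm_v F) ?(frm_a F).
split; last exact: search_body_spec.
have := wl_time I; have := count_size (marked (nstates s) sigma (ar u aMark)) (iota 0 (nstates s)).
by rewrite size_iota; move: sp0; rewrite -[eval _ _ _]/(vr u vSp); lia.
Qed.

End Search.

Notation trace_in s := (trace (vr s vM) (vr s vB1) (edge E s) (colour s) (ar s aPar) (ar s aF)).

Record searched s t : Prop := Searched {
  se_stamp : vr t vStamp = (vr s vStamp).+1;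
  se_mark : forall S, ar t aMark S <= vr t vStamp;
  se_tick : tk t <= tk s + (count (good_in s) (iota 0 (nstates s))).+1;
  se_bool : vr t vFound <= 1;
  se_found : vr t vFound = 1 -> complete_state s (vr t vGoal) /\
    exists ks, chain (vr s vM) (step_in E s) (place_in s) (ar t aPred) (vr t vGoal) ks;
  se_none : vr t vFound = 0 -> forall S ks, trace_in s S ks -> ~~ complete_state s S }.

Lemma search_spec s : ready s -> vr s vM <= n -> 0 < vr s vB1 -> vr s vFound = 0 ->
  (forall S, ar s aMark S <= vr s vStamp) -> (vr s vStamp).+1 < 2 ^ bit_bound n ->
  WP search (searched s) s.
Proof.
move=> R mn b0 f0 mk stL; rewrite /search.
have L0 k : k <= 1 -> k < 2 ^ bit_bound n by move=> h; apply: small_bits; lia.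
apply: WP_seq; apply: WP_asg; rewrite -[eval _ _ (EVar vStamp + ECst 1)%X]/(vr s vStamp + 1) addn1.
  by move=> _; apply: vbound_large.
set sigma := (vr s vStamp).+1.
apply: WP_seq; apply: WP_set; [by []|by move=> _; exact: stL|].
apply: WP_seq; apply: WP_set; [by []|by move=> _; exact: L0|].
apply: WP_seq; apply: WP_asg; first by move=> _; apply: vbound_large => //; apply: L0.
set s1 := setv _ _ _.
have sm : same s s1 by [].
have I1 : looping s sigma (tk s) s1.
  split=> //; rewrite /inv -[vr s1 vFound]/(vr s vFound) f0.
  have lt S : ar s aMark S < sigma by rewrite ltnS.
  exact: (@worklist_init _ _ sigma (tk s) _ _ _ _ (nstates_gt0 s) _ (ar s aStk) (ar s aPred)
            (vr s vGoal) lt).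
apply: WP_conseq (search_loop_spec R mn b0 sm I1) _ => t F _ _ [[I ts tl] sp0].
have W := I; rewrite /inv sp0 in W.
split=> //.
- by move=> S; rewrite ts; apply: wl_mark W S.
- have := wl_time W; have := marked_le W; lia.
- exact: wl_found W.
- move=> f1; have [mg fg] := wl_goal W f1; split=> //.
  have [|ks c] := worklist_chain (size_of := placed (vr s vM)) _ W mg; last by exists ks.
  by move=> S k km st; exact: (placed_place km st).
(* With an empty stack every marked state is closed under steps, so every trace stays within the
   marked states; a complete one would have set [vFound]. *)
- move=> ft S ks tr; have : marked (nstates s) sigma (ar t aMark) S.
    elim: tr => {S ks} [|S ks k tr mS km st]; first exact: wl_zero W.
    by case: (wl_closed W mS) => [[j]//|[]//|[_]]; apply.
  move=> mS; apply/negP => full; case: (wl_closed W mS) => [[j]//|[]//|[h _]].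
  by have := h full; rewrite ft.
Qed.

End Program.

(** * All guesses and all bandwidths for one component *)

Definition feasible m (adj : nat -> nat -> bool) b1 :=
  exists p : nat -> nat, [/\ forall k, k < m -> p k < m,
    forall k l, k < m -> l < m -> p k = p l -> k = l &
    forall k l, k < m -> l < m -> adj k l -> p k < p l + b1].

Lemma feasible_size m adj : feasible m adj m.
Proof. by exists id; split=> // k l km _ _; rewrite ltn_addl. Qed.

(** An edge of the tree changes the segment by at most 1, so a vertex and its grandparent differ by
    at most 2, which is what the five choices cover. *)
Lemma guess_exists m adj typ par root b1 p : tree m adj typ par root -> 0 < b1 ->
  (forall k, k < m -> p k < m) ->
  (forall k l, k < m -> l < m -> adj k l -> p k < p l + b1) ->
  exists2 g, g < nguess m typ root &
    forall k, k < m -> ~~ typ k -> guess m typ par root g k = 2 * m + p k %/ b1.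
Proof.
move=> T b0 pm pa.
have near k : k < m -> k != root ->
   p k %/ b1 <= (p (par k) %/ b1).+1 /\ p (par k) %/ b1 <= (p k %/ b1).+1.
  have q x y : x < y + b1 -> x %/ b1 <= (y %/ b1).+1.
    move=> /ltnW/(leq_div2r b1)/leq_trans; apply.
    by rewrite addnC -{1}[b1]mul1n divnMDl // add1n.
  move=> km kr; have [a a'] := tree_adj T km kr; have pkm := tree_par T km.
  by split; apply/q/pa.
(* The digits read off [p]; adding 2 makes the difference to the grandparent a number from 0 to
   4. *)
pose d k := if k == root then p root %/ b1 else if typ k then 0
            else p k %/ b1 + 2 - p (par (par k)) %/ b1.
have [g [gG gd]] : exists g, g < weight (choices m typ root) m /\
    forall i, i < m -> digit (choices m typ root) g i = d i.
  apply: digit_ex => i im; rewrite /d /choices; case: eqP => [_|/eqP ir].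
    exact: leq_ltn_trans (leq_div _ _) (pm _ (tree_root T)).
  case: ifP => // /negbT ti; have [tp [tpp lt]] := grandparent_lt T im ti ir.
  have pr : par i != root by apply: contraTneq tp => ->; apply: tree_typ_root T.
  have := near i im ir; have := near (par i) (tree_par T im) pr.
  by move: (p i %/ b1) (p (par i) %/ b1) (p (par (par i)) %/ b1) => x y z; lia.
exists g => //; elim/ltn_ind => k IH km tk.
have [->|kr] := eqVneq k root; first by rewrite guess_root gd ?(tree_root T) // /d eqxx.
have [tp [tpp lt]] := grandparent_lt T km tk kr.
rewrite (guess_step T g km tk kr) IH //; last exact: ltn_trans km.
rewrite gd // /d (negPf kr) (negPf tk).
have pr : par k != root by apply: contraTneq tp => ->; apply: tree_typ_root T.
have := near k km kr; have := near (par k) (tree_par T km) pr.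
by move: (p k %/ b1) (p (par k) %/ b1) (p (par (par k)) %/ b1) => x y z; lia.
Qed.

Section Program.
Variable n : nat.
Variable E : nat -> nat -> bool.
Hypothesis E_sym : forall u v, E u v = E v u.

Notation WP := (WP (array_base n) (size_bound n) (bit_bound n) (index_bound n)).
Notation bounded := (bounded (size_bound n) (bit_bound n)).
Notation vbound := (vbound (size_bound n) (bit_bound n)).
Notation ready := (ready n E).

(** At most [3 * state_bound n] rounds for one segment length in one component; a component with [m]
    vertices tries at most [m] lengths, and the sizes of the components add up to [n]. *)
Definition tick_bound := 3 * n * state_bound n.

Lemma tick_bound_lt : tick_bound + 2 < 2 ^ bit_bound n.
Proof.
have h : state_bound n <= 2 * n * 2 ^ (5 * n).
  apply: leq_trans (leq_div _ _) _; rewrite leq_mul2l; apply/orP; right.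
  by rewrite expnM; apply: leq_exp2r0.
have h1 : 2 * n < 2 ^ n.+1 by rewrite expnS ltn_mul2l ltn_expl.
have h2 : 3 * n < 2 ^ n.+2 by rewrite !expnS; have := ltn_expl n (isT : 1 < 2); lia.
apply: (@leq_ltn_trans (2 ^ n.+2 * (2 ^ n.+1 * 2 ^ (5 * n)) + 2)).
  rewrite leq_add2r /tick_bound leq_mul // ?(ltnW h2) //; apply: leq_trans h _.
  by rewrite leq_mul2r (ltnW h1) orbT.
rewrite -!expnD; apply: (@leq_trans (2 ^ (n.+2 + (n.+1 + 5 * n)) * 4)).
  have : 0 < 2 ^ (n.+2 + (n.+1 + 5 * n)) by rewrite expn_gt0.
  lia.
by rewrite -[4]/(2 ^ 2) -expnD leq_exp2l // /bit_bound; lia.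
Qed.

Definition found_in t := complete_state t (vr t vGoal) /\
  exists ks, chain (vr t vM) (step_in E t) (place_in t) (ar t aPred) (vr t vGoal) ks.

Definition ngood s g := count (good (vr s vM) (edge E s) (colour s) (ar s aPar) (vr s vRoot) g)
  (iota 0 (nstates s)).

(** Each search is accompanied by a tick, so bounding the stamp by the ticks keeps it within the
    word length. *)
Definition stamped t := vr t vStamp <= tk t /\ forall S, ar t aMark S <= vr t vStamp.

Definition frozen s t :=
  [/\ vr t vN = vr s vN, vr t vM = vr s vM, vr t vM3 = vr s vM3 & vr t vRoot = vr s vRoot] /\
  [/\ ar t aAdj = ar s aAdj, ar t aOrd = ar s aOrd, ar t aPar = ar s aPar &
      ar t aTyp = ar s aTyp].

Lemma frozen_ready s t : frozen s t -> ready s -> ready t.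
Proof. by case=> h1 h2 R; apply: ready_transfer R h1 h2. Qed.

Section Guesses.
Variable s : state.
Hypothesis R : ready s.
Hypothesis mn : vr s vM <= n.
Hypothesis b1_gt0 : 0 < vr s vB1.
Let T := rt_tree (rd_rooted R).
Let m := vr s vM.

Lemma good_in_guess g t : frozen s t ->
  (forall k, k < m -> ~~ colour s k -> ar t aF k = guess m (colour s) (ar s aPar) (vr s vRoot) g k) ->
  good_in E t =1 good m (edge E s) (colour s) (ar s aPar) (vr s vRoot) g.
Proof.
case=> -[_ mE _ rE] [_ oE pE tE] fE S; rewrite /good_in /good /edge /colour mE oE pE tE.
by congr andb; apply: (valid_ext T) => k km ck; apply: fE.
Qed.

(** Later guesses overwrite [aF], so the function that was searched with is remembered
    existentially; its values are pinned down at the guessed vertices. *)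
Definition no_trace g := exists2 f,
  (forall k, k < m -> ~~ colour s k -> f k = guess m (colour s) (ar s aPar) (vr s vRoot) g k) &
  forall S ks, trace m (vr s vB1) (edge E s) (colour s) (ar s aPar) f S ks -> ~~ complete_state s S.

Definition guessing t :=
  [/\ stamped t, vr t vFound <= 1, vr t vG <= nguess m (colour s) (vr s vRoot),
      tk t <= tk s + \sum_(0 <= g < vr t vG) (2 + ngood s g) &
      (vr t vFound = 1 -> found_in t) /\
      (vr t vFound = 0 -> forall g, g < vr t vG -> no_trace g)].

(** The 2 stands for one round of [guess_loop] and the expansion of the state 0; this gives
    [2 * state_bound n] over all guesses, and the good states give the third part. *)
Lemma ngood_bound : \sum_(0 <= g < nguess m (colour s) (vr s vRoot)) (2 + ngood s g) <=
  3 * state_bound n.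
Proof.
rewrite big_split /= sum_nat_const_nat subn0.
have := nguess_bound T (rt_balanced (rd_rooted R)) mn.
have := good_bound T (rt_balanced (rd_rooted R)) mn.
rewrite -/m /ngood /nstates -/m; lia.
Qed.

Lemma guess_loop_spec : vr s vG = 0 -> vr s vFound = 0 -> stamped s ->
  vr s vGs = nguess m (colour s) (vr s vRoot) -> tk s + 3 * state_bound n <= tick_bound ->
  WP guess_loop (fun t => [/\ stamped t, vr t vFound <= 1, tk t <= tk s + 3 * state_bound n,
    vr t vFound = 1 -> found_in t & vr t vFound = 0 -> ~ feasible m (edge E s) (vr s vB1)]) s.
Proof.
move=> g0 f0 st Gs tb; have NB := ngood_bound.
have part g : g <= nguess m (colour s) (vr s vRoot) ->
   \sum_(0 <= g' < g) (2 + ngood s g') <= 3 * state_bound n.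
  move=> gG; apply: leq_trans NB; rewrite (big_cat_nat (leq0n g) gG) //=; exact: leq_addr.
apply: (WP_while (T := tick_bound) (I := guessing)).
- by split; rewrite ?f0 ?g0 ?big_geq ?addn0.
- move=> t F bt [stt fb gG tt [f1 f2]].
  have fz : frozen s t by split; split; rewrite ?(frm_v F) ?(frm_a F).
  have bE : vr t vB1 = vr s vB1 by rewrite (frm_v F).
  have GE : vr t vGs = nguess m (colour s) (vr s vRoot) by rewrite (frm_v F).
  rewrite -[eval _ _ _]/((vr t vG < vr t vGs) * (vr t vFound == 0)) muln_bool GE.
  case: ltnP => // gG'; case: eqP => // ft0 _.
  have tl : tk t + 2 <= tk s + 3 * state_bound n.
    have := part (vr t vG).+1 gG'; rewrite big_nat_recr //=; lia.
  split; first by lia.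
  have Rt := frozen_ready fz R.
  have mt : vr t vM <= n by case: fz => -[_ ->].
  apply: WP_seq; apply: WP_conseq (decode_spec Rt mt) _ => u Fu _ bu decU.
  have fzu : frozen s u by case: fz => -[h1 h2 h3 h4] [h5 h6 h7 h8]; split; split; rewrite ?(frm_v Fu) ?(frm_a Fu).
  have Ru := frozen_ready fzu R.
  have mu : vr u vM <= n by case: fzu => -[_ ->].
  have bu1 : vr u vB1 = vr s vB1 by rewrite (frm_v Fu).
  have fu : vr u vFound = 0 by rewrite (frm_v Fu).
  have [stu mku] : vr u vStamp = vr t vStamp /\ ar u aMark = ar t aMark.
    by split; rewrite ?(frm_v Fu) ?(frm_a Fu).
  have tku : tk u = tk t by rewrite (frm_tk Fu).
  have gu : vr u vG = vr t vG by rewrite (frm_v Fu).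
  have dec k : k < m -> ~~ colour s k -> ar u aF k =
      guess m (colour s) (ar s aPar) (vr s vRoot) (vr t vG) k.
    case: (fz) => -[_ mE _ rE] [_ _ pE tE].
    by have := decU k; rewrite /guess_in /colour mE rE pE tE.
  have TB := tick_bound_lt.
  apply: WP_seq; apply: WP_conseq (search_spec Ru mu _ fu _ _) _.
  + by rewrite bu1.
  + by move=> S; rewrite mku stu; case: stt.
  + by rewrite stu; case: stt => h _; lia.
  move=> v Fv _ bv [sv mv tv fv v1 v0].
  have fzv : frozen u v by split; split; rewrite ?(frm_v Fv) ?(frm_a Fv).
  have gv : vr v vG = vr t vG by rewrite (frm_v Fv).
  have bv1 : vr v vB1 = vr u vB1 by rewrite (frm_v Fv).
  have Fv' : ar v aF = ar u aF by rewrite (frm_a Fv).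
  have cnt : count (good_in E u) (iota 0 (nstates u)) = ngood s (vr t vG).
    rewrite /ngood (eq_count (good_in_guess fzu dec)) /nstates.
    by case: fzu => -[_ ->].
  have GB := nguess_bound T (rt_balanced (rd_rooted R)) mn; rewrite -/m in GB.
  apply: WP_asg; rewrite -[eval _ _ _]/(vr v vG + 1) gv.
    move=> _; apply: vbound_large => //; apply: leq_ltn_trans TB.
    have : state_bound n <= tick_bound.
      rewrite /tick_bound -{1}[state_bound n]mul1n leq_mul2r; apply/orP; right.
      by have := tree_root T; move: mn; lia.
    lia.
  set w := setv _ _ _; have gw : vr (tick w) vG = (vr t vG).+1 by rewrite -addn1.
  have same_uv : same u v by case: fzv => h1 h2; split.
  have [stE plE] := same_step E same_uv.
  split.
  + split; last exact: mv.
    rewrite -[X in X <= _]/(vr v vStamp) -[X in _ <= X]/(tk v).+1 sv stu; case: stt => h1 _.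
    by have := frm_le Fv; rewrite tku; lia.
  + exact: fv.
  + by rewrite gw.
  + rewrite gw big_nat_recr //= -[X in X <= _]/(tk v).+1; move: tv; rewrite tku cnt; lia.
  + split=> [h|h g].
      have [c1 [ks c2]] := v1 h; split.
        by rewrite /complete_state -[vr (tick w) vM]/(vr v vM); case: fzv => -[_ -> _ _] _.
      exists ks; rewrite -[step_in E (tick w)]/(step_in E v) -[place_in (tick w)]/(place_in v).
      by rewrite stE plE -[vr (tick w) vM]/(vr v vM); case: fzv => -[_ -> _ _] _.
    rewrite gw ltnS leq_eqVlt => /predU1P[->|]; last exact: f2.
    exists (ar u aF) => // S ks; have := v0 h S ks.
    case: (fzu) => -[_ mE _ _] [_ oE pE tE].
    by rewrite /complete_state /edge /colour mE oE pE tE bu1; apply.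
- move=> t F bt [stt fb gG tt [f1 f2]].
  have GE : vr t vGs = nguess m (colour s) (vr s vRoot) by rewrite (frm_v F).
  rewrite -[eval _ _ _]/((vr t vG < vr t vGs) * (vr t vFound == 0)) muln_bool GE => e0.
  split=> //; first by apply: leq_trans tt _; rewrite leq_add2l part.
  move=> ft0 [p [pm pi pa]]; have gE : vr t vG = nguess m (colour s) (vr s vRoot).
    by move: e0; rewrite ft0 andbT; case: ltnP => // h _; apply/eqP; rewrite eqn_leq gG h.
  (* An ordering within the bound would have been found with the guess read off from it. *)
  have [g gG' gp] := guess_exists T b1_gt0 pm pa.
  rewrite -gE in gG'; have [f fE none] := f2 ft0 g gG'.
  have adj_sym k l : k < m -> l < m -> edge E s k l = edge E s l k.
    by move=> _ _; rewrite /edge E_sym.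
  have par_ok k : k < m -> colour s k -> ar s aPar k < m /\ edge E s k (ar s aPar k).
    move=> km ck; split; first exact: (tree_par T).
    have kr : k != vr s vRoot by apply: contraTneq ck => ->; apply: tree_typ_root T.
    by case: (tree_adj T km kr).
  have fp k : k < m -> ~~ colour s k -> f k = 2 * m + p k %/ vr s vB1.
    by move=> km ck; rewrite fE // gp.
  have [S [ks [tr full]]] := complete (colour_par R) b1_gt0 adj_sym pm pi pa par_ok fp.
  by have := none S ks tr; rewrite /complete_state full eqxx.
Qed.

End Guesses.

Record solved s t : Prop := Solved {
  so_ready : ready t;
  so_stamped : stamped t;
  so_tick : tk t <= tk s + vr s vM * (3 * state_bound n);
  so_b1 : 0 < vr t vB1 <= vr s vM;
  so_found : found_in t;
  so_min : forall b, 0 < b < vr t vB1 -> ~ feasible (vr s vM) (edge E s) b }.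

Lemma solve_spec s : graph_loaded n E s -> rooted E s -> 0 < vr s vM <= n ->
  (forall k, k < vr s vM -> ar s aOrd k < n) -> stamped s ->
  tk s + vr s vM * (3 * state_bound n) <= tick_bound ->
  WP solve (solved s) s.
Proof.
move=> gl rt /andP[m0 mn] oN st tb; rewrite /solve.
set m := vr s vM in m0 mn oN tb *.
have T := rt_tree rt; rewrite -/m in T.
have TB := tick_bound_lt.
have SB : state_bound n <= tick_bound.
  rewrite /tick_bound -{1}[state_bound n]mul1n leq_mul2r; apply/orP; right; lia.
apply: WP_seq; apply: WP_asg; first by move=> _; apply: vbound_small; rewrite /size_bound /= -/m; lia.
apply: WP_seq; apply: WP_asg; first by move=> _; apply: vbound_small.
set s2 := setv _ _ _.
have R2 : ready s2 by case: gl => g1 g2; split=> //; case: rt => *; split.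
have GE : eval s2 [::] (Eprod (EVar vM) (eChoices (EBnd 0))) = nguess m (colour s) (vr s vRoot).
  exact: (eval_weight (k := EVar vM) (rho := [::]) R2 (leqnn _)).
have GB := nguess_bound T (rt_balanced rt) mn.
apply: WP_seq; apply: WP_asg; rewrite GE.
  by move=> _; apply: vbound_large => //; lia.
set s3 := setv _ _ _; have R3 : ready s3 by apply: ready_transfer R2 _ _.
pose I b t := [/\ stamped t, tk t <= tk s + b * (3 * state_bound n), vr t vFound <= 1,
   vr t vFound = 0 -> forall b', 0 < b' <= b -> ~ feasible m (edge E s) b' &
   vr t vFound = 1 -> [/\ found_in t, 0 < vr t vB1 <= b &
      forall b', 0 < b' < vr t vB1 -> ~ feasible m (edge E s) b']].
apply: (WP_for (I := I)) => //.
- split=> //; first by rewrite addn0.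
  by move=> _ [].
- rewrite -[vr s3 vM]/m => b t bm F tb' bt [stt tt fb f0 f1].
  have fz : frozen s3 t by split; split; rewrite ?(frm_v F) ?(frm_a F).
  have Rt := frozen_ready fz R3.
  have tG : vr t vGs = nguess m (colour s) (vr s vRoot) by rewrite (frm_v F).
  apply: WP_if; rewrite -[eval _ _ _]/(nat_of_bool (vr t vFound == 0)); last first.
    move/eqP; rewrite eqb0 => ft; have {}ft : vr t vFound = 1 by lia.
    apply: WP_skip; split=> //; rewrite ?ft //; first by rewrite mulSn; lia.
    by move=> _; have [h1 /andP[-> h2] h3] := f1 ft; split=> //; apply: leqW.
  case: eqP => // ft _.
  apply: WP_seq; apply: WP_asg; rewrite -[eval _ _ _]/(vr t vB + 1) tb' addn1.
    by move=> _; apply: vbound_small; rewrite /size_bound; lia.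
  apply: WP_seq; apply: WP_asg; first by move=> _; apply: vbound_large => //; rewrite expn_gt0.
  set t2 := setv _ _ _.
  have mE : vr t vM = m by rewrite (frm_v F).
  have R4 : ready t2 by apply: ready_transfer Rt _ _.
  have colE : [/\ colour t2 = colour s, edge E t2 = edge E s & vr t2 vRoot = vr s vRoot].
    by rewrite /colour /edge /= (frm_a F) // (frm_a F) // (frm_v F).
  have [c1 c2 c3] := colE.
  have b2 : vr t2 vB1 = b.+1 by [].
  have tkb : tk t2 + 3 * state_bound n <= tick_bound.
    rewrite -[tk t2]/(tk t); apply: leq_trans tb.
    have : b.+1 * (3 * state_bound n) <= m * (3 * state_bound n) by rewrite leq_mul2r bm orbT.
    by rewrite mulSn; lia.
  apply: WP_conseq (guess_loop_spec R4 _ _ _ ft stt _ tkb) _ => //.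
  + by rewrite -[vr t2 vM]/(vr t vM) mE.
  + by rewrite -[vr t2 vM]/(vr t vM) mE c1 c3.
  move=> u Fu _ bu [stu fu tku u1 u0].
  have bE : vr u vB1 = b.+1 by rewrite (frm_v Fu).
  split=> //.
  + by move: tku; rewrite -[tk t2]/(tk t) mulSn; lia.
  + move=> fu0 b' /andP[b0]; rewrite leq_eqVlt ltnS => /predU1P[->|bb].
      by have := u0 fu0; rewrite -[vr t2 vM]/(vr t vM) mE c2 b2.
    by apply: f0 => //; rewrite b0.
  + move=> fu1; split; [exact: u1|by rewrite bE ltnSn|].
    by rewrite bE => b' /andP[b0 bb]; apply: f0 => //; rewrite b0.
- rewrite -[vr s3 vM]/m => t F bt [stt tt fb f0 f1].
  have fz : frozen s3 t by split; split; rewrite ?(frm_v F) ?(frm_a F).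
  have Rt := frozen_ready fz R3.
  have ft : vr t vFound = 1.
    case: (vr t vFound =P 0) => [e|]; last by lia.
    (* Segment length [m] is always feasible, so the loop cannot end without success. *)
    by case: (f0 e m); [rewrite m0 leqnn|apply: feasible_size].
  have [h1 h2 h3] := f1 ft; split=> //.
Qed.

End Program.

(** * Reading the ordering off the final state *)

Section Program.
Variable n : nat.
Variable E : nat -> nat -> bool.
Hypothesis E_sym : forall u v, E u v = E v u.

Notation WP := (WP (array_base n) (size_bound n) (bit_bound n) (index_bound n)).
Notation bounded := (bounded (size_bound n) (bit_bound n)).
Notation vbound := (vbound (size_bound n) (bit_bound n)).
Notation ready := (ready n E).
Notation trace_in s := (trace (vr s vM) (vr s vB1) (edge E s) (colour s) (ar s aPar) (ar s aF)).

Lemma chain_trace s pred S ks :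
  chain (vr s vM) (step_in E s) (place_in s) pred S ks -> trace_in s S ks.
Proof. by elim=> {S ks} [|S ks k _ tr km st _]; [apply: trace0|apply: traceS]. Qed.

Lemma output_spec s : ready s -> vr s vM <= n -> 0 < vr s vB1 <= vr s vM -> found_in E s ->
  (forall k l, k < vr s vM -> l < vr s vM -> ar s aOrd k = ar s aOrd l -> k = l) ->
  vr s vOff + vr s vM <= n ->
  WP output (fun t => exists q,
    [/\ forall k, k < vr s vM -> q k < vr s vM,
        forall k l, k < vr s vM -> l < vr s vM -> q k = q l -> k = l,
        forall k l, k < vr s vM -> l < vr s vM -> edge E s k l -> q k < q l + vr s vB1,
        forall k, k < vr s vM -> ar t aOut (ar s aOrd k) = vr s vOff + q k + 1 &
        forall v, v \notin vertices s -> ar t aOut v = ar s aOut v]) s.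
Proof.
move=> R mn /andP[b0 bm] [full [ks ch]] oi offn; rewrite /output.
set m := vr s vM in mn bm full ch oi offn *; set b1 := vr s vB1 in b0 bm *.
have T := rt_tree (rd_rooted R).
have tr := chain_trace ch; have TS := traceP (colour_par R) tr.
have szks : size ks = m by rewrite (ts_size TS); apply/eqP.
have kin k : k < m -> k \in ks.
  have sub : {subset ks <= iota 0 m}.
    by move=> x /(allP (ts_below TS)); rewrite mem_iota.
  have sz : size (iota 0 m) <= size ks by rewrite size_iota szks.
  by have [_ e] := uniq_min_size (ts_uniq TS) sub sz; rewrite e mem_iota.
have adj_sym k l : k < m -> l < m -> edge E s k l = edge E s l k.
  by move=> _ _; rewrite /edge E_sym.
apply: WP_seq; apply: WP_asg; rewrite -[eval _ _ _]/(vr s vGoal).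
  by case=> b _ _; apply: vbound_large => //; apply: b.
set s1 := setv _ _ _.
(* After [j] rounds the current state is the one reached by the first [m - j] vertices of the chain,
   and the other vertices have their positions. *)
pose I j u := [/\ exists2 ks', chain m (step_in E s) (place_in s) (ar s aPred) (vr u vS) ks' &
       ks' = take (m - j) ks /\ size ks' = m - j,
   forall i, m - j <= i -> i < m -> ar u aOut (ar s aOrd (nth 0 ks i)) = vr s vOff + posn m b1 i + 1 &
   forall v, v \notin vertices s -> ar u aOut v = ar s aOut v].
apply: (WP_for (I := I)) => //.
- split=> //; last by move=> i; rewrite subn0 => h1 h2; lia.
  by exists ks; rewrite // subn0 take_oversize ?szks.
- rewrite -[vr s1 vM]/m => j u jm F uj bu [[ks' ch' [kE sz]] outE out0].
  have [pE oE] : ar u aPred = ar s aPred /\ ar u aOrd = ar s aOrd by split; rewrite (frm_a F).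
  have [mE bE ofE] : [/\ vr u vM = m, vr u vB1 = b1 & vr u vOff = vr s vOff].
    by split; rewrite (frm_v F).
  have [|S [ks2 [k [ch2 km st pk [SE ksE]]]]] := chain_rcons ch'; first by rewrite sz; lia.
  rewrite {ks'}ksE in kE sz ch'.
  have sz2 : size ks2 = m - j.+1 by move: sz; rewrite size_rcons; lia.
  have [ks2E k_nth] : ks2 = take (m - j.+1) ks /\ k = nth 0 ks (m - j.+1).
    have e : m - j = (m - j.+1).+1 by lia.
    by move: kE; rewrite e (take_nth 0) ?szks; [case/rcons_inj|lia].
  have vb v : v <= 3 * n -> forall x, vbound x v.
    by move=> vn x; apply: vbound_small; rewrite /size_bound; lia.
  apply: WP_seq; apply: WP_asg; rewrite -[eval _ [::] (EArr aPred (EVar vS))]/(ar u aPred (vr u vS)) pE pk.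
    by move=> _; apply: vb; lia.
  set u1 := setv _ _ _.
  apply: WP_seq; apply: WP_asg.
    by move=> _; apply: vb; rewrite -[eval _ _ _]/(vr u vM - 1 - vr u vJ) mE; lia.
  rewrite -[eval _ _ _]/(vr u vM - 1 - vr u vJ) mE uj.
  set u2 := setv _ _ _.
  have posE : eval u2 [::] (EVar vOff + ePos (EVar vD) + ECst 1)%X = vr s vOff + posn m b1 (m - j.+1) + 1.
    rewrite -[LHS]/(vr u vOff + eval u2 [::] (ePos (EVar vD)) + 1) eval_pos ofE.
    rewrite -[vr u2 vM]/(vr u vM) -[vr u2 vB1]/(vr u vB1) mE bE -[vr u2 vD]/(m - 1 - j).
    by rewrite -subnDA add1n.
  have idxE : eval u2 [::] (EArr aOrd (EVar vK)) = ar s aOrd k by rewrite -oE.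
  have plt : posn m b1 (m - j.+1) < m by apply: posn_lt => //; lia.
  apply: WP_seq; apply: WP_set; rewrite ?posE ?idxE.
  - by move=> _; apply: small_index; apply: ltnW; apply: (rd_ord R).
  - by move=> _; apply: small_bits; lia.
  set u3 := seta _ _ _ _.
  have newS : eval u3 [::] (EVar vS - eDig (EVar vS) (EVar vK) * Eprod (EVar vK) (ECst 4))%X = S.
    rewrite -[LHS]/(vr u vS - dig (vr u vS) k * weight (fun=> 4) k) SE.
    exact: (place_sub km st).
  apply: WP_asg; rewrite newS.
    move=> _; apply: vbound_large => //.
    have := ts_lt (traceP (colour_par R) (chain_trace ch2)).
    rewrite -/m -/(nstates s) nstates_exp -/m => h.
    have : S < index_bound n + 1.
      by rewrite addn1 ltnS; apply: ltnW; apply: leq_trans h _; rewrite leq_exp2l.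
    move=> h3; apply: ltn_trans h3 _; exact: index_lt.
  split.
  + by exists ks2.
  + move=> i; rewrite leq_eqVlt => /predU1P[<-|ij] im.
      by rewrite -[LHS]/(if ar s aOrd _ == ar s aOrd k then _ else _) k_nth eqxx.
    rewrite -[LHS]/(if ar s aOrd _ == ar s aOrd k then _ else ar u aOut (ar s aOrd (nth 0 ks i))).
    case: eqP => [/oi e|_]; last by apply: outE => //; lia.
    have ni : nth 0 ks i < m by apply: (allP (ts_below TS)); rewrite mem_nth ?szks.
    move: (e ni km); rewrite k_nth => /eqP; rewrite nth_uniq ?szks ?(ts_uniq TS) //; last by lia.
    by move/eqP; lia.
  + move=> v vs; rewrite -[LHS]/(if v == ar s aOrd k then _ else ar u aOut v).
    by case: eqP => [e|_]; [rewrite e mem_vertices in vs|apply: out0].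
- move=> t F bt [_ outE out0].
  exists (fun k => posn m b1 (index k ks)); split=> //.
  + by move=> k km; apply: posn_lt => //; rewrite -szks index_mem kin.
  + move=> k l km lm e; have ik : index k ks < m by rewrite -szks index_mem kin.
    have il : index l ks < m by rewrite -szks index_mem kin.
    have := posn_inj b0 ik il e; move/(congr1 (nth 0 ks)).
    by rewrite !nth_index ?kin.
  + move=> k l km lm a; exact: (trace_sound (colour_par R) b0 adj_sym tr (eqP full) km lm a).
  + move=> k km; have ik : index k ks < m by rewrite -szks index_mem kin.
    have := outE (index k ks); rewrite nth_index ?kin // => -> //.
    by rewrite -[vr s1 vM]/m subnn.
Qed.

End Program.

(** * Joining the components *)

Section Program.
Variable n : nat.
Variable E : nat -> nat -> bool.
Hypothesis E_sym : forall u v, E u v = E v u.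

Notation WP := (WP (array_base n) (size_bound n) (bit_bound n) (index_bound n)).
Notation bounded := (bounded (size_bound n) (bit_bound n)).
Notation vbound := (vbound (size_bound n) (bit_bound n)).
Notation ready := (ready n E).

(** The values of [sigma] are not confined to a range, so that [sigma] may be restricted to a
    component. The one-sided inequality suffices because [E] is symmetric. *)
Definition achievable beta := exists2 sigma : nat -> nat,
  forall u v, u < n -> v < n -> sigma u = sigma v -> u = v &
  forall u v, u < n -> v < n -> E u v -> sigma u <= sigma v + beta.

(** Values are replaced by their ranks within the component. If [p k] exceeds [p l], the excess is
    at most the number of vertices whose values lie in an interval of length [beta], and these
    values are distinct. *)
Lemma compress m (ord : nat -> nat) beta :
  (forall k, k < m -> ord k < n) ->
  (forall k l, k < m -> l < m -> ord k = ord l -> k = l) ->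
  achievable beta -> feasible m (fun k l => E (ord k) (ord l)) beta.+1.
Proof.
move=> on oi [sigma si sE].
have inj k l : k < m -> l < m -> sigma (ord k) = sigma (ord l) -> k = l.
  by move=> km lm /si e; apply: oi => //; apply: e; apply: on.
pose p k := count (fun l => sigma (ord l) < sigma (ord k)) (iota 0 m).
have mono k l : k < m -> sigma (ord k) < sigma (ord l) -> p k < p l.
  move=> km kl; rewrite /p.
  have -> : count (fun x => sigma (ord x) < sigma (ord l)) (iota 0 m) =
     count (fun x => sigma (ord x) < sigma (ord k)) (iota 0 m) +
     count (fun x => sigma (ord k) <= sigma (ord x) < sigma (ord l)) (iota 0 m).
    rewrite -count_predUI [X in _ + X](_ : _ = 0) ?addn0.
      by apply: eq_count => x /=; lia.
    by apply/eqP; rewrite -leqn0 leqNgt -has_count; apply/hasPn => x _ /=; lia.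
  rewrite -addn1 leq_add2l -has_count; apply/hasP; exists k; first by rewrite mem_iota.
  by rewrite leqnn.
exists p; split.
- move=> k km; rewrite /p -[X in _ < X](size_iota 0).
  rewrite -(count_predC (fun l => sigma (ord l) < sigma (ord k))) -addn1 leq_add2l -has_count.
  by apply/hasP; exists k; rewrite ?mem_iota //= ltnn.
- move=> k l km lm e; apply: inj => //.
  by case: (ltngtP (sigma (ord k)) (sigma (ord l))) => // /mono h;
    [have := h km|have := h lm]; rewrite e ltnn.
- move=> k l km lm a; have s_le := sE _ _ (on k km) (on l lm) a.
  rewrite addnS ltnS /p.
  apply: (@leq_trans (p l + count (fun x => sigma (ord l) <= sigma (ord x) < sigma (ord l) + beta) (iota 0 m))).
    rewrite /p -count_predUI; apply: leq_trans (leq_addr _ _).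
    by apply: sub_count => x /=; lia.
  rewrite leq_add2l -size_filter -(size_map (sigma \o ord)).
  rewrite -[leqRHS](size_iota (sigma (ord l))); apply: uniq_leq_size.
    rewrite map_inj_in_uniq ?filter_uniq ?iota_uniq // => x y.
    by rewrite !mem_filter !mem_iota => /andP[_ xm] /andP[_ ym]; apply: inj.
  by move=> y /mapP[x]; rewrite mem_filter => /andP[h _] ->; rewrite mem_iota.
Qed.

(** [D] consists of the finished components. It is closed under edges, so a new component has no
    edge to it, and [pr_opt] compares with orderings of the whole graph from the start. *)
Record progress (D : pred nat) s : Prop := Progress {
  pr_graph : graph_loaded n E s;
  pr_stamp : stamped s;
  pr_vis : forall v, v < n -> ar s aVis v = D v;
  pr_closed : forall u v, u < n -> v < n -> E u v -> D u -> D v;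
  pr_off : vr s vOff = count D (iota 0 n);
  pr_range : forall u, u < n -> D u -> 0 < ar s aOut u <= vr s vOff;
  pr_inj : forall u v, u < n -> v < n -> D u -> D v -> ar s aOut u = ar s aOut v -> u = v;
  pr_opt : forall beta, achievable beta -> forall u v, u < n -> v < n -> D u -> D v -> E u v ->
    ar s aOut u <= ar s aOut v + beta;
  pr_tick : tk s <= vr s vOff * (3 * state_bound n) }.

Lemma component_spec D s : progress D s -> vr s vI < n -> ~~ D (vr s vI) ->
  WP component (fun t => exists D', [/\ progress D' t, forall v, D v -> D' v & D' (vr s vI)]) s.
Proof.
case=> gl st vis closed off range inj opt tick iN Di; rewrite /component.
apply: WP_seq; apply: WP_conseq (grow_spec gl iN Di vis) _ => t F1 _ _ [G clo].
have mn := grown_le G; have m0 := gr_gt0 G.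
set m := vr t vM in mn m0 *.
have offt : vr t vOff = vr s vOff by rewrite (frm_v F1).
have outt : ar t aOut = ar s aOut by rewrite (frm_a F1).
have tkt : tk t = tk s by rewrite (frm_tk F1).
pose D' v := D v || (v \in vertices t).
have cnt : count D' (iota 0 n) = count D (iota 0 n) + m.
  have <- : count [in vertices t] (iota 0 n) = m.
    rewrite -[RHS](size_mkseq (ar t aOrd)) -size_filter; apply/perm_size/uniq_perm.
    - by rewrite filter_uniq ?iota_uniq.
    - exact: uniq_vertices (gr_inj G).
    move=> v; rewrite mem_filter mem_iota; case: (boolP (v \in [in vertices t])) => //= /verticesP[k km <-].
    by have [] := gr_new G km.
  rewrite -count_predUI [X in _ + X](_ : _ = 0) ?addn0 //.
  apply/eqP; rewrite -leqn0 leqNgt -has_count; apply/hasPn => v _ /=.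
  by case: (boolP (v \in _)) => [/verticesP[k km <-]|_]; rewrite ?andbF // andbT; have [] := gr_new G km.
have offn : vr s vOff + m <= n.
  by rewrite off -cnt -[leqRHS](size_iota 0 n) count_size.
apply: WP_seq; apply: WP_conseq (recolour_spec E_sym G) _ => u F2 _ _ rt.
have mu : vr u vM = m by rewrite (frm_v F2).
have [ordu visu outu] : [/\ ar u aOrd = ar t aOrd, ar u aVis = ar t aVis & ar u aOut = ar s aOut].
  by split; rewrite (frm_a F2).
have tku : tk u = tk s by rewrite (frm_tk F2).
have offu : vr u vOff = vr s vOff by rewrite (frm_v F2).
have glu : graph_loaded n E u.
  by case: gl => g1 g2; split; [rewrite (frm_v F2) // (frm_v F1)|rewrite (frm_a F2) // (frm_a F1)].
have stu : stamped u.
  by case: st => h1 h2; split; [rewrite (frm_v F2) // (frm_v F1) // tku|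
     rewrite (frm_v F2) // (frm_v F1) // (frm_a F2) // (frm_a F1)].
have ordn k : k < vr u vM -> ar u aOrd k < n.
  by rewrite mu ordu => km; case: (gr_new G km).
have budget : tk u + vr u vM * (3 * state_bound n) <= tick_bound n.
  rewrite mu tku (_ : tick_bound n = n * (3 * state_bound n)); last first.
    by rewrite /tick_bound mulnA (mulnC n).
  by apply: leq_trans (leq_add tick (leqnn _)) _; rewrite -mulnDl leq_mul2r offn orbT.
have mlim : 0 < vr u vM <= n by rewrite mu m0.
apply: WP_seq; apply: WP_conseq (solve_spec E_sym glu rt mlim ordn stu budget) _.
move=> w F3 _ _ [Rw stw tkw b1w fw minw].
have mw : vr w vM = m by rewrite (frm_v F3).
have [ordw visw outw] : [/\ ar w aOrd = ar t aOrd, ar w aVis = ar t aVis & ar w aOut = ar s aOut].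
  by split; rewrite (frm_a F3) // ?ordu ?visu ?outu.
have offw : vr w vOff = vr s vOff by rewrite (frm_v F3).
have oi k l : k < vr w vM -> l < vr w vM -> ar w aOrd k = ar w aOrd l -> k = l.
  by rewrite mw ordw; apply: gr_inj G k l.
have lim1 : vr w vM <= n by rewrite mw.
have lim2 : 0 < vr w vB1 <= vr w vM by rewrite mw -mu.
have lim3 : vr w vOff + vr w vM <= n by rewrite mw offw.
apply: WP_seq; apply: WP_conseq (output_spec E_sym Rw lim1 lim2 fw oi lim3) _.
move=> x F4 _ _ [q [qm qi qa qout qold]].
have offx : vr x vOff = vr s vOff by rewrite (frm_v F4).
have mx : vr x vM = m by rewrite (frm_v F4).
apply: WP_asg; rewrite -[eval _ _ _]/(vr x vOff + vr x vM) offx mx.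
  by move=> _; apply: vbound_large => //; apply: small_bits; lia.
set y := setv _ _ _.
have verw : vertices w = vertices t by rewrite /vertices mw ordw.
rewrite verw in qold.
have outN k : k < m -> ar y aOut (ar t aOrd k) = vr s vOff + q k + 1.
  by rewrite -mw => km; have := qout k km; rewrite ordw offw.
have outO v : v \notin vertices t -> ar y aOut v = ar s aOut v.
  by move=> h; rewrite -[LHS]/(ar x aOut v) qold // outw.
have qlt k : k < m -> q k < m by rewrite -mw; apply: qm.
have old u0 : D u0 -> u0 \notin vertices t.
  by move=> Du; apply/verticesP => -[k km e]; have [_] := gr_new G km; rewrite e Du.
exists D'; split; last 2 first.
- by move=> v; rewrite /D' => ->.
- by rewrite /D' -(gr_root G) mem_vertices ?orbT.
have visx v : ar y aVis v = ar t aVis v by rewrite -[LHS]/(ar x aVis v) (frm_a F4) // visw.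
split.
- by case: glu => g1 g2; split; rewrite -?[vr y _]/(vr x _) -?[ar y _]/(ar x _);
    [rewrite (frm_v F4) // (frm_v F3)|rewrite (frm_a F4) // (frm_a F3)].
- case: stw => h1 h2; split; rewrite -?[vr y _]/(vr x _) -?[ar y _]/(ar x _) -?[tk y]/(tk x).
    by rewrite (frm_v F4) // (frm_tk F4).
  by move=> S; rewrite (frm_v F4) // (frm_a F4).
- by move=> v vn; rewrite visx (gr_vis G vn).
- move=> a b an bn ab /orP[Da|/verticesP[k km e]].
    by rewrite /D' (closed a b).
  by have := clo k b km bn; rewrite e => /(_ ab); rewrite (gr_vis G bn) /D'; case: (_ || _).
- by rewrite -[vr y vOff]/(vr s vOff + m) off cnt.
- move=> a an; rewrite -[vr y vOff]/(vr s vOff + m) => /orP[Da|/verticesP[k km <-]].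
    by rewrite outO ?old //; have := range a an Da; lia.
  by rewrite outN //; have := qlt k km; lia.
- move=> a b an bn /orP[Da|/verticesP[k km <-]] /orP[Db|/verticesP[l lm <-]].
  + by rewrite !outO ?old //; apply: inj.
  + by rewrite outO ?old // outN //; have := range a an Da; lia.
  + by rewrite outN // outO ?old //; have := range b bn Db; lia.
  + rewrite !outN // => e; congr (ar t aOrd _); apply: qi; rewrite ?mw //; lia.
- move=> beta ach a b an bn /orP[Da|/verticesP[k km <-]] /orP[Db|/verticesP[l lm e]] ab.
  + by rewrite !outO ?old //; apply: (opt beta).
  + by have := closed a b an bn ab Da; have [_] := gr_new G lm; rewrite e => /negPf ->.
  + rewrite E_sym in ab; have [kn /negPf Dk] := gr_new G km.
    by have := closed _ _ bn kn ab Db; rewrite Dk.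
  + rewrite -e in ab *; rewrite !outN //.
    have ew : edge E w k l by rewrite /edge ordw.
    have := qa k l; rewrite mw => /(_ km lm ew) h.
    have fe : feasible (vr u vM) (edge E u) beta.+1.
      rewrite mu /edge ordu; apply: (compress (ord := ar t aOrd)) => //.
      * by move=> j jm; case: (gr_new G jm).
      * exact: gr_inj G.
    (* The segment length found is minimal and [beta.+1] is feasible, hence [vB1 <= beta.+1]. *)
    have : ~ (0 < beta.+1 < vr w vB1) by move=> h'; apply: (minw _ h').
    lia.
- have -> : tk y = tk w by rewrite -[tk y]/(tk x) (frm_tk F4).
  rewrite -[vr y vOff]/(vr s vOff + m) mulnDl; apply: leq_trans tkw _.
  by rewrite mu tku leq_add2r.
Qed.

Definition initial s :=
  [/\ forall x, vr s x = 0, forall a i, 0 < a -> ar s a i = 0, tk s = 0 & graph_input n E s].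

Theorem bandwidth_cmd_spec s : initial s ->
  WP bandwidth_cmd (fun t => [/\ tk t <= tick_bound n,
     forall u, u < n -> 0 < ar t 0 u <= n,
     forall u v, u < n -> v < n -> ar t 0 u = ar t 0 v -> u = v &
     forall beta, achievable beta -> forall u v, u < n -> v < n -> E u v ->
       ar t 0 u <= ar t 0 v + beta]) s.
Proof.
case=> v0 a0 t0 inp; rewrite /bandwidth_cmd.
apply: WP_seq; apply: WP_conseq (load_graph_spec inp) _ => s1 F1 _ _ gl.
have sn : vr s1 vN = n by case: gl.
pose I i t := exists2 D, progress D t & forall v, v < i -> v < n -> D v.
apply: WP_seq; apply: (WP_for (I := I)) => //.
- exists pred0 => //; split=> //.
  + by split; rewrite (frm_v F1) // v0 // => S; rewrite (frm_a F1) // a0.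
  + by move=> v _; rewrite (frm_a F1) // a0.
  + by rewrite (frm_v F1) // v0 count_pred0.
  + by rewrite (frm_tk F1) // t0.
- by move=> i t v [D [p1 p2 p3 p4 p5 p6 p7 p8 p9] h]; exists D.
- rewrite sn => i t i_n F ti bt [D P h].
  apply: WP_if; rewrite -[eval _ _ _]/(nat_of_bool (ar t aVis (vr t vI) == 0)) ti.
    rewrite (pr_vis P i_n) eqb0; case: (boolP (D i)) => // Di _.
    apply: WP_conseq (component_spec P _ _) _; rewrite ?ti // => u Fu _ _ [D' [P' sub Di']].
    exists D' => // v; rewrite ltnS leq_eqVlt => /predU1P[-> //|vi] vn.
    by apply: sub; apply: h.
  rewrite (pr_vis P i_n) eqb0; case: (boolP (D i)) => // Di _.
  apply: WP_skip; exists D => // v; rewrite ltnS leq_eqVlt => /predU1P[-> //|vi] vn.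
  exact: h.
rewrite sn => t F _ [D P h].
have tn : vr t vN = n by rewrite (frm_v F).
have Dn v : v < n -> D v by move=> vn; apply: h.
have off : vr t vOff <= n.
  by rewrite (pr_off P) -[leqRHS](size_iota 0 n) count_size.
pose J i u := forall j, j < i -> ar u 0 j = ar t aOut j.
apply: (WP_for (I := J)) => //.
- rewrite tn => i u i_n Fu ui bu Ju.
  have oE : ar u aOut = ar t aOut by rewrite (frm_a Fu).
  apply: WP_put => /=; rewrite ?ui.
  + by move=> _; rewrite /array_base; apply: leq_trans i_n _; nia.
  + by case=> _ _ b; apply: b.
  move=> j; rewrite ltnS leq_eqVlt => /predU1P[->|ji] /=; first by rewrite eqxx oE.
  by rewrite ltn_eqF //; apply: Ju.
- rewrite tn => u Fu bu Ju; split.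
  + rewrite (frm_tk Fu) //; apply: leq_trans (pr_tick P) _; rewrite /tick_bound.
    by move: (vr t vOff) off (state_bound n) => k le_kn S; nia.
  + by move=> v vn; rewrite Ju //; have := pr_range P vn (Dn v vn); lia.
  + by move=> a b an bn; rewrite !Ju //; apply: (pr_inj P) => //; apply: Dn.
  + by move=> beta ach a b an bn ab; rewrite !Ju //; apply: (pr_opt P ach) => //; apply: Dn.
Qed.

End Program.

(** * Asymptotics *)

(** The base [n.+2] is at least 2, so its powers dominate constants even at [n = 0]. *)
Definition poly_bounded (f : nat -> nat) := exists k, forall n, f n <= n.+2 ^ k.

Lemma poly_le f g : (forall n, f n <= g n) -> poly_bounded g -> poly_bounded f.
Proof. by move=> fg [k gk]; exists k => n; apply: leq_trans (gk n). Qed.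

Lemma poly_const c : poly_bounded (fun=> c).
Proof. by exists c => n; apply: leq_trans (ltnW (ltn_expl c (isT : 1 < 2))) _; rewrite leq_exp2r0. Qed.

Lemma poly_id : poly_bounded id.
Proof. by exists 1 => n; rewrite expn1; lia. Qed.

Lemma poly_add f g : poly_bounded f -> poly_bounded g -> poly_bounded (fun n => f n + g n).
Proof.
case=> k fk [l gl]; exists (k + l).+1 => n; rewrite expnS.
apply: (@leq_trans (2 * n.+2 ^ (k + l))); last by rewrite leq_mul2r orbT.
rewrite mul2n -addnn leq_add //.
  by apply: leq_trans (fk n) _; rewrite leq_exp2l // leq_addr.
by apply: leq_trans (gl n) _; rewrite leq_exp2l // leq_addl.
Qed.

Lemma poly_mul f g : poly_bounded f -> poly_bounded g -> poly_bounded (fun n => f n * g n).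
Proof. by case=> k fk [l gl]; exists (k + l) => n; rewrite expnD leq_mul. Qed.

Lemma poly_succ f : poly_bounded f -> poly_bounded (fun n => (f n).+1).
Proof.
by move=> pf; apply: poly_le (poly_add pf (poly_const 1)) => n; rewrite addn1.
Qed.

Ltac poly := repeat first [assumption | exact: poly_const | exact: poly_id
  | apply: poly_add | apply: poly_mul | apply: poly_succ].

Section Costs.
Variables N L : nat -> nat.
Hypotheses (pN : poly_bounded N) (pL : poly_bounded L).

Lemma poly_steps_e e : poly_bounded (fun n => steps_e (N n) e).
Proof. by elim: e => /= *; poly. Qed.

Lemma poly_steps_c c : poly_bounded (fun n => steps_c (N n) c).
Proof. by elim: c => /= *; poly; apply: poly_steps_e. Qed.

Lemma poly_bits_e e : poly_bounded (fun n => bits_e (N n) (L n) e).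
Proof. by elim: e => /= *; poly. Qed.

Lemma poly_bits_c c : poly_bounded (fun n => bits_c (N n) (L n) c).
Proof. by elim: c => /= *; poly; apply: poly_bits_e. Qed.

End Costs.

(* The term of index [k] in the binomial expansion of [(a + b) ^ n] is of order
   [n ^ k * a ^ n]. *)
Lemma poly_exp a b k : 0 < a -> 0 < b ->
  exists C, forall n, 2 * k < n -> n.+2 ^ k * a ^ n <= C * (a + b) ^ n.
Proof.
move=> a0 b0; exists (6 ^ k * k`! * a ^ k) => n kn.
have kn' : k < n.+1 by lia.
have h : n.+2 ^ k <= 6 ^ k * ('C(n, k) * k`!).
  have powE x : x ^ k = \prod_(i < k) x by rewrite prod_nat_const card_ord.
  rewrite bin_ffact ffact_prod !powE -big_split /=.
  by apply: leq_prod => i _; have := ltn_ord i; lia.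
have -> : a ^ n = a ^ k * a ^ (n - k) by rewrite -expnD subnKC; lia.
rewrite Pascal (bigD1 (Ordinal kn')) //= mulnDr; apply: leq_trans (leq_addr _ _).
have b1 : 1 <= b ^ k by rewrite expn_gt0 b0.
move: h b1; move: (n.+2 ^ k) (6 ^ k) 'C(n, k) (k`!) (a ^ k) (a ^ (n - k)) (b ^ k).
move=> x y c f u v w h w1.
apply: (@leq_trans (y * (c * f) * (u * v))); first by rewrite leq_mul2r h orbT.
rewrite (_ : y * f * u * _ = y * (c * f) * (u * v) * w); last by nia.
by rewrite leq_pmulr.
Qed.

Definition word n := bits_c (size_bound n) (bit_bound n) bandwidth_cmd + (bit_bound n).+1.
Definition cells n := array_base n + (index_bound n).+1 * narr.
Definition time_bound n :=
  (5 + steps_c (size_bound n) bandwidth_cmd * (1 + tick_bound n)) * (6 * word n).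
Definition space_bound n := (nregs + cells n) * word n.

Lemma poly_size_bound : poly_bounded size_bound.
Proof. by rewrite /size_bound; poly. Qed.

Lemma poly_bit_bound : poly_bounded bit_bound.
Proof. by rewrite /bit_bound; poly. Qed.

Lemma poly_word : poly_bounded word.
Proof.
apply: poly_add; first exact: poly_bits_c poly_size_bound poly_bit_bound _.
exact: poly_succ poly_bit_bound.
Qed.

Lemma space_bound_le : exists2 p, poly_bounded p & forall n, space_bound n <= p n * 4 ^ n.
Proof.
have := poly_word; rewrite /space_bound; move: word => w pw.
exists (fun n => (nregs + array_base n + 2 * narr) * w n).
  by rewrite /array_base; poly.
move=> n; rewrite mulnAC leq_mul2r; apply/orP; right.
rewrite /cells /index_bound; have := expn_gt0 4 n; move: (4 ^ n) (array_base n) => f g /=.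
by rewrite /nregs /narr; nia.
Qed.

(** The ratio [19 / 4] is kept as a factor on either side so that the estimate stays within the
    naturals. *)
Lemma time_bound_le : exists2 p, poly_bounded p &
  forall n, time_bound n * 4 ^ n <= p n * 19 ^ n.
Proof.
have := poly_word; have := poly_steps_c poly_size_bound bandwidth_cmd.
rewrite /time_bound; move: word => w.
set st := fun n => steps_c (size_bound n) bandwidth_cmd => ps pw.
exists (fun n => (5 + st n * (1 + 6 * (n * n))) * (6 * w n)); first by poly.
move=> n; rewrite -[steps_c _ _]/(st n) [_ * 4 ^ n]mulnAC [_ * 19 ^ n]mulnAC leq_mul2r; apply/orP; right.
have h : state_bound n * 4 ^ n <= 2 * n * 19 ^ n by apply: leq_trunc_div.
have h' : 4 ^ n <= 19 ^ n by case: (n) => // m; rewrite leq_exp2r.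
have k : (1 + tick_bound n) * 4 ^ n <= (1 + 6 * (n * n)) * 19 ^ n.
  by rewrite /tick_bound; move: h h'; move: (4 ^ n) (19 ^ n) (state_bound n) => f g S; nia.
move: k h'; move: (4 ^ n) (19 ^ n) (1 + tick_bound n) (1 + 6 * _) (st n) => f g y z t; nia.
Qed.

Lemma nth_allpairs (S T R : Type) (f : S -> T -> R) x0 y0 z0 s t i j :
  i < size s -> j < size t ->
  nth z0 [seq f x y | x <- s, y <- t] (i * size t + j) = f (nth x0 s i) (nth y0 t j).
Proof.
move=> + jt; elim: s i => //= x s IH [|i] si; rewrite nth_cat size_map.
  by rewrite jt (nth_map y0).
by rewrite mulSn -addnA ltnNge leq_addr /= addKn IH.
Qed.

Lemma onth_size (T : Type) (s : seq T) : onth s (size s) = None.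
Proof. by elim: s. Qed.

Lemma size_bandwidth_program : size bandwidth_program = 5 + size (comp_c 5 bandwidth_cmd).
Proof. exact: (size_cat prologue). Qed.

(** * From the command to the machine program and the theorem *)

Section Correctness.
Variables (n : nat) (e : rel 'I_n).
Hypothesis e_sym : symmetric e.

Definition edge_nat (i j : nat) : bool :=
  if insub i is Some u then if insub j is Some v then e u v else false else false.

Lemma edge_natE (u v : 'I_n) : edge_nat u v = e u v.
Proof. by rewrite /edge_nat !valK. Qed.

Lemma edge_nat_sym i j : edge_nat i j = edge_nat j i.
Proof. by rewrite /edge_nat; case: insubP => [u _ _|_]; case: insubP => //= v _ _; apply: e_sym. Qed.

Lemma size_graph_code : size (graph_code e) = array_base n.
Proof. by rewrite /= size_allpairs !size_enum_ord /array_base addn1. Qed.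

Lemma nth_graph_code i j : i < n -> j < n ->
  nth 0 (graph_code e) (1 + i * n + j) = edge_nat i j.
Proof.
move=> i_n jn; pose u := Ordinal i_n; pose v := Ordinal jn.
have := @nth_allpairs _ _ _ (fun x y => nat_of_bool (e x y)) u v 0 (enum 'I_n) (enum 'I_n) i j.
by rewrite -addnA size_enum_ord (nth_ord_enum u u) (nth_ord_enum v v) -(edge_natE u v) => <-.
Qed.

Definition start : config := Config 0 [::] (graph_code e).

Definition initial_state := State (fun=> 0) (fun a i => if a is 0 then nth 0 (graph_code e) i else 0) 0.

Lemma initial_initial_state : initial n edge_nat initial_state.
Proof.
split=> //; first by case.
by split=> // i j; apply: nth_graph_code.
Qed.

Lemma graph_code_le i : nth 0 (graph_code e) i <= n.
Proof.
case: i => //= i; case: (ltnP i (size [seq nat_of_bool (e x y) | x <- enum 'I_n, y <- enum 'I_n])).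
  move=> h; have /allpairsP[[u v] /= [_ _ ->]] := mem_nth 0 h.
  by have := ltn_ord u; case: (e _ _) => //; lia.
by move=> h; rewrite nth_default.
Qed.

Lemma n_lt : n < 2 ^ bit_bound n.
Proof. by apply: small_lt_exp2; rewrite !expnS expn0; nia. Qed.

Lemma bounded_initial_state : bounded (size_bound n) (bit_bound n) initial_state.
Proof.
split=> [x|x _|a i] //=; rewrite ?expn_gt0 //.
by case: a => [|a]; rewrite ?expn_gt0 //; apply: leq_ltn_trans (graph_code_le i) n_lt.
Qed.

Notation within := (within nregs (word n) (cells n)).
Notation reach := (reach nregs (word n) (cells n) bandwidth_program).

Lemma lt_word x : x < 2 ^ bit_bound n -> x < 2 ^ word n.
Proof. by move/ltn_exp2W; apply; rewrite /word; lia. Qed.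

Lemma word_gt0 : 0 < word n. Proof. by rewrite /word addnS. Qed.

Lemma nregs_le : nregs <= 2 ^ word n.
Proof.
rewrite (_ : nregs = 2 ^ 6) // leq_exp2l // /word /bit_bound; lia.
Qed.

Lemma within_start : within start.
Proof.
split=> //; rewrite ?size_graph_code.
- by move=> x; rewrite /reg nth_default // expn_gt0.
- by rewrite /cells leq_addr.
- by move=> i; apply: lt_word; apply: leq_ltn_trans (graph_code_le i) n_lt.
Qed.

Lemma reach_prologue :
  reach 5 start (fun c => pc c = 5 /\ sim (array_base n) initial_state c).
Proof.
have reg0 x : reg start x = 0 by rewrite /reg nth_default.
have sq : n * n < 2 ^ word n.
  by apply: lt_word; apply: leq_ltn_trans (base_lt n); rewrite leq_addr.
have w2 : 1 < 2 ^ word n by apply: leq_trans nregs_le.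
have bs : array_base n < 2 ^ word n by apply: lt_word; apply: base_lt.
eapply reach_const; [by []|exact: within_start|by []|by lia|move=> ok1].
eapply reach_load; [by []|exact: ok1|by []|rewrite !reg_set eqxx => ok2].
have E0 : cell (set_reg start (tmp 0) 0) 0 = n by [].
rewrite E0 in ok2 *.
eapply reach_op; [by []|exact: ok2|by []|by rewrite !reg_set|rewrite !reg_set => ok3].
rewrite -[eval_binop _ _ _]/(n * n) in ok3 *.
eapply reach_const; [by []|exact: ok3|by []|by []|move=> ok4].
eapply reach_op; [by []|exact: ok4|by []|by rewrite !reg_set|rewrite !reg_set => ok5].
rewrite -[eval_binop _ _ _]/(array_base n) in ok5 *.
apply: reach_done => //; split=> //; split.
- by move=> x xn; rewrite !reg_set reg0 /tmp; do !case: eqP => //; lia.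
- by rewrite reg_set eqxx.
- case=> // a i /andP[_ aN]; rewrite !cell_reg /cell nth_default //.
  by rewrite size_graph_code /addr; lia.
- by [].
Qed.

Lemma bandwidth_program_run : exists t s (c : config),
  [/\ run bandwidth_program start t s c, t <= time_bound n, s <= space_bound n &
    [/\ forall u, u < n -> 0 < nth 0 (memory c) u <= n,
     forall u v, u < n -> v < n -> nth 0 (memory c) u = nth 0 (memory c) v -> u = v &
     forall beta, achievable n edge_nat beta -> forall u v, u < n -> v < n -> edge_nat u v ->
       nth 0 (memory c) u <= nth 0 (memory c) v + beta]].
Proof.
have [s1 [ex b1 [tk1 rng inj opt]]] :=
  bandwidth_cmd_spec edge_nat_sym initial_initial_state bounded_initial_state.
have L_LB : bit_bound n < word n by rewrite /word; lia.
have code : code_at bandwidth_program 5 (comp_c 5 bandwidth_cmd) by move=> i _.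
have [k [c1 [k1 st1 [[pc1 sim1]]]]] : reach (5 + steps_c (size_bound n) bandwidth_cmd * (1 + tick_bound n)) start
    (fun c => (pc c = 5 + size (comp_c 5 bandwidth_cmd) /\ sim (array_base n) s1 c)).
  apply: reach_bind reach_prologue _ => c [pc0 sim0] ok.
  have := comp_cP (base_lt n) (size_bound_lt n) L_LB nregs_le (leqnn _) ex bandwidth_wf code pc0 ok
    sim0 bounded_initial_state bandwidth_depth.
  case=> [|_ _ R]; first by rewrite /word leq_addr.
  apply: (reach_weaken R) => //; rewrite subn0; apply: leq_mul; first exact: time_c_le.
  by rewrite leq_add2l.
have halt : onth bandwidth_program (pc c1) = None.
  by rewrite pc1 -size_bandwidth_program onth_size.
have [t [s [r tT sS]]] := steps_run nregs_le word_gt0 bandwidth_operands st1 halt.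
case: sim1 => _ _ _ mem.
have out u : u < n -> nth 0 (memory c1) u = ar s1 0 u.
  by move=> un; apply: mem; rewrite /array_base; nia.
exists t, s, c1; split=> //.
  by apply: leq_trans tT _; rewrite /time_bound leq_mul2r k1 orbT.
split=> [u un|u v un vn|beta ach u v un vn]; rewrite !out //; [exact: rng|exact: inj|exact: opt].
Qed.

End Correctness.

(** Any ordering [sigma] achieves its own bandwidth, so [opt] applies with that value; using it for
    both directions of an edge gives the absolute difference. *)
Lemma minimum_ordering_of_optimal n (e : rel 'I_n) (pi : nat -> nat) :
  symmetric e ->
  (forall u, u < n -> 0 < pi u <= n) ->
  (forall u v, u < n -> v < n -> pi u = pi v -> u = v) ->
  (forall beta, achievable n (edge_nat e) beta ->
     forall u v, u < n -> v < n -> edge_nat e u v -> pi u <= pi v + beta) ->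
  minimum_ordering e (fun v : 'I_n => pi v).
Proof.
move=> e_sym range inj opt; split.
  split=> [u v /inj h|v]; first by apply/val_inj/h.
  by rewrite card_ord range.
move=> sigma [si _]; set beta := ordering_bandwidth e sigma.
have diff u v : e u v -> sigma u <= sigma v + beta.
  move=> uv; have : `|sigma u - sigma v|%N <= beta.
    apply: leq_trans (leq_bigmax u).
    by apply: (@leq_bigmax_cond _ (e u) (fun v => `|sigma u - sigma v|%N) v).
  by lia.
have ach : achievable n (edge_nat e) beta.
  pose s k := if insub k is Some u then sigma u else 0.
  have sE (u : 'I_n) : s u = sigma u by rewrite /s valK.
  exists s => u v un vn; rewrite -[u]/(val (Ordinal un)) -[v]/(val (Ordinal vn)) !sE.
    by move/si ->.
  by rewrite edge_natE; apply: diff.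
apply/bigmax_leqP => u _; apply/bigmax_leqP => v uv.
have h1 := opt _ ach u v (ltn_ord u) (ltn_ord v); rewrite edge_natE in h1.
have h2 := opt _ ach v u (ltn_ord v) (ltn_ord u); rewrite edge_natE e_sym in h2.
by move: (h1 uv) (h2 uv); lia.
Qed.

Import Order.TTheory GRing.Theory Num.Theory.

Lemma ler_ratio_exp (R : numFieldType) a b n t C : 0 < b ->
  t * b ^ n <= C * a ^ n -> (t%:R <= C%:R * (a%:R / b%:R) ^+ n :> R)%R.
Proof.
move=> b0 h; rewrite expr_div_n mulrA ler_pdivlMr ?exprn_gt0 ?ltr0n //.
by rewrite -!natrX -!natrM ler_nat.
Qed.

Theorem theorem1 :
  exists (P : program) (T Sp : nat -> nat),
    solves_bandwidth P T Sp /\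
    bigO (fun n => (T n)%:R%R) (fun n => ((483 / 100) ^+ n)%R) /\
    bigOstar (fun n => (Sp n)%:R%R) (fun n => (4 ^+ n)%R).
Proof.
exists bandwidth_program, time_bound, space_bound; split; last split.
- move=> n e e_sym _; have [t [s [c [r tT sS [rng inj opt]]]]] := bandwidth_program_run e_sym.
  by exists t, s, c; split=> //; apply: minimum_ordering_of_optimal.
- have [p [k pk] h] := time_bound_le.
  (* [475 / 100] is [19 / 4], and the difference 8 to 483 absorbs the polynomial factor. *)
  have [C hC] := @poly_exp 475 8 k isT isT.
  exists C%:R%R, (2 * k).+1 => n kn.
  (* Everything is scaled to integers: the base [19 / 4] is [1900 / 400] with [1900 = 475 * 4], and
     the target [4.83] is [1932 / 400] with [1932 = 483 * 4]. *)
  have {hC} : time_bound n * 400 ^ n <= C * 1932 ^ n.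
    rewrite (_ : 400 = 4 * 100) // (_ : 1932 = 483 * 4) // !expnMn !mulnA.
    apply: (@leq_trans (n.+2 ^ k * 19 ^ n * 100 ^ n)).
      by rewrite leq_mul2r (leq_trans (h n)) ?orbT // leq_mul2r pk orbT.
    rewrite -mulnA -expnMn (_ : 19 * 100 = 475 * 4) // expnMn mulnA leq_mul2r.
    by rewrite hC ?orbT.
  rewrite (_ : 1932 = 483 * 4) // (_ : 400 = 100 * 4) // !expnMn !mulnA leq_pmul2r ?expn_gt0 //.
  exact: (@ler_ratio_exp _ 483 100).
- have [p [k pk] h] := space_bound_le.
  (* [n + 2 <= 3 * n] from [n = 1] on, so [(n + 2) ^ k <= 3 ^ k * n ^ k]. *)
  exists k, (3 ^ k)%:R%R, 1 => n n1.
  rewrite mulrA -!natrX -!natrM ler_nat; apply: leq_trans (h n) _.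
  rewrite leq_mul2r -expnMn; apply/orP; right; apply: leq_trans (pk n) _.
  by apply: leq_exp2r0; lia.
Qed.
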